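(* Let $\alpha,\beta,q,r$ be real numbers with $$\tfrac13<\alpha\le 1,\quad 0\le\beta\le 1,\quad 3\alpha+2\beta\ge 2,\quad q>\max\Big(3+\frac{2(1+\beta)}{\alpha},\,3+\frac{6\beta}{3\alpha-1}\Big),$$ $$r\in\Big(3,\;3\alpha+2-\frac{3(3\alpha+2\beta-1)}{q}\Big)\cup(5,\infty).$$ Then there exist $\varepsilon_0>0$, depending only on $\alpha,\beta,r,q$, and a constant $C_{r,q}>0$ such that for every $\varepsilon\in(0,\varepsilon_0]$ and every $f_0:\mathbb{R}^3\times\mathbb{R}^3\to\mathbb{R}$ with $f_0\ge 0$, $\|f_0\|_{L^1_2}<\infty$, $\|f_0\|_{w_q}\le\varepsilon^2$ and $\|f_0\|_{W_r}\le\varepsilon^2$, there is a unique mild solution $f$ of the Boltzmann-BGK Cauchy problem $$\partial_t f+v\cdot\nabla_x f=\nu_{\alpha,\beta}(f)\,(\mathcal M(f)-f),\qquad f(0)=f_0,$$ which satisfies all of the following: (i) $f$ is nonnegative; (ii) $\sup_{t\ge0}\|f(t)\|_{w_q}\le\varepsilon$ and $\sup_{t\ge0}\|f(t)\|_{W_r}\le\varepsilon$; (iii) $\nu_{\alpha,\beta}(f)(t,x)\le C_{r,q}\,\varepsilon^{\alpha}\,(1+t^2)^{-\frac{3\alpha}{2}+\frac{3\beta}{q-3}}$ for all $t\ge 0$, $x\in\mathbb{R}^3$; (iv) $\sup_{t\ge0}\|f(t)\|_{L^1_2}\le 2\|f_0\|_{L^1_2}$.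
   Context: Here $t\ge0$ and $x,v\in\mathbb{R}^3$. For a nonnegative function $f(t,x,v)$, the macroscopic density $\rho_f(t,x)$, bulk velocity $U_f(t,x)\in\mathbb{R}^3$ and temperature $T_f(t,x)$ are defined by $$\rho_f=\int_{\mathbb{R}^3} f\,dv,\qquad \rho_fU_f=\int_{\mathbb{R}^3} v f\,dv,\qquad \rho_f(|U_f|^2+3T_f)=\int_{\mathbb{R}^3}|v|^2f\,dv.$$ The local Maxwellian and the collision frequency are $$\mathcal M(f)=\frac{\rho_f}{(2\pi T_f)^{3/2}}\exp\Big(-\frac{|v-U_f|^2}{2T_f}\Big),\qquad \nu_{\alpha,\beta}(f)=\rho_f^{\alpha}T_f^{\beta},$$ with the convention $\mathcal M(f)=0$ and $\nu_{\alpha,\beta}(f)=0$ at points $(t,x)$ where $\rho_f(t,x)=0$. Weights and norms: $w_a(v)=(1+|v|^2)^{a/2}$, $W_a(t,x,v)=(1+|x-vt|^2+|v|^2)^{a/2}$, $$\|f(t)\|_{w_a}=\sup_{x,v}|w_a(v)f(t,x,v)|,\quad \|f(t)\|_{W_a}=\sup_{x,v}|W_a(t,x,v)f(t,x,v)|,\quad \|f(t)\|_{L^1_2}=\int_{\mathbb{R}^6}(1+|v|^2)|f(t,x,v)|\,dx\,dv.$$ For the initial datum $f_0(x,v)$ these norms are taken at $t=0$, so $\|f_0\|_{W_r}=\sup_{x,v}(1+|x|^2+|v|^2)^{r/2}|f_0(x,v)|$. $L^1_2$ is the space of measurable functions on $\mathbb{R}^6$ with finite $\|\cdot\|_{L^1_2}$.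 A mild solution with initial datum $f_0$ is a function $f\in C([0,\infty);L^1_2)$ such that $$f(t,x,v)=f_0(x-vt,v)+\int_0^t\nu_{\alpha,\beta}(f)(s,x-v(t-s))\,(\mathcal M(f)-f)(s,x-v(t-s),v)\,ds$$ for almost every $(t,x,v)\in[0,\infty)\times\mathbb{R}^3\times\mathbb{R}^3$. *)

(* Defs.v *)
From HB Require Import structures.
From mathcomp Require Import all_boot all_order all_algebra.
From mathcomp Require Import all_classical all_reals all_analysis.

Set Implicit Arguments.
Unset Strict Implicit.
Unset Printing Implicit Defensive.

Import Order.TTheory GRing.Theory Num.Theory.
Import numFieldNormedType.Exports.

Local Open Scope classical_set_scope.
Local Open Scope ring_scope.

(* R^3 is R * R * R, which carries the Borel sigma-algebra (as a product) and
   the componentwise vector space structure.  The library norm on a product is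
   the max norm, so the Euclidean |v|^2 is spelled out in sqnorm.

   Elements of L^1_2 are represented by functions R^3 -> R^3 -> R; equality in
   L^1_2 is equality almost everywhere and is written out where it is needed.
   The sup norms are suprema over all points, not essential suprema. *)

Definition R3 (R : realType) := (R * R * R)%type.

(* The library finds a sigma-finite structure on m1 \x m2 only for
   subprobabilities m1 and m2; this lemma supplies it for Lebesgue measure. *)
Lemma sigma_finite_product d1 d2 (T1 : measurableType d1)
    (T2 : measurableType d2) (R : realType)
    (m1 : {sigma_finite_measure set T1 -> \bar R})
    (m2 : {sigma_finite_measure set T2 -> \bar R}) :
  sigma_finite [set: T1 * T2] (m1 \x m2)%E.
Proof.
have /sigma_finiteP[F [TF ndF Foo]] := sigma_finiteT m1.
have /sigma_finiteP[G [TG ndG Goo]] := sigma_finiteT m2.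
exists (fun n => F n `*` G n).
  rewrite -setXTT TF TG predeqE => -[x y]; split.
    move=> [/= [n _ Fnx] [k _ Gky]]; exists (maxn n k) => //; split.
    - by move: x Fnx; exact/subsetPset/ndF/leq_maxl.
    - by move: y Gky; exact/subsetPset/ndG/leq_maxr.
  by move=> [n _ []/= ? ?]; split; exists n.
move=> k; have [? ?] := Foo k; have [? ?] := Goo k.
split; first exact: measurableX.
by rewrite product_measure1E// lte_mul_pinfty// ge0_fin_numE.
Qed.

Section Kinetic.
Context {R : realType}.

Local Notation R3 := (R3 R).
Local Notation leb := (@lebesgue_measure R).

Definition leb2 := (leb \x leb)%E.
HB.instance Definition _ := Measure.on leb2.
HB.instance Definition _ := @Measure_isSigmaFinite.Build _ _ _ leb2
  (sigma_finite_product leb leb).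

Definition leb3 := (leb2 \x leb)%E.
HB.instance Definition _ := Measure.on leb3.
HB.instance Definition _ := @Measure_isSigmaFinite.Build _ _ _ leb3
  (sigma_finite_product leb2 leb).

Definition leb6 := (leb3 \x leb3)%E.
HB.instance Definition _ := Measure.on leb6.
HB.instance Definition _ := @Measure_isSigmaFinite.Build _ _ _ leb6
  (sigma_finite_product leb3 leb3).

Definition leb_txv := (leb \x leb6)%E.
HB.instance Definition _ := Measure.on leb_txv.
HB.instance Definition _ := @Measure_isSigmaFinite.Build _ _ _ leb_txv
  (sigma_finite_product leb leb6).

Definition sqnorm (v : R3) : R := v.1.1 ^+ 2 + v.1.2 ^+ 2 + v.2 ^+ 2.

Section Moments.
Variable g : R3 -> R.

Definition rho : R := \int[leb3]_v g v.

(* The defining relations rho * U = int v g and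
   rho * (|U|^2 + 3 T) = int |v|^2 g, solved for U and T.  At rho = 0 the
   convention 0^-1 = 0 makes U and T equal to 0; these values are never used,
   since maxwellian and collision_freq treat rho = 0 separately. *)
Definition bulk_velocity : R3 :=
  rho^-1 *: (\int[leb3]_v (v.1.1 * g v),
             \int[leb3]_v (v.1.2 * g v),
             \int[leb3]_v (v.2 * g v)).

Definition temperature : R :=
  (rho^-1 * \int[leb3]_v (sqnorm v * g v) - sqnorm bulk_velocity) / 3.

Definition maxwellian (v : R3) : R :=
  if rho == 0 then 0 else
  rho / (2 * pi * temperature) `^ (3 / 2)
  * expR (- (sqnorm (v - bulk_velocity) / (2 * temperature))).

Definition collision_freq (alpha beta : R) : R :=
  if rho == 0 then 0 else rho `^ alpha * temperature `^ beta.

End Moments.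

Definition weight_w (a : R) (v : R3) : R := (1 + sqnorm v) `^ (a / 2).

Definition weight_W (a t : R) (x v : R3) : R :=
  (1 + sqnorm (x - t *: v) + sqnorm v) `^ (a / 2).

Definition norm_w (a : R) (h : R3 -> R3 -> R) : \bar R :=
  ereal_sup [set `|weight_w a z.2 * h z.1 z.2|%:E | z in [set: R3 * R3]].

Definition norm_W (a t : R) (h : R3 -> R3 -> R) : \bar R :=
  ereal_sup [set `|weight_W a t z.1 z.2 * h z.1 z.2|%:E | z in [set: R3 * R3]].

Definition norm_L12 (h : R3 -> R3 -> R) : \bar R :=
  (\int[leb6]_z ((1 + sqnorm z.2) * `|h z.1 z.2|)%:E)%E.

Definition in_L12 (h : R3 -> R3 -> R) : Prop :=
  measurable_fun [set: R3 * R3] (fun z : R3 * R3 => h z.1 z.2) /\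
  (norm_L12 h < +oo)%E.

Definition eq_L12 (g h : R3 -> R3 -> R) : Prop :=
  \forall z \ae leb6, g z.1 z.2 = h z.1 z.2.

Definition nonneg_times : set R := [set t | 0 <= t].

Definition sup_time (N : R -> \bar R) : \bar R :=
  ereal_sup [set N t | t in nonneg_times].

(* Membership in C([0, oo); L^1_2), for a jointly measurable representative,
   so that the time integral of the mild formulation makes sense.  Values of f
   at negative times are irrelevant throughout. *)
Definition continuous_L12 (f : R -> R3 -> R3 -> R) : Prop :=
  [/\ measurable_fun
        ([set p | 0 <= p.1] : set (R * (R3 * R3)))
        (fun p : R * (R3 * R3) => f p.1 p.2.1 p.2.2),
      forall t, 0 <= t -> in_L12 (f t) &
      forall t0, 0 <= t0 ->
        norm_L12 (fun x v => f t x v - f t0 x v)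
          @[t --> within nonneg_times (nbhs t0)] --> 0%E].

Definition collision (alpha beta : R) (f : R -> R3 -> R3 -> R)
    (t : R) (x v : R3) : R :=
  collision_freq (f t x) alpha beta * (maxwellian (f t x) v - f t x v).

(* Rintegral takes a junk value on non-integrable functions, hence the explicit
   integrability along almost every characteristic. *)
Definition mild_solution (alpha beta : R) (f0 : R3 -> R3 -> R)
    (f : R -> R3 -> R3 -> R) : Prop :=
  continuous_L12 f /\
  \forall p \ae leb_txv,
    let: (t, (x, v)) := p in
    let along s := collision alpha beta f s (x - (t - s) *: v) v in
    0 <= t ->
    leb.-integrable `[0, t] (EFin \o along) /\
    f t x v = f0 (x - t *: v) v + \int[leb]_(s in `[0, t]) along s.

End Kinetic.

(* Main.v *)
Require Import Defs.
From mathcomp Require Import all_boot all_order all_algebra.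
From mathcomp Require Import all_classical all_reals all_analysis.
From mathcomp Require Import measurable_realfun ring lra.
Import Order.TTheory GRing.Theory Num.Theory.
Import numFieldNormedType.Exports.
Set Implicit Arguments.
Unset Strict Implicit.
Unset Printing Implicit Defensive.
Local Open Scope classical_set_scope.
Local Open Scope ring_scope.

(** The equation is a perturbation of free transport in which the collisions
    die out at an integrable rate.

    Weights.  For fixed [t] and [x] the weight [1 + |x - tv|^2 + |v|^2] equals
    [1 + |x|^2 / s + s |v - c|^2] with [s = 1 + t^2] and [c = (t / s) x]
    ([weight_WE]).  A bound by [eps] in this weight is therefore a bound in a
    bracket of width [s^(-1/2)] in velocity, and gives [rho <= C eps s^(-3/2)]
    ([rho_decay]).  The weight [w_q] controls a high moment: with
    [Y = 1 + |U|^2 + 3 T] one has [rho Y^((q - 3) / 2) <= C eps] ([dclass_Y]).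
    Interpolating between the two, [nu <= C eps^alpha (1 + t)^(- p)] with
    [p > 1], by the lower bound on [q] ([decay_nu], [rate_p1]).  The Maxwellian
    of [f] inherits the weighted bounds of [f] up to a constant
    ([maxwellian_weight]).  For [r <= 5] the weight [W_r] does not control the
    temperature, and the decay of [nu] has to pay for it; this is where the
    upper bound on [r] comes from ([rate_p2]).  [decay_rates] collects these
    bounds.

    Lipschitz estimate.  In the distance of [L^1((1 + |v|^2) dv)] the fields
    [U] and [T] are Lipschitz only after multiplication by [rho], and Gaussians
    are Lipschitz functions of [U] and [T] only relative to [T].  What pays for
    both losses is [rho^alpha T^(beta - 1) Y^2 <= K] ([key_bound]).  It holds
    because a profile with a bounded weight cannot concentrate: its mass is at
    most a constant times [T^(3/2)] times its supremum near [U]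
    ([concentration]).  Hence [f |-> nu(f) (M(f) - f)] is Lipschitz for the norm
    of [L^1_2] ([coll_lip], [norm_L12_coll]).

    Existence.  Let [lam] be the integrable majorant [eta (1 + t)^(- p)] of
    [nu].  Adding [lam f] to both sides of the equation leaves the nonnegative
    source [gain f = nu M + (lam - nu) f], whose weighted norms are at most
    [2 lam eps].  As the integral of [lam] is of order [eps^alpha], hence small,
    the Duhamel map [Phi] of the damped equation preserves nonnegativity, both
    weighted bounds and the bound [2 |f0|] in [L^1_2] ([admissible_Phi],
    [norm_L12_Phi]).  It halves distances measured with the factor
    [expR (- 2 K t)] ([Phi_contractK]), so that its iterates converge.  The image
    [sol] of their limit is the solution: Duhamel's formula for the damped
    equation yields the mild formulation ([duh_mild]), and [sol]
    follows free transport up to a Lipschitz error in [L^1_2], which makes it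
    continuous because free transport is ([continuous_L12_of_steps],
    [transport_cvg0]).

    Uniqueness.  The distance [D] of two solutions satisfies
    [D t <= K * int_0^t D] for almost every [t]; the halving step that makes
    [Phi] contract then gives [D = 0] almost everywhere, and continuity gives
    every time ([mild_solution_unique]). *)

(** * Integrals over [R^3] *)

Section affine.
Context {R : realType}.
Local Notation leb := (@lebesgue_measure R).

Lemma leb_affine (k : R -> \bar R) (s c : R) : 0 < s ->
  measurable_fun [set: R] k -> (forall y, 0 <= k y)%E ->
  (\int[leb]_y k (s * (y - c))%R = (s^-1)%:E * \int[leb]_y k y)%E.
Proof.
move=> s0 mk k0.
pose phi y : measurableTypeR R := s * (y - c).
have mphi : measurable_fun [set: R] phi.
  apply: measurable_funM => //; exact: measurable_funB.
pose m := mscale (NngNum (ltW s0)) (pushforward leb phi).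
have H A : measurable A -> leb A = m mphi A.
  apply: lebesgue_measure_unique => X [[a b] _ <-].
  change (leb `]a, b] = s%:E * leb (phi @^-1` `]a, b]))%E.
  have -> : phi @^-1` `]a, b] = `](a/s+c), (b/s+c)]%classic.
    apply/seteqP; split => y /=; rewrite !in_itv /= -ltrBrDr -lerBlDr ltr_pdivrMr// ler_pdivlMr// [(y - c) * s]mulrC //.
  rewrite !lebesgue_measure_itv /= !lte_fin ltrD2r ltr_pM2r ?invr_gt0//.
  case: ifP => _; last by rewrite mule0.
  by rewrite -!EFinD -EFinM; congr EFin; field; rewrite gt_eqF.
rewrite [X in (_ * X)%E](@eq_measure_integral _ _ _ _ (m mphi) leb); last first.
  by move=> A mA _; exact: H.
rewrite ge0_integral_mscale // ge0_integral_pushforward//.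
by rewrite muleA -EFinM mulVf ?gt_eqF// mul1e preimage_setT.
Qed.
End affine.

Section leb3_integrals.
Context {R : realType}.
Local Notation leb := (@lebesgue_measure R).

Lemma leb_translate (k : R -> \bar R) (c : R) :
  measurable_fun [set: R] k -> (forall y, 0 <= k y)%E ->
  (\int[leb]_y k (y - c)%R = \int[leb]_y k y)%E.
Proof.
move=> mk k0; have := @leb_affine R k 1 c ltr01 mk k0.
by rewrite invr1 mul1e => <-; apply: eq_integral => y _; rewrite mul1r.
Qed.

Lemma measurable_R3 d (T : measurableType d) (f1 f2 f3 : T -> R) :
  measurable_fun [set: T] f1 -> measurable_fun [set: T] f2 ->
  measurable_fun [set: T] f3 ->
  measurable_fun [set: T] (fun z => ((f1 z, f2 z), f3 z) : R3 R).
Proof. by move=> ? ? ?; do 2 apply: measurable_fun_pair => //. Qed.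

Section comps.
Context d (T : measurableType d) (f g : T -> R3 R).
Hypothesis mf : measurable_fun [set: T] f.
Hypothesis mg : measurable_fun [set: T] g.

Lemma measurable_R3_1 : measurable_fun [set: T] (fun z => (f z).1.1 : R).
Proof. by apply: measurableT_comp => //; apply: measurableT_comp. Qed.
Lemma measurable_R3_2 : measurable_fun [set: T] (fun z => (f z).1.2 : R).
Proof. by apply: measurableT_comp => //; apply: measurableT_comp. Qed.
Lemma measurable_R3_3 : measurable_fun [set: T] (fun z => (f z).2 : R).
Proof. by apply: measurableT_comp => //; apply: measurableT_comp. Qed.
End comps.

Section comps.
Context d (T : measurableType d) (f g : T -> R3 R) (a : T -> R).
Hypothesis mf : measurable_fun [set: T] f.
Hypothesis mg : measurable_fun [set: T] g.
Hypothesis ma : measurable_fun [set: T] a.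

Lemma measurable_R3B : measurable_fun [set: T] (fun z => f z - g z : R3 R).
Proof.
apply: (@measurable_R3 _ _ (fun z => (f z).1.1 - (g z).1.1)
  (fun z => (f z).1.2 - (g z).1.2) (fun z => (f z).2 - (g z).2));
  apply: measurable_funB; (exact: measurable_R3_1 || exact: measurable_R3_2 || exact: measurable_R3_3).
Qed.
Lemma measurable_R3Z : measurable_fun [set: T] (fun z => a z *: f z : R3 R).
Proof.
apply: (@measurable_R3 _ _ (fun z => a z * (f z).1.1)
  (fun z => a z * (f z).1.2) (fun z => a z * (f z).2));
  apply: measurable_funM => //; (exact: measurable_R3_1 || exact: measurable_R3_2 || exact: measurable_R3_3).
Qed.
Lemma measurable_sqnorm : measurable_fun [set: T] (fun z => sqnorm (f z)).
Proof.
rewrite /sqnorm; apply: measurable_funD; first apply: measurable_funD; apply: measurable_funX;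
 (exact: measurable_R3_1 || exact: measurable_R3_2 || exact: measurable_R3_3).
Qed.
End comps.

Lemma measurable_integral2 d1 d2 (T1 : measurableType d1) (T2 : measurableType d2)
    (m2 : {sigma_finite_measure set T2 -> \bar R}) (f : T1 -> T2 -> \bar R) :
  measurable_fun [set: T1 * T2] (fun z => f z.1 z.2) ->
  (forall x y, 0 <= f x y)%E ->
  measurable_fun [set: T1] (fun x => \int[m2]_y f x y)%E.
Proof.
by move=> mf f0; have := @measurable_fun_fubini_tonelli_F _ _ _ _ _ m2 _ mf (fun=> f0 _ _).
Qed.

Lemma int_leb3E (k : R3 R -> \bar R) :
  measurable_fun [set: R3 R] k -> (forall v, 0 <= k v)%E ->
  (\int[leb3]_v k v =
   \int[leb]_a \int[leb]_b \int[leb]_c k ((a, b), c))%E.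
Proof.
move=> mk k0; rewrite [LHS]fubini_tonelli1// [LHS]fubini_tonelli1//.
- by apply: measurable_fun_fubini_tonelli_F.
- by move=> x; exact: integral_ge0.
Qed.

Lemma leb3_affine (k : R3 R -> \bar R) (s : R) (c : R3 R) : 0 < s ->
  measurable_fun [set: R3 R] k -> (forall v, 0 <= k v)%E ->
  (\int[leb3]_v k (s *: (v - c))%R = (s^-1 ^+ 3)%:E * \int[leb3]_v k v)%E.
Proof.
move=> s0 mk k0.
have mF : measurable_fun [set: R * R] (fun z => \int[leb]_y k (z, y))%E.
  by apply: measurable_fun_fubini_tonelli_F.
have mF2 : measurable_fun [set: R] (fun a => \int[leb]_b \int[leb]_y k ((a,b), y))%E.
  apply: (@measurable_integral2 _ _ _ _ leb (fun a b => \int[leb]_y k ((a,b), y))%E) => //.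
    by apply: (measurableT_comp mF); apply: measurable_fun_pair.
  by move=> x ?; exact: integral_ge0.
rewrite !int_leb3E//; last first.
  apply: measurableT_comp => //; apply: measurable_R3Z => //; apply: measurable_R3B => //.
have -> : (s^-1 ^+ 3)%:E = (s^-1%:E * (s^-1%:E * s^-1%:E))%E.
  by rewrite -!EFinM; congr EFin; ring.
rewrite -!muleA -(leb_affine c.1.1)//; last first.
  by move=> ?; apply: integral_ge0 => ? _; apply: integral_ge0.
have mA : measurable_fun [set: R] (fun a : R => s * (a - c.1.1)).
  by apply: measurable_funM => //; exact: measurable_funB.
have mB : measurable_fun [set: R] (fun a : R => s * (a - c.1.2)).
  by apply: measurable_funM => //; exact: measurable_funB.
have s1 : (0 <= s^-1%:E)%E by rewrite lee_fin invr_ge0 ltW.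
have mI : measurable_fun [set: R]
    (fun y : R => (\int[leb]_b \int[leb]_c0 k ((s * (y - c.1.1))%R, b, c0)))%E.
  exact: (measurableT_comp mF2).
rewrite -ge0_integralZl//; last first.
  by move=> ? _; apply: integral_ge0 => ? _; apply: integral_ge0.
rewrite -ge0_integralZl//; last 2 first.
- by apply: emeasurable_funM.
- by move=> ? _; rewrite mule_ge0//; apply: integral_ge0 => ? _; apply: integral_ge0.
apply: eq_integral => a _.
rewrite -(leb_affine c.1.2)//; last 2 first.
- by apply: (measurableT_comp mF); apply: measurable_fun_pair => //.
- by move=> ?; apply: integral_ge0.
rewrite -ge0_integralZl//; last 2 first.
- by apply: (measurableT_comp mF); apply: measurable_fun_pair.
- by move=> ? _; apply: integral_ge0.
apply: eq_integral => b _; rewrite -(leb_affine c.2)//.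
by apply: (measurableT_comp mk); apply: measurable_fun_pair.
Qed.
End leb3_integrals.

(** * Integrability of negative powers of 1 + |v|^2 *)

Section brackets1.
Context {R : realType}.
Local Notation leb := (@lebesgue_measure R).

Lemma is_derive_powR1D (a y : R) : - 1 < y ->
  is_derive y 1 (fun z => (1 + z) `^ a) (a * (1 + y) `^ (a - 1)).
Proof.
move=> y1; have y0 : 0 < 1 + y by rewrite -ltrBlDl sub0r.
have H : is_derive y 1 (fun z : R => 1 + z) (0 + 1) by apply: is_deriveD.
rewrite add0r in H.
have := @is_derive1_comp R (fun z => z `^ a) (fun z => 1 + z) y _ 1 (is_derive1_powR a y0) H.
by rewrite mulr1; exact.
Qed.

Lemma cvg_powR1D_neg (a : R) : a < 0 -> (1 + z) `^ a @[z --> +oo] --> 0.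
Proof.
move=> a0; apply: (@cvg_trans _ (expR (- (- a * ln (1 + z))) @[z --> +oo])).
  apply: near_eq_cvg; near=> z.
  have z0 : 0 < 1 + z by rewrite ltr_wpDr//; near: z; exact: nbhs_pinfty_ge.
  by rewrite /powR gt_eqF// mulNr opprK.
apply: (@cvg_comp _ _ _ (fun z => - a * ln (1 + z)) (fun z => expR (- z)) _ (@pinfty_nbhs R)); last exact: cvgr_expR.
apply/cvgryPgt => A; near=> z.
have z0 : 0 < 1 + z by rewrite ltr_wpDr//; near: z; exact: nbhs_pinfty_ge.
rewrite -ltr_pdivrMl ?oppr_gt0// -ltr_expR lnK ?posrE//.
rewrite ltr_pwDl//; near: z; apply: nbhs_pinfty_ge; exact: num_real.
Unshelve. all: by end_near. Qed.

Lemma cts_powR1D (a y : R) : -1 < y -> {for y, continuous (fun z : R => (1 + z) `^ a)}.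
Proof.
move=> y1; apply: differentiable_continuous; apply/derivable1_diffP.
by have [] := is_derive_powR1D a y1.
Qed.

(** The primitive is [(1 + y)^(1 - p) / (1 - p)], which tends to 0 at infinity. *)
Lemma int_powR1D (p : R) : 1 < p ->
  (\int[leb]_(y in `[0%R, +oo[) ((1 + y) `^ (- p))%:E = ((p - 1)^-1)%:E)%E.
Proof.
move=> p1; have p10 : 0 < p - 1 by rewrite subr_gt0.
pose F y : R := - (p - 1)^-1 * (1 + y) `^ (1 - p).
have dF (y : R) : -1 < y -> is_derive y 1 F ((1 + y) `^ (- p)).
  move=> y1; have H := is_derive_powR1D (1 - p) y1.
  apply: (@is_derive_eq _ _ _ F y 1 _ _ (@is_deriveZ _ _ _ _ (- (p - 1)^-1) _ _ _ H)).
  have -> : 1 - p - 1 = - p by ring.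
  by rewrite /GRing.scale /= mulrA -[1 - p]opprB mulrNN mulVf ?mul1r// gt_eqF.
rewrite (@ge0_continuous_FTC2y _ _ F 0 0)//.
- by rewrite /F addr0 powR1 mulr1 sub0e EFinN oppeK.
- by move=> *; exact: powR_ge0.
- apply/continuous_within_itvcyP; split.
    move=> y; rewrite in_itv/= andbT => y0; apply: cts_powR1D; lra.
  by apply: cvg_at_right_filter; apply: cts_powR1D; lra.
- rewrite -(mulr0 (- (p - 1)^-1)); apply: cvgMr; apply: cvg_powR1D_neg; lra.
- by move=> x x0; have [] : is_derive x 1 F ((1 + x) `^ (- p)) by apply: dF; lra.
- apply: cvg_at_right_filter; apply: differentiable_continuous; apply/derivable1_diffP.
  by have [] : is_derive (0 : R) 1 F ((1 + 0) `^ (- p)) by apply: dF; lra.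
- move=> x; rewrite in_itv/= andbT => x0; rewrite derive1E.
  by have [_ ->] : is_derive x 1 F ((1 + x) `^ (- p)) by apply: dF; lra.
Qed.

Lemma powRN_antitone (a x y : R) : 0 <= a -> 0 < x -> x <= y ->
  y `^ (- a) <= x `^ (- a).
Proof.
move=> a0 x0 xy; rewrite !powRN lef_pV2 ?posrE ?powR_gt0// ?ge0_ler_powR ?nnegrE//; lra.
Qed.

Lemma bracket1_ge (y : R) : 0 <= y -> 2^-1 * (1 + y) ^+ 2 <= 1 + y ^+ 2.
Proof. by move=> y0; have := sqr_ge0 (y - 1); lra. Qed.

Lemma bracket1_powR (p y : R) : 0 <= p -> 0 <= y ->
  (1 + y ^+ 2) `^ (- (p / 2)) <= 2 `^ (p / 2) * (1 + y) `^ (- p).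
Proof.
move=> p0 y0; apply: le_trans (powRN_antitone _ _ (bracket1_ge y0)) _.
- by rewrite divr_ge0.
- by rewrite mulr_gt0// exprn_gt0//; lra.
rewrite powRM ?exprn_ge0//; try lra.
have -> : 2^-1 `^ (- (p / 2)) = 2 `^ (p / 2) :> R.
  by rewrite -[2^-1]powR_inv1// -powRrM mulN1r opprK.
rewrite ler_wpM2l ?powR_ge0// -powR_mulrn; last lra.
by rewrite -powRrM; have -> : 2%:R * - (p / 2) = - p by field.
Qed.

Lemma measurable_powRl d (T : measurableType d) (f : T -> R) a D :
  measurable_fun D f -> measurable_fun D (fun x => f x `^ a).
Proof. by move=> mf; apply: (measurableT_comp (measurable_powR a)). Qed.

Lemma measurable_bracket1 (a : R) : measurable_fun [set: R] (fun y => (1 + y ^+ 2) `^ a).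
Proof.
by apply: measurable_powRl; apply: measurable_funD => //; exact: measurable_funX.
Qed.

Lemma int_bracket1 (p : R) : 1 < p ->
  (\int[leb]_y ((1 + y ^+ 2) `^ (- (p / 2)))%:E < +oo)%E.
Proof.
move=> p1.
have mf : measurable_fun [set: R] (fun y => (1 + y ^+ 2) `^ (- (p / 2)) : R) by exact: measurable_bracket1.
have mg : measurable_fun [set: R] (fun y : R => (1 + y) `^ (- p)).
  by apply: measurable_powRl; exact: measurable_funD.
rewrite ge0_symfun_integralT; first last.
- by move=> y /=; rewrite sqrrN.
- move=> y; apply: (@continuous_comp _ _ _ (fun x : R => 1 + x ^+ 2) (fun x => x `^ _)); last first.
    apply: differentiable_continuous; apply/derivable1_diffP.
    have y0 : 0 < 1 + y ^+ 2 by rewrite ltr_wpDr// sqr_ge0.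
    by have [] := is_derive1_powR (- (p / 2)) y0.
  by apply: cvgD; [exact: cvg_cst|exact: exprn_continuous].
- by move=> *; exact: powR_ge0.
rewrite -set_itvcy; apply: (@le_lt_trans _ _ (2%:E * ((2 `^ (p/2))%:E * ((p-1)^-1)%:E))%E); last by rewrite -!EFinM ltry.
rewrite lee_pmul2l//= -(int_powR1D p1) -ge0_integralZl//; last 2 first.
- by apply/measurable_EFinP; exact: measurable_funTS.
- by move=> ? _; rewrite lee_fin powR_ge0.
apply: ge0_le_integral => //=.
- by move=> *; rewrite lee_fin powR_ge0.
- by apply/measurable_EFinP; exact: measurable_funTS.
- by apply/measurable_EFinP; apply: measurable_funM => //; exact: measurable_funTS.
- move=> y; rewrite in_itv /= andbT => y0; rewrite lee_fin; apply: bracket1_powR => //; lra.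
Qed.
End brackets1.

Section brackets3.
Context {R : realType}.
Local Notation leb := (@lebesgue_measure R).
Local Notation R3 := (R3 R).

Lemma sqnorm_ge0 (v : R3) : 0 <= sqnorm v.
Proof. by rewrite /sqnorm !addr_ge0// sqr_ge0. Qed.

(** Splits the bracket into a product of three one-dimensional ones, so that its integral is a
    product; the exponent [r / 3] is above 1 exactly when [r > 3]. *)
Lemma bracket3_le (r : R) (v : R3) : 0 <= r ->
  (1 + sqnorm v) `^ (- (r / 2)) <=
  (1 + v.1.1 ^+ 2) `^ (- (r / 3 / 2)) * (1 + v.1.2 ^+ 2) `^ (- (r / 3 / 2)) *
  (1 + v.2 ^+ 2) `^ (- (r / 3 / 2)).
Proof.
move=> r0.
have -> : - (r / 2) = - (r / 3 / 2) + - (r / 3 / 2) + - (r / 3 / 2) by field.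
have p0 : 0 < 1 + sqnorm v by rewrite ltr_wpDr// sqnorm_ge0.
have a0 : 0 <= r / 3 / 2 by rewrite !divr_ge0.
have [s1 s2 s3] : [/\ 0 <= v.1.1 ^+ 2, 0 <= v.1.2 ^+ 2 & 0 <= v.2 ^+ 2] by split; exact: sqr_ge0.
rewrite !powRD; try by rewrite (gt_eqF p0) implybT.
rewrite !ler_pM ?mulr_ge0 ?powR_ge0//; apply: powRN_antitone => //; rewrite /sqnorm; lra.
Qed.

Lemma measurable_bracket3 d (T : measurableType d) (f : T -> R3) (a : R) :
  measurable_fun [set: T] f -> measurable_fun [set: T] (fun z => (1 + sqnorm (f z)) `^ a).
Proof.
by move=> mf; apply: measurable_powRl; apply: measurable_funD => //; exact: measurable_sqnorm.
Qed.

Lemma int_bracket3 (r : R) : 3 < r ->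
  (\int[leb3]_v ((1 + sqnorm v) `^ (- (r / 2)))%:E < +oo)%E.
Proof.
move=> r3; pose f y : R := (1 + y ^+ 2) `^ (- (r / 3 / 2)).
have mf : measurable_fun [set: R] f by exact: measurable_bracket1.
have f0 y : 0 <= f y by exact: powR_ge0.
have fi : (\int[leb]_y (f y)%:E < +oo)%E by apply: int_bracket1; rewrite ltr_pdivlMr//; lra.
have fi0 : (0 <= \int[leb]_y (f y)%:E)%E by apply: integral_ge0 => y _; rewrite lee_fin.
apply: (@le_lt_trans _ _ (\int[leb3]_v (f v.1.1 * f v.1.2 * f v.2)%:E)%E).
  apply: ge0_le_integral => //.
  - by move=> *; rewrite lee_fin powR_ge0.
  - by apply/measurable_EFinP; apply: measurable_bracket3.
  - apply/measurable_EFinP; apply: measurable_funM; first apply: measurable_funM;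
    apply: (measurableT_comp mf); (exact: measurable_R3_1 || exact: measurable_R3_2 || exact: measurable_R3_3).
  - by move=> v _; rewrite lee_fin; apply: bracket3_le; lra.
rewrite int_leb3E; last 2 first.
- apply/measurable_EFinP; apply: measurable_funM; first apply: measurable_funM;
    apply: (measurableT_comp mf); (exact: measurable_R3_1 || exact: measurable_R3_2 || exact: measurable_R3_3).
- by move=> v; rewrite lee_fin !mulr_ge0.
set A := (\int[leb]_y (f y)%:E)%E in fi fi0.
have fiA : A \is a fin_num by rewrite ge0_fin_numE.
apply: (@le_lt_trans _ _ (A * A * A)%E); last by rewrite ltey_eq !fin_numM.
rewrite le_eqVlt; apply/orP; left; apply/eqP.
have mfE : measurable_fun [set: R] (fun y => (f y)%:E) by apply/measurable_EFinP.
transitivity (\int[leb]_a ((f a)%:E * (A * A)))%E; last first.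
  by rewrite ge0_integralZr// ?mule_ge0 ?muleA// => ? _; rewrite lee_fin.
apply: eq_integral => a _.
transitivity (\int[leb]_b ((f a)%:E * ((f b)%:E * A)))%E; last first.
  rewrite ge0_integralZl//; last 3 first.
  - by apply: emeasurable_funM.
  - by move=> ? _; rewrite mule_ge0// lee_fin.
  - by rewrite lee_fin.
  by rewrite ge0_integralZr// => ? _; rewrite lee_fin.
apply: eq_integral => b _; rewrite muleA -EFinM -ge0_integralZl//.
- by move=> ? _; rewrite lee_fin.
- by rewrite lee_fin mulr_ge0.
Qed.

(** The integral over [R^3] of the Japanese bracket [(1 + |v|^2)^(1/2)] to the power [- r]. *)
Definition japint (r : R) : R := \int[leb3]_v ((1 + sqnorm v) `^ (- (r / 2))).

Lemma sqnormZ (s : R) (v : R3) : sqnorm (s *: v) = s ^+ 2 * sqnorm v.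
Proof. by rewrite /sqnorm /= !exprMn -!mulrDr. Qed.

Definition ii (f : R3 -> R) := leb3.-integrable setT (EFin \o f).

Lemma iiP (f : R3 -> R) : measurable_fun [set: R3] f -> (forall v, 0 <= f v) ->
  (\int[leb3]_v (f v)%:E < +oo)%E -> ii f.
Proof.
move=> mf f0 fi; apply/integrableP; split; first exact/measurable_EFinP.
by under eq_integral do rewrite /= ger0_norm//.
Qed.

Lemma ii_measurable (f : R3 -> R) : ii f -> measurable_fun [set: R3] f.
Proof. by move=> /integrableP[/measurable_EFinP]. Qed.

Lemma EFin_I3 (f : R3 -> R) : ii f -> (\int[leb3]_v (f v))%:E = (\int[leb3]_v (f v)%:E)%E.
Proof. by move=> fi; rewrite /Rintegral fineK//; apply: integrable_fin_num. Qed.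

Lemma ii_le (f g : R3 -> R) : measurable_fun [set: R3] f ->
  (forall v, `|f v| <= g v) -> ii g -> ii f.
Proof.
move=> mf fg gi; apply: (le_integrable _ _ _ gi) => //; first exact/measurable_EFinP.
by move=> v _ /=; rewrite lee_fin (le_trans (fg v))// ler_norm.
Qed.

Lemma iiD (f g : R3 -> R) : ii f -> ii g -> ii (fun v => f v + g v).
Proof. by move=> fi gi; have := integrableD measurableT fi gi. Qed.

Lemma iiB (f g : R3 -> R) : ii f -> ii g -> ii (fun v => f v - g v).
Proof. by move=> fi gi; have := integrableB measurableT fi gi. Qed.

Lemma iiZ (c : R) (f : R3 -> R) : ii f -> ii (fun v => c * f v).
Proof. by move=> fi; have := integrableZl measurableT c fi. Qed.

Lemma I3D (f g : R3 -> R) : ii f -> ii g ->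
  \int[leb3]_v (f v + g v) = \int[leb3]_v f v + \int[leb3]_v g v.
Proof. by move=> fi gi; rewrite RintegralD. Qed.

Lemma I3B (f g : R3 -> R) : ii f -> ii g ->
  \int[leb3]_v (f v - g v) = \int[leb3]_v f v - \int[leb3]_v g v.
Proof. by move=> fi gi; rewrite RintegralB. Qed.

Lemma I3Z (c : R) (f : R3 -> R) : ii f ->
  \int[leb3]_v (c * f v) = c * \int[leb3]_v f v.
Proof. by move=> fi; rewrite RintegralZl. Qed.

Lemma I3_le (f g : R3 -> R) : ii f -> ii g -> (forall v, f v <= g v) ->
  \int[leb3]_v f v <= \int[leb3]_v g v.
Proof. by move=> fi gi fg; apply: le_Rintegral. Qed.

Lemma I3_ge0 (f : R3 -> R) : (forall v, 0 <= f v) -> 0 <= \int[leb3]_v f v.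
Proof. by move=> f0; apply: Rintegral_ge0. Qed.

Lemma I3_abs (f : R3 -> R) : ii f -> `|\int[leb3]_v f v| <= \int[leb3]_v `|f v|.
Proof. by move=> fi; apply: le_normr_Rintegral. Qed.

Lemma ii_abs (f : R3 -> R) : ii f -> ii (fun v => `|f v|).
Proof. by move=> fi; have := integrable_norm fi. Qed.

Lemma int_bracket_affine (r s : R) (c : R3) : 3 < r -> 0 < s ->
  (\int[leb3]_v ((1 + s ^+ 2 * sqnorm (v - c)) `^ (- (r / 2)))%:E =
  (s ^- 3 * japint r)%:E)%E.
Proof.
move=> r3 s0; have i3 := int_bracket3 r3.
have := @leb3_affine R (fun v => ((1 + sqnorm v) `^ (- (r / 2)))%:E) s c s0.
move=> /(_ _ _)/= E; rewrite exprVn in E.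
rewrite EFinM /japint EFin_I3; last first.
  by apply: iiP => //; [exact: measurable_bracket3 | move=> v; exact: powR_ge0].
rewrite -E; last 2 first.
- by apply/measurable_EFinP; exact: measurable_bracket3.
- by move=> v; rewrite lee_fin powR_ge0.
by apply: eq_integral => v _; rewrite sqnormZ.
Qed.

Lemma ii_bracket (r s : R) (c : R3) : 3 < r -> 0 < s ->
  ii (fun v => (1 + s ^+ 2 * sqnorm (v - c)) `^ (- (r / 2))).
Proof.
move=> r3 s0; apply: iiP.
- apply: measurable_powRl; apply: measurable_funD => //; apply: measurable_funM => //.
  by apply: measurable_sqnorm; apply: measurable_R3B.
- by move=> v; exact: powR_ge0.
- by rewrite int_bracket_affine// ltry.
Qed.

Lemma I3_bracket (r s : R) (c : R3) : 3 < r -> 0 < s ->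
  \int[leb3]_v ((1 + s ^+ 2 * sqnorm (v - c)) `^ (- (r / 2))) = s ^- 3 * japint r.
Proof. by move=> r3 s0; rewrite /Rintegral int_bracket_affine. Qed.

Lemma japint_ge0 (r : R) : 0 <= japint r.
Proof. by apply: I3_ge0 => v; exact: powR_ge0. Qed.
End brackets3.

Ltac nng := solve [repeat first [done | exact: powR_ge0 | exact: sqnorm_ge0
  | exact: japint_ge0 | exact: expR_ge0 | exact: sqr_ge0 | exact: normr_ge0 | (by apply: ltW)
  | apply: mulr_ge0 | apply: divr_ge0 | rewrite invr_ge0 | apply: addr_ge0]].

(** * Moments and concentration *)

Section density_moments.
Context {R : realType}.
Local Notation R3 := (R3 R).

Lemma sqnormD2 (a b c : R3) : sqnorm (a - c) <= 2 * sqnorm (a - b) + 2 * sqnorm (b - c).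
Proof.
rewrite /sqnorm /=.
have H (x y z : R) : (x - z) ^+ 2 <= 2 * (x - y) ^+ 2 + 2 * (y - z) ^+ 2.
  by have := sqr_ge0 (x - y - (y - z)); lra.
have := H a.1.1 b.1.1 c.1.1; have := H a.1.2 b.1.2 c.1.2; have := H a.2 b.2 c.2; lra.
Qed.

Lemma sqnormB2 (a c : R3) : sqnorm (a - c) <= 2 * sqnorm a + 2 * sqnorm c.
Proof.
rewrite /sqnorm /=.
have H (x z : R) : (x - z) ^+ 2 <= 2 * x ^+ 2 + 2 * z ^+ 2.
  by have := sqr_ge0 (x + z); lra.
have := H a.1.1 c.1.1; have := H a.1.2 c.1.2; have := H a.2 c.2; lra.
Qed.

Lemma sqnorm0 : sqnorm (0 : R3) = 0.
Proof. by rewrite /sqnorm /=; ring. Qed.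

Lemma sqnormC (a b : R3) : sqnorm (a - b) = sqnorm (b - a).
Proof. by rewrite /sqnorm /=; ring. Qed.

Lemma bracket_scale (sg : R) : 0 < sg ->
  sg = (sg `^ 2^-1) ^+ 2 /\ (sg `^ 2^-1) ^- 3 = sg `^ (- (3 / 2)).
Proof.
move=> s0; rewrite -!powR_mulrn ?powR_ge0// -powRN -!powRrM.
split; first by rewrite mulVf ?pnatr_eq0// powRr1// ltW.
by congr (_ `^ _); field.
Qed.

Lemma ii_bracketE (r sg : R) (c : R3) : 3 < r -> 0 < sg ->
  ii (fun v => (1 + sg * sqnorm (v - c)) `^ (- (r / 2))).
Proof.
move=> r3 s0; have [E _] := bracket_scale s0.
by have := @ii_bracket R r (sg `^ 2^-1) c r3 (powR_gt0 _ s0); rewrite -E.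
Qed.

Lemma I3_bracketE (r sg : R) (c : R3) : 3 < r -> 0 < sg ->
  \int[leb3]_v ((1 + sg * sqnorm (v - c)) `^ (- (r / 2))) = sg `^ (- (3 / 2)) * japint r.
Proof.
move=> r3 s0; have [E <-] := bracket_scale s0.
by have := @I3_bracket R r (sg `^ 2^-1) c r3 (powR_gt0 _ s0); rewrite -E.
Qed.

(** Trades polynomial growth for exponential decay. *)
Lemma powR_expR_bound (a y : R) : 0 < a -> 0 <= y ->
  (1 + y) `^ a * expR (- y) <= a `^ a * expR 1.
Proof.
move=> a0 y0.
have H : (1 + y) / a <= expR ((1 + y) / a).
  by have := expR_ge1Dx ((1 + y) / a); lra.
have : ((1 + y) / a) `^ a <= expR ((1 + y) / a) `^ a.
  by apply: ge0_ler_powR; rewrite ?nnegrE ?expR_ge0// ?divr_ge0//; lra.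
rewrite -expRM divfK ?gt_eqF// powRM ?invr_ge0; [|lra|lra].
rewrite -[a^-1]powR_inv1 ?(ltW a0)// -powRrM mulN1r powRN ler_pdivrMr ?powR_gt0// => H2.
apply: (@le_trans _ _ (expR (1 + y) * a `^ a * expR (- y))).
  by rewrite ler_wpM2r ?expR_ge0.
by rewrite mulrAC -expRD addrK mulrC.
Qed.

Definition dens (g : R3 -> R) :=
  [/\ measurable_fun [set: R3] g, forall v, 0 <= g v &
      ii (fun v => (1 + sqnorm v) * g v)].

Section moments.
Variable g : R3 -> R.
Hypothesis dg : dens g.
Let mg : measurable_fun [set: R3] g. Proof. by case: dg. Qed.
Let g0 v : 0 <= g v. Proof. by case: dg. Qed.
Let gi : ii (fun v => (1 + sqnorm v) * g v). Proof. by case: dg. Qed.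

Lemma dens_ii (k : R3 -> R) (K : R) : measurable_fun [set: R3] k ->
  (forall v, `|k v| <= K * (1 + sqnorm v)) -> ii (fun v => k v * g v).
Proof.
move=> mk kK; apply: (ii_le _ _ (iiZ K gi)); first exact: measurable_funM.
by move=> v; rewrite normrM (ger0_norm (g0 v)) mulrA ler_wpM2r.
Qed.

Lemma dens_ii0 : ii g.
Proof.
have := @dens_ii (fun=> 1) 1 (measurable_cst _); under eq_fun do rewrite mul1r.
by apply => v; rewrite normr1 mul1r lerDl sqnorm_ge0.
Qed.

Lemma dens_ii1 : ii (fun v => v.1.1 * g v).
Proof.
apply: (@dens_ii _ 1); first by apply: measurable_R3_1.
move=> v; rewrite /sqnorm; have := sqr_ge0 v.1.2; have := sqr_ge0 v.2.
have := sqr_ge0 (v.1.1 - 2^-1); have := sqr_ge0 (v.1.1 + 2^-1).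
by rewrite ler_norml; lra.
Qed.

Lemma dens_ii2 : ii (fun v => v.1.2 * g v).
Proof.
apply: (@dens_ii _ 1); first by apply: measurable_R3_2.
move=> v; rewrite /sqnorm; have := sqr_ge0 v.1.1; have := sqr_ge0 v.2.
have := sqr_ge0 (v.1.2 - 2^-1); have := sqr_ge0 (v.1.2 + 2^-1).
by rewrite ler_norml; lra.
Qed.

Lemma dens_ii3 : ii (fun v => v.2 * g v).
Proof.
apply: (@dens_ii _ 1); first by apply: measurable_R3_3.
move=> v; rewrite /sqnorm; have := sqr_ge0 v.1.1; have := sqr_ge0 v.1.2.
have := sqr_ge0 (v.2 - 2^-1); have := sqr_ge0 (v.2 + 2^-1).
by rewrite ler_norml; lra.
Qed.

Lemma dens_iiE : ii (fun v => sqnorm v * g v).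
Proof.
apply: (@dens_ii _ 1); first exact: measurable_sqnorm.
by move=> v; have := sqnorm_ge0 v => ?; rewrite ger0_norm//; lra.
Qed.

Lemma rho_ge0 : 0 <= rho g.
Proof. exact: I3_ge0. Qed.

Lemma dens_iic (c : R3) : ii (fun v => sqnorm (v - c) * g v).
Proof.
have c0 := sqnorm_ge0 c.
apply: (@dens_ii _ (2 + 2 * sqnorm c)); first by apply: measurable_sqnorm; apply: measurable_R3B.
move=> v; rewrite ger0_norm ?sqnorm_ge0//.
have := sqnormB2 v c.
have := sqnorm_ge0 v => v0 H; apply: le_trans H _.
have := mulr_ge0 c0 v0; lra.
Qed.

Hypothesis rho0 : 0 < rho g.
Let r := rho g.
Let U := bulk_velocity g.
Let T := temperature g.

Lemma mom1 : \int[leb3]_v (v.1.1 * g v) = r * U.1.1.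
Proof. by rewrite /U /bulk_velocity /= mulrA mulfV ?mul1r// gt_eqF. Qed.
Lemma mom2 : \int[leb3]_v (v.1.2 * g v) = r * U.1.2.
Proof. by rewrite /U /bulk_velocity /= mulrA mulfV ?mul1r// gt_eqF. Qed.
Lemma mom3 : \int[leb3]_v (v.2 * g v) = r * U.2.
Proof. by rewrite /U /bulk_velocity /= mulrA mulfV ?mul1r// gt_eqF. Qed.
Lemma momE : \int[leb3]_v (sqnorm v * g v) = r * (sqnorm U + 3 * T).
Proof.
rewrite /T /temperature -/U -/r [3 * _]mulrC divfK ?pnatr_eq0//.
by rewrite addrC subrK mulrA mulfV ?mul1r// gt_eqF.
Qed.

Lemma momY : \int[leb3]_v ((1 + sqnorm v) * g v) = r * (1 + sqnorm U + 3 * T).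
Proof.
under eq_Rintegral do rewrite mulrDl mul1r.
by rewrite I3D ?momE; [rewrite -/(rho g) -/r; ring|exact: dens_ii0|exact: dens_iiE].
Qed.

Lemma momc (c : R3) : \int[leb3]_v (sqnorm (v - c) * g v) = r * (3 * T + sqnorm (U - c)).
Proof.
have i0 := dens_ii0; have i1 := dens_ii1; have i2 := dens_ii2; have i3 := dens_ii3; have iE := dens_iiE.
under eq_Rintegral => v _.
  have -> : sqnorm (v - c) * g v = (sqnorm v * g v + sqnorm c * g v) -
    ((2 * c.1.1) * (v.1.1 * g v) + (2 * c.1.2) * (v.1.2 * g v) + (2 * c.2) * (v.2 * g v)).
    by rewrite /sqnorm /=; ring.
  over.
rewrite I3B; last 2 first.
- by apply: iiD => //; exact: iiZ.
- by apply: iiD; [apply: iiD|]; exact: iiZ.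
rewrite !I3D ?I3Z// ?momE ?mom1 ?mom2 ?mom3; try by [exact: iiZ | apply: iiD; exact: iiZ].
rewrite -/(rho g) -/r /sqnorm /=; ring.
Qed.

Lemma temp_ge0 : 0 <= T.
Proof.
have := momc U; rewrite subrr.
rewrite sqnorm0 addr0 => E.
have : 0 <= r * (3 * T) by rewrite -E; apply: I3_ge0 => v; rewrite mulr_ge0// sqnorm_ge0.
by rewrite pmulr_rge0// pmulr_rge0.
Qed.

(** A profile that is bounded near its mean cannot concentrate there. By the inequality of Chebyshev
    the mass outside the ball of radius [sqrt (6 tau)] around [U] is at most [r T / (2 tau)];
    inside, [g <= S], and the volume is of order [(6 tau)^(3/2)]. The indicator of the ball is
    bounded by four times a bracket, so that brackets are the only functions to integrate. Keeping
    [tau] free also excludes [T = 0]. *)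
Lemma concentration_gen (S tau : R) : 0 <= S -> 0 < tau ->
  (forall v, sqnorm (v - U) < 6 * tau -> g v <= S) ->
  r <= 4 * japint 4 * (6 * tau) `^ (3 / 2) * S + r * T / (2 * tau).
Proof.
move=> S0 t0 gS.
have s0 : 0 < (6 * tau)^-1 by rewrite invr_gt0 mulr_gt0.
pose k v := (1 + (6 * tau)^-1 * sqnorm (v - U)) `^ (- (4 / 2)).
have ki : ii k by apply: ii_bracketE => //; lra.
have gle v : g v <= 4 * S * k v + (6 * tau)^-1 * (sqnorm (v - U) * g v).
  have n0 := sqnorm_ge0 (v - U).
  have [h|h] := ltP (sqnorm (v - U)) (6 * tau).
  - apply: (le_trans (gS v h)).
    have k4 : 4^-1 <= k v.
      have -> : 4^-1 = 2 `^ (- (4 / 2)) :> R.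
        by have -> : - (4 / 2) = - 2 :> R; [field|rewrite powR_invn//; field].
      apply: powRN_antitone; first by rewrite divr_ge0.
      + by rewrite ltr_wpDr// mulr_ge0// ltW.
      + have : (6 * tau)^-1 * sqnorm (v - U) <= 1 by rewrite mulrC ler_pdivrMr ?mul1r ?mulr_gt0// ltW.
        lra.
    have := ler_wpM2l S0 k4.
    have : 0 <= (6 * tau)^-1 * (sqnorm (v - U) * g v) by nng.
    lra.
  - rewrite mulrA ler_wpDl ?mulr_ge0 ?powR_ge0// ler_peMl//.
    by rewrite mulrC ler_pdivlMr ?mul1r// mulr_gt0.
have ig := dens_ii0; have ic := dens_iic U.
have := I3_le ig (iiD (iiZ (4 * S) ki) (iiZ (6 * tau)^-1 ic)) gle.
rewrite -/(rho g) -/r I3D; [|exact: iiZ|exact: iiZ].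
rewrite !I3Z// momc subrr.
rewrite sqnorm0.
rewrite /k I3_bracketE//; last lra.
have -> : (6 * tau)^-1 `^ (- (3 / 2)) = (6 * tau) `^ (3 / 2).
  by rewrite -powR_inv1 ?mulr_ge0 ?ltW// -powRrM mulN1r opprK.
move=> H; apply: le_trans H _.
rewrite le_eqVlt; apply/orP; left; apply/eqP; field; lra.
Qed.

Lemma concentration (S : R) : 0 <= S -> 0 < T ->
  (forall v, sqnorm (v - U) < 6 * T -> g v <= S) ->
  r <= 8 * japint 4 * (6 * T) `^ (3 / 2) * S.
Proof.
move=> S0 T0 gS; have := concentration_gen S0 T0 gS.
have -> : r * T / (2 * T) = r / 2 by field; lra.
lra.
Qed.

(** A bounded profile of zero temperature would have its mass in arbitrarily small balls around [U]. *)
Lemma temp_gt0 (S : R) : (forall v, g v <= S) -> 0 < T.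
Proof.
move=> gS; rewrite lt_neqAle temp_ge0 andbT; apply/negP => /eqP T0.
have S0 : 0 <= S := le_trans (g0 0) (gS 0).
have J0 := @japint_ge0 R 4.
set K := 4 * japint 4 * S.
have K0 : 0 <= K by rewrite !mulr_ge0.
(* At [T = 0] concentration reads [r <= K (6 tau)^(3/2)]; this radius makes the right side
   [K r / (2 K + 1)], which is below [r]. *)
pose tau := (r / (2 * K + 1)) `^ (2 / 3) / 6.
have b0 : 0 < r / (2 * K + 1) by rewrite divr_gt0//; lra.
have t0 : 0 < tau by rewrite divr_gt0// powR_gt0.
have := concentration_gen S0 t0 (fun v _ => gS v).
have -> : (6 * tau) `^ (3 / 2) = r / (2 * K + 1).
  rewrite /tau mulrC divfK ?pnatr_eq0// -powRrM.
  by have -> : 2 / 3 * (3 / 2) = 1 :> R; [field|rewrite powRr1// ltW].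
rewrite -T0 mulr0 mul0r addr0 => H.
have : r * (2 * K + 1) <= r * K.
  rewrite -ler_pdivlMr; last lra.
  by apply: le_trans H _; rewrite /K le_eqVlt; apply/orP; left; apply/eqP; ring.
rewrite ler_pM2l//; lra.
Qed.

End moments.
End density_moments.

(** * Moment bounds and weighted bounds for Maxwellians *)

Section moment_bounds.
Context {R : realType}.
Local Notation R3 := (R3 R).

Lemma powR_expE (x a : R) : 0 < x -> x `^ a = expR (a * ln x).
Proof. by move=> x0; rewrite /powR gt_eqF. Qed.

Definition Cmom (p : R) : R := 2 `^ ((p - 3) / 2) * 2 `^ ((p - 2) / 2) * japint (p - 2).

Lemma Cmom_ge0 p : 0 <= Cmom p. Proof. by rewrite /Cmom; nng. Qed.

Section moments.
Variable g : R3 -> R.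
Hypothesis dg : dens g.
Hypothesis rho0 : 0 < rho g.
Let g0 (v : R3) : 0 <= g v. Proof. by case: dg. Qed.
Let r := rho g.
Let U := bulk_velocity g.
Let T := temperature g.

(** Splits the second moment around [c] at [|v - c|^2 = th]: below, [|v - c|^2] is at most [th];
    above, the weighted bound leaves a power [2 - p] of [|v - c|], which is integrable as [p > 5]. *)
Lemma moment_tail (sg p N th : R) (c : R3) : 0 < sg -> 5 < p -> 0 <= N -> 0 < th ->
  (forall v : R3, (sg * sqnorm (v - c)) `^ (p / 2) * g v <= N) ->
  r * (3 * T + sqnorm (U - c)) <=
  th * r + N * sg `^ (- (p / 2)) * 2 `^ ((p - 2) / 2) * japint (p - 2) * th `^ ((5 - p) / 2).
Proof.
move=> s0 p5 N0 t0 gN.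
have ti : 0 < th^-1 by rewrite invr_gt0.
pose k (v : R3) := (1 + th^-1 * sqnorm (v - c)) `^ (- ((p - 2) / 2)).
have ki : ii k by apply: ii_bracketE => //; lra.
set B := N * sg `^ (- (p / 2)) * 2 `^ ((p - 2) / 2) * th `^ (- ((p - 2) / 2)).
have B0 : 0 <= B by rewrite /B; nng.
have gle (v : R3) : sqnorm (v - c) * g v <= th * g v + B * k v.
  have n0 := sqnorm_ge0 (v - c); have := gN v; set x := sqnorm (v - c) in n0 *.
  have [h _|h Hg] := leP x th.
    by rewrite ler_wpDr ?ler_wpM2r// mulr_ge0// powR_ge0.
  have x0 : 0 < x by apply: lt_trans h.
  rewrite ler_wpDl//; first by nng.
  have E : x = (sg * x) `^ (p / 2) * (sg `^ (- (p / 2)) * x `^ (- ((p - 2) / 2))).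
    rewrite powRM ?(ltW x0) ?(ltW s0)// !powR_expE// -!expRD -[LHS]lnK//.
    by congr expR; field.
  rewrite {1}E mulrAC; apply: (le_trans (ler_wpM2r _ Hg)); first by nng.
  rewrite /B -!mulrA ler_wpM2l// ler_wpM2l ?powR_ge0//.
  (* Above the threshold, [x] is comparable to [th + x], which centres the power at a bracket. *)
  have hx : th / 2 * (1 + th^-1 * x) <= x.
    have -> : th / 2 * (1 + th^-1 * x) = (th + x) / 2 by field; rewrite gt_eqF.
    lra.
  apply: (@le_trans _ _ ((th / 2 * (1 + th^-1 * x)) `^ (- ((p - 2) / 2)))).
    by apply: powRN_antitone => //; [lra | apply: mulr_gt0; [lra|rewrite ltr_wpDr//; nng]].
  rewrite powRM; [|lra|rewrite addr_ge0//; nng].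
  rewrite powRM; [|lra|lra].
  have -> : 2^-1 `^ (- ((p - 2) / 2)) = 2 `^ ((p - 2) / 2) :> R.
    by rewrite -[2^-1]powR_inv1// -powRrM mulN1r opprK.
  by rewrite /k le_eqVlt; apply/orP; left; apply/eqP; ring.
have := I3_le (dens_iic dg c) (iiD (iiZ th (dens_ii0 dg)) (iiZ B ki)) gle.
rewrite I3D; [|apply: iiZ; exact: dens_ii0|exact: iiZ].
rewrite !I3Z//; last exact: dens_ii0.
rewrite (momc dg)// -/(rho g) -/r -/T -/U /k I3_bracketE//; last lra.
move=> H; apply: le_trans H _.
rewrite lerD2l le_eqVlt; apply/orP; left; apply/eqP.
rewrite /B.
have -> : th^-1 `^ (- (3 / 2)) = th `^ (3 / 2).
  by rewrite -powR_inv1 ?(ltW t0)// -powRrM mulN1r opprK.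
have -> : th `^ ((5 - p) / 2) = th `^ (- ((p - 2) / 2)) * th `^ (3 / 2).
  by rewrite !powR_expE// -expRD; congr expR; field.
ring.
Qed.

(** Optimising the threshold in the tail estimate interpolates the second moment between the mass
    and the weighted supremum. *)
Lemma moment_bound (sg p N : R) (c : R3) : 0 < sg -> 5 < p -> 0 <= N ->
  (forall v : R3, (sg * sqnorm (v - c)) `^ (p / 2) * g v <= N) ->
  r * (3 * T + sqnorm (U - c)) `^ ((p - 3) / 2) <= Cmom p * N * sg `^ (- (p / 2)).
Proof.
move=> s0 p5 N0 gN; have T0 := temp_ge0 dg rho0.
set m := 3 * T + sqnorm (U - c).
have m0 : 0 <= m by rewrite /m; nng.
have [->|mn0] := eqVneq m 0.
  rewrite powR0 ?mulr0; first by have := Cmom_ge0 p => ?; nng.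
  by apply/eqP; lra.
have mp : 0 < m by rewrite lt_neqAle eq_sym mn0.
have h0 : 0 < m / 2 by lra.
(* The threshold is half the mean of [|v - c|^2], so that the first term of the tail bound is
   absorbed by the left side. *)
have := moment_tail s0 p5 N0 h0 gN; rewrite -/m => H.
have {}H : r * (m / 2) <= N * sg `^ (- (p / 2)) * 2 `^ ((p - 2) / 2) * japint (p - 2) * (m / 2) `^ ((5 - p) / 2).
  by lra.
have -> : r * m `^ ((p - 3) / 2) = r * (m / 2) * ((m / 2) `^ ((p - 5) / 2) * 2 `^ ((p - 3) / 2)).
  have -> : m `^ ((p - 3) / 2) = (m / 2) `^ ((p - 3) / 2) * 2 `^ ((p - 3) / 2).
    by rewrite -powRM ?divfK//; lra.
  rewrite -!mulrA; congr (_ * _); rewrite !mulrA; congr (_ * _).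
  rewrite !(powR_expE _ h0) -[X in X * expR _]lnK ?posrE// -expRD; congr expR.
  by set L := ln _; field.
apply: le_trans (ler_wpM2r _ H) _; first by nng.
have E : (m / 2) `^ ((5 - p) / 2) * (m / 2) `^ ((p - 5) / 2) = 1.
  by rewrite !(powR_expE _ h0) -expRD -expR0; congr expR; field.
rewrite le_eqVlt; apply/orP; left; apply/eqP; rewrite /Cmom.
set X := (m / 2) `^ ((5 - p) / 2) in E *; set Z := (m / 2) `^ ((p - 5) / 2) in E *.
by transitivity (N * sg `^ (- (p / 2)) * 2 `^ ((p - 2) / 2) * japint (p - 2) * 2 `^ ((p - 3) / 2) * (X * Z)); [ring|rewrite E; ring].
Qed.

(** The source of the decay of the density: [sg] will be [1 + t^2]. *)
Lemma rho_decay (sg p N : R) (c : R3) : 0 < sg -> 3 < p -> 0 <= N ->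
  (forall v : R3, (1 + sg * sqnorm (v - c)) `^ (p / 2) * g v <= N) ->
  r <= japint p * N * sg `^ (- (3 / 2)).
Proof.
move=> s0 p3 N0 gN.
have ki := ii_bracketE c p3 s0.
have gle (v : R3) : g v <= N * (1 + sg * sqnorm (v - c)) `^ (- (p / 2)).
  have P0 : 0 < 1 + sg * sqnorm (v - c) by rewrite ltr_wpDr//; nng.
  rewrite powRN ler_pdivlMr ?powR_gt0// mulrC; exact: gN.
have := I3_le (dens_ii0 dg) (iiZ N ki) gle.
rewrite I3Z// I3_bracketE// -/(rho g) -/r => H; apply: le_trans H _.
by rewrite le_eqVlt; apply/orP; left; apply/eqP; ring.
Qed.
End moments.

Definition gauss (U : R3) (T : R) (v : R3) : R :=
  (2 * pi * T) `^ (- (3 / 2)) * expR (- (sqnorm (v - U) / (2 * T))).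

Lemma maxwellianE (g : R3 -> R) v : rho g != 0 ->
  maxwellian g v = rho g * gauss (bulk_velocity g) (temperature g) v.
Proof. by move=> /negPf r0; rewrite /maxwellian r0 /gauss powRN mulrA. Qed.

Lemma gauss_ge0 U T v : 0 <= gauss U T v.
Proof. by rewrite /gauss; nng. Qed.

Lemma measurable_gauss U T : measurable_fun [set: R3] (gauss U T).
Proof.
apply: measurable_funM => //; apply: (measurableT_comp (@measurable_expR R)).
apply: measurable_funN; apply: measurable_funM => //.
by apply: measurable_sqnorm; apply: measurable_R3B.
Qed.

Lemma gauss_le U T v : 0 < T ->
  gauss U T v <= T `^ (- (3 / 2)) * expR (- (sqnorm (v - U) / (2 * T))).
Proof.
move=> T0; rewrite ler_wpM2r ?expR_ge0//; apply: powRN_antitone => //.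
by rewrite ler_peMl ?(ltW T0)//; have := @pi_ge2 R; lra.
Qed.

Section weight.
Variable g : R3 -> R.
Hypothesis dg : dens g.
Hypothesis rho0 : 0 < rho g.
Let g0 (v : R3) : 0 <= g v. Proof. by case: dg. Qed.
Let r := rho g.
Let U := bulk_velocity g.
Let T := temperature g.
Hypothesis T0 : 0 < T.

Definition Cmax (p : R) : R :=
  ((p / 2) `^ (p / 2) * expR 1) * (8 * japint 4 * 6 `^ (3 / 2) * 8 `^ (p / 2) + 48 `^ (p / 2)).

Lemma Cmax_ge0 p : 0 <= Cmax p. Proof. by rewrite /Cmax; nng. Qed.

Variables (A sg p N : R) (c : R3).
Hypothesis (A0 : 0 <= A) (s0 : 0 < sg) (p0 : 0 < p) (N0 : 0 <= N).
Let P (v : R3) := A + sg * sqnorm (v - c).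
Hypothesis gN : forall v : R3, P v `^ (p / 2) * g v <= N.
Let p20 : 0 <= p / 2. Proof. by rewrite divr_ge0// ltW. Qed.
Let P0 (v : R3) : 0 <= P v. Proof. by rewrite /P addr_ge0//; nng. Qed.

(** On the ball that carries half of the mass, the weight is comparable to its value at the mean. *)
Lemma concentration_weight : 24 * sg * T <= P U ->
  r <= 8 * japint 4 * (6 * T) `^ (3 / 2) * (N * (P U / 4) `^ (- (p / 2))).
Proof.
move=> h; have sT : 0 < sg * T by rewrite mulr_gt0.
have PU0 : 0 < P U by lra.
apply: (concentration dg rho0) => //; first by nng.
move=> v; rewrite -/U -/T => hv; have PE : P v = A + sg * sqnorm (v - c) by [].
have PvU : P U / 4 <= P v.
  have H1 : P U <= A + sg * (2 * sqnorm (v - U) + 2 * sqnorm (v - c)).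
    by rewrite /P lerD2l ler_pM2l// [sqnorm (v - U)]sqnormC; exact: sqnormD2.
  have H2 : sg * sqnorm (v - U) <= sg * (6 * T) by rewrite ler_pM2l// ltW.
  have H3 : A + 2 * (sg * sqnorm (v - c)) <= 2 * P v by move: A0; rewrite PE; lra.
  lra.
rewrite powRN ler_pdivlMr ?powR_gt0//; last lra.
apply: le_trans (gN v); rewrite mulrC ler_wpM2r//.
apply: ge0_ler_powR; rewrite ?nnegrE//; lra.
Qed.

Lemma le_terms_prod (K C1 C2 M X : R) : 0 <= K -> 0 <= C1 -> 0 <= C2 -> 0 <= M -> 0 <= X ->
  K * C1 * M <= K * (C1 + C2) * (M + X) /\ K * C2 * X <= K * (C1 + C2) * (M + X).
Proof.
move=> K0 c1 c2 M0 X0; split; rewrite -!mulrA ler_wpM2l//.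
  by apply: ler_pM => //; rewrite lerDl.
by apply: ler_pM => //; rewrite lerDr.
Qed.

(** Let [y] be the exponent of the Gaussian at [v]. If the weight at [U] dominates [sg T], then
    [P v <= 2 (P U) (1 + y)], and concentration near [U] bounds [rho (P U)^(p/2)] by [N T^(3/2)].
    Otherwise [P v <= 48 sg T (1 + y)], and the second term on the right appears. In both cases the
    power of [1 + y] is absorbed by [expR (- y)]. *)
Lemma maxwellian_weight (v : R3) :
  P v `^ (p / 2) * maxwellian g v <= Cmax p * (N + r * T `^ ((p - 3) / 2) * sg `^ (p / 2)).
Proof.
rewrite maxwellianE ?gt_eqF//.
set y := sqnorm (v - U) / (2 * T).
have y0 : 0 <= y by rewrite /y; nng.
have sT : 0 < sg * T by rewrite mulr_gt0.
have ygT : sqnorm (v - U) = 2 * T * y by rewrite /y mulrC divfK// gt_eqF// mulr_gt0.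
have Pv : P v <= 2 * P U + 4 * (sg * T) * y.
  have H : P v <= A + sg * (2 * sqnorm (v - U) + 2 * sqnorm (U - c)).
    by rewrite /P lerD2l ler_pM2l//; exact: sqnormD2.
  rewrite ygT in H; move: A0 H; rewrite /P; lra.
have r0 : 0 <= r := ltW rho0.
set K := (p / 2) `^ (p / 2) * expR 1.
have K0 : 0 <= K by rewrite /K; nng.
have J0 := @japint_ge0 R 4.
(* The power of [1 + y] is absorbed by the Gaussian, whichever multiple of [1 + y] bounds the
   weight. *)
have key Q : 0 <= Q -> P v <= Q * (1 + y) ->
    P v `^ (p / 2) * (r * gauss U T v) <= r * T `^ (- (3 / 2)) * Q `^ (p / 2) * K.
  move=> Q0 PQ.
  have H1 : P v `^ (p / 2) <= Q `^ (p / 2) * (1 + y) `^ (p / 2).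
    rewrite -powRM//; last lra.
    apply: ge0_ler_powR; rewrite ?nnegrE//; rewrite mulr_ge0//; lra.
  have p2 : 0 < p / 2 by rewrite divr_gt0.
  have H2 := @powR_expR_bound R (p / 2) y p2 y0; rewrite -/K in H2.
  have H3 := gauss_le U v T0.
  apply: le_trans (ler_pM _ _ H1 (ler_wpM2l r0 H3)) _; rewrite ?mulr_ge0 ?powR_ge0 ?gauss_ge0//.
  rewrite -/y.
  rewrite [leLHS](_ : _ = r * T `^ (- (3 / 2)) * Q `^ (p / 2) * ((1 + y) `^ (p / 2) * expR (- y))); last by ring.
  by rewrite ler_wpM2l//; nng.
have C1 : 0 <= 8 * japint 4 * 6 `^ (3 / 2) * 8 `^ (p / 2) :> R by nng.
have C2 : 0 <= 48 `^ (p / 2) :> R by nng.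
have X0 : 0 <= r * T `^ ((p - 3) / 2) * sg `^ (p / 2) by nng.
have [h|h] := leP (24 * sg * T) (P U).
- have PU0 : 0 < P U by lra.
  apply: (le_trans (key (2 * P U) _ _)); first lra.
    by have := mulr_ge0 (ltW PU0) y0; have := ler_wpM2r y0 h; lra.
  have H := concentration_weight h.
  apply: (@le_trans _ _ (K * (8 * japint 4 * 6 `^ (3 / 2) * 8 `^ (p / 2)) * N)); last first.
    exact: (le_terms_prod K0 C1 C2 N0 X0).1.
  have -> : r * T `^ (- (3 / 2)) * (2 * P U) `^ (p / 2) * K = r * (T `^ (- (3 / 2)) * (2 * P U) `^ (p / 2) * K) by ring.
  apply: le_trans (ler_wpM2r _ H) _; first by rewrite mulr_ge0// mulr_ge0// powR_ge0.
  rewrite le_eqVlt; apply/orP; left; apply/eqP.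
  rewrite powRM ?(ltW T0)//.
  have E1 : T `^ (3 / 2) * T `^ (- (3 / 2)) = 1 by rewrite powRN mulfV// gt_eqF// powR_gt0.
  have E2 : (P U / 4) `^ (- (p / 2)) * (2 * P U) `^ (p / 2) = 8 `^ (p / 2).
    have -> : 2 * P U = 8 * (P U / 4) by field.
    have q0 : 0 < P U / 4 by rewrite divr_gt0.
    rewrite [(8 * _) `^ _]powRM ?(ltW q0)//.
    by rewrite mulrCA powRN mulVf ?mulr1// gt_eqF// powR_gt0.
  transitivity (8 * japint 4 * 6 `^ (3 / 2) * N * K * (T `^ (3 / 2) * T `^ (- (3 / 2))) * ((P U / 4) `^ (- (p / 2)) * (2 * P U) `^ (p / 2))); first by ring.
  by rewrite E1 E2; ring.
- apply: (le_trans (key (48 * (sg * T)) _ _)); first lra.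
    by have := mulr_ge0 (ltW sT) y0; lra.
  apply: (@le_trans _ _ (K * 48 `^ (p / 2) * (r * T `^ ((p - 3) / 2) * sg `^ (p / 2)))); last first.
    exact: (le_terms_prod K0 C1 C2 N0 X0).2.
  rewrite le_eqVlt; apply/orP; left; apply/eqP.
  have -> : T `^ ((p - 3) / 2) = T `^ (- (3 / 2)) * T `^ (p / 2).
    by rewrite !powR_expE// -expRD; congr expR; field.
  by rewrite (powRM _ (ler0n _ 48) (ltW sT)) (powRM _ (ltW s0) (ltW T0)); ring.
Qed.
End weight.
End moment_bounds.

(** * Distance between two Gaussians *)

Section gaussians.
Context {R : realType}.
Local Notation R3 := (R3 R).

Definition Cgm : R := 4 * (3 `^ 3 * expR 1) * 2 `^ (3 / 2) * japint 4.
Lemma Cgm_ge0 : 0 <= Cgm. Proof. by rewrite /Cgm; nng. Qed.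

(** Replaces the Gaussian by a bracket of exponent 3: one power will absorb the weight [1 + |v|^2],
    and the remaining two keep it integrable. *)
Lemma gauss_poly (U v : R3) (T : R) : 0 < T ->
  gauss U T v <= (3 `^ 3 * expR 1) * T `^ (- (3 / 2)) * (1 + (2 * T)^-1 * sqnorm (v - U)) `^ (- 3).
Proof.
move=> T0; apply: (le_trans (gauss_le U v T0)).
set y := (2 * T)^-1 * sqnorm (v - U).
have y0 : 0 <= y by rewrite /y; nng.
have -> : sqnorm (v - U) / (2 * T) = y by rewrite mulrC.
have H := @powR_expR_bound R 3 y (ltr0n _ 3) y0.
have P0 : 0 < (1 + y) `^ 3 by rewrite powR_gt0//; lra.
rewrite -mulrA mulrCA ler_wpM2l ?powR_ge0// powRN ler_pdivlMr//.
by rewrite mulrC.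
Qed.

(** Moves the weight from the origin to the centre of the Gaussian and to its scale. *)
Lemma weight_center (U v : R3) (T Y : R) : 0 < T -> 1 + sqnorm U <= Y -> T <= Y ->
  1 + sqnorm v <= 4 * Y * (1 + (2 * T)^-1 * sqnorm (v - U)).
Proof.
move=> T0 UY TY; set y := (2 * T)^-1 * sqnorm (v - U).
have y0 : 0 <= y by rewrite /y; nng.
have E : sqnorm (v - U) = 2 * T * y by rewrite /y mulrA mulfV ?mul1r// gt_eqF// mulr_gt0.
have H : sqnorm v <= 2 * sqnorm (v - U) + 2 * sqnorm U.
  have := sqnormD2 v U (0 : R3).
  have E0 (w : R3) : sqnorm (w - 0) = sqnorm w by rewrite /sqnorm /= !subr0.
  by rewrite !E0.
have := ler_wpM2r y0 TY; have := sqnorm_ge0 U; lra.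
Qed.

Lemma bracket_mul (x : R) : 0 <= x -> (1 + x) * (1 + x) `^ (- 3) = (1 + x) `^ (- (4 / 2)).
Proof.
move=> x0; have x1 : 0 < 1 + x by lra.
rewrite !powR_expE// -[X in X * _]lnK ?posrE// -expRD; congr expR; by field.
Qed.

Lemma ii_gauss_weight (U : R3) (T : R) : 0 < T -> ii (fun v => (1 + sqnorm v) * gauss U T v).
Proof.
move=> T0; set Y := 1 + sqnorm U + T.
have Y0 : 0 <= Y by rewrite /Y; nng.
have ti : 0 < (2 * T)^-1 by rewrite invr_gt0 mulr_gt0.
apply: (@ii_le _ _ (fun v => (4 * Y * (3 `^ 3 * expR 1) * T `^ (- (3 / 2))) * (1 + (2 * T)^-1 * sqnorm (v - U)) `^ (- (4 / 2)))).
- apply: measurable_funM; last exact: measurable_gauss.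
  by apply: measurable_funD => //; exact: measurable_sqnorm.
- move=> v; have g0 := gauss_ge0 U T v.
  have v0 : 0 <= 1 + sqnorm v by nng.
  rewrite (ger0_norm (mulr_ge0 v0 g0)).
  have z0 : 0 <= (2 * T)^-1 * sqnorm (v - U) by nng.
  rewrite -(bracket_mul z0).
  have U0 := sqnorm_ge0 U.
  have W := @weight_center U v T Y T0 _ _.
  apply: le_trans (ler_pM v0 g0 (W _ _) (gauss_poly U v T0)) _; rewrite /Y; [lra|lra|].
  rewrite le_eqVlt; apply/orP; left; apply/eqP; ring.
- by apply: iiZ; apply: ii_bracketE => //; lra.
Qed.

Lemma gauss_weight (U : R3) (T Y : R) : 0 < T -> 1 + sqnorm U <= Y -> T <= Y ->
  \int[leb3]_v ((1 + sqnorm v) * gauss U T v) <= Cgm * Y.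
Proof.
move=> T0 UY TY.
have ti : 0 < (2 * T)^-1 by rewrite invr_gt0 mulr_gt0.
have ki : ii (fun v : R3 => (1 + (2 * T)^-1 * sqnorm (v - U)) `^ (- (4 / 2))) by apply: ii_bracketE; rewrite ?ltr_nat.
have H := I3_le (ii_gauss_weight U T0) (iiZ (4 * Y * (3 `^ 3 * expR 1) * T `^ (- (3 / 2))) ki) _.
apply: le_trans (H _) _ => [v|].
  have g0 := gauss_ge0 U T v; have v0 : 0 <= 1 + sqnorm v by nng.
  rewrite -bracket_mul//; last by nng.
  apply: le_trans (ler_pM v0 g0 (weight_center v T0 UY TY) (gauss_poly U v T0)) _.
  rewrite le_eqVlt; apply/orP; left; apply/eqP; ring.
rewrite I3Z// I3_bracketE ?ltr_nat//.
have -> : (2 * T)^-1 `^ (- (3 / 2)) = (2 * T) `^ (3 / 2).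
  by rewrite -powR_inv1 ?mulr_ge0 ?(ltW T0)// -powRrM mulN1r opprK.
rewrite powRM ?(ltW T0)//.
have E1 : T `^ (3 / 2) * T `^ (- (3 / 2)) = 1 by rewrite powRN mulfV// gt_eqF// powR_gt0.
rewrite le_eqVlt; apply/orP; left; apply/eqP; rewrite /Cgm.
transitivity (4 * (3 `^ 3 * expR 1) * 2 `^ (3 / 2) * japint 4 * Y * (T `^ (3 / 2) * T `^ (- (3 / 2)))); first by ring.
by rewrite E1 mulr1.
Qed.

(** The [l^1] norm, because differences of velocities are estimated one coordinate at a time. *)
Definition n1 (w : R3) : R := `|w.1.1| + `|w.1.2| + `|w.2|.

Lemma n1_ge0 w : 0 <= n1 w. Proof. by rewrite /n1; nng. Qed.

Lemma sqnorm_n1 (w : R3) : sqnorm w <= n1 w ^+ 2.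
Proof.
rewrite /sqnorm /n1 -(real_normK (num_real w.1.1)) -(real_normK (num_real w.1.2)) -(real_normK (num_real w.2)).
set a := `|w.1.1|; set b := `|w.1.2|; set c := `|w.2|.
have a0 : 0 <= a by exact: normr_ge0.
have b0 : 0 <= b by exact: normr_ge0.
have c0 : 0 <= c by exact: normr_ge0.
have := mulr_ge0 a0 b0; have := mulr_ge0 a0 c0; have := mulr_ge0 c0 b0; lra.
Qed.

Lemma expR_diff (m a b : R) : m <= a -> m <= b ->
  `|expR (- a) - expR (- b)| <= `|a - b| * expR (- m).
Proof.
wlog ab : a b / a <= b.
  move=> H ma mb; have [h|h] := leP a b; first exact: H.
  by rewrite distrC [X in _ <= X * _]distrC; apply: H => //; exact: ltW.
move=> ma mb; rewrite ger0_norm ?subr_ge0 ?ler_expR ?lerN2// distrC ger0_norm ?subr_ge0//.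
have -> : expR (- b) = expR (- a) * expR (a - b) by rewrite -expRD; congr expR; ring.
have H1 : expR (- a) <= expR (- m) by rewrite ler_expR lerN2.
have H2 := expR_ge1Dx (a - b).
have H3 : 0 <= b - a by rewrite subr_ge0.
apply: (@le_trans _ _ (expR (- a) * (b - a))); last by rewrite mulrC ler_wpM2l.
have -> : expR (- a) - expR (- a) * expR (a - b) = expR (- a) * (1 - expR (a - b)) by ring.
rewrite ler_wpM2l ?expR_ge0//; lra.
Qed.

(** One coordinate of [|w + d|^2 - |w|^2] for a shift [d] that is small at the scale [tau] of the
    Gaussian. *)
Lemma shift_bound (d w tau z : R) : 0 < tau -> 0 <= z -> w ^+ 2 <= z * tau ^+ 2 -> `|d| <= tau ->
  `|d * (2 * w + d)| <= `|d| * (tau * (2 + z)).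
Proof.
move=> t0 z0 wz dt; rewrite normrM ler_wpM2l//.
have Hw : 2 * `|w| <= tau * (1 + z).
  rewrite -(ler_pM2l t0).
  have : 2 * (tau * `|w|) <= tau ^+ 2 + `|w| ^+ 2 by have := sqr_ge0 (tau - `|w|); lra.
  rewrite real_normK ?num_real//; lra.
apply: (le_trans (ler_normD _ _)); rewrite normrM ger0_norm//; lra.
Qed.

Definition Cgd : R := 2 `^ (3 / 2) * (4 * expR 1) * (4 `^ 4 * (4 `^ 4 * expR 1)).
Lemma Cgd_ge0 : 0 <= Cgd. Proof. by rewrite /Cgd; nng. Qed.

Lemma powR_half_ratio (x : R) : 0 < x -> x <= 1 -> 1 - x `^ (3 / 2) <= 2 * (1 - x).
Proof.
move=> x0 x1.
have H : x `^ 2 <= x `^ (3 / 2) by apply: ger_powR; [rewrite x0|lra].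
rewrite powR_mulrn ?(ltW x0)// in H.
have := sqr_ge0 (1 - x); lra.
Qed.

Lemma expR_poly4 (z : R) : 0 <= z ->
  (1 + z) * expR (- (z / 4)) <= 4 `^ 4 * (4 `^ 4 * expR 1) * (1 + z) `^ (- 3).
Proof.
move=> z0; have z40 : 0 <= z / 4 by lra.
have z1 : 0 < 1 + z by lra.
have K4 := @powR_expR_bound R 4 (z / 4) (ltr0n _ 4) z40.
rewrite powRN ler_pdivlMr ?powR_gt0//.
have -> : (1 + z) * expR (- (z / 4)) * (1 + z) `^ 3 = (1 + z) `^ 4 * expR (- (z / 4)).
  rewrite mulrAC; congr (_ * _).
  rewrite !powR_expE// -[X in X * _]lnK ?posrE// -expRD; congr expR; by field.
have K6 : (1 + z) `^ 4 <= 4 `^ 4 * (1 + z / 4) `^ 4.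
  rewrite -powRM//; last lra.
  by apply: ge0_ler_powR => //; rewrite ?nnegrE; lra.
apply: (@le_trans _ _ (4 `^ 4 * (1 + z / 4) `^ 4 * expR (- (z / 4)))).
  by rewrite ler_wpM2r// expR_ge0.
by rewrite -mulrA ler_wpM2l ?powR_ge0.
Qed.

Lemma powR_prefactor (T1 T2 : R) : 0 < T1 -> T1 <= T2 ->
  T1 `^ (- (3 / 2)) - T2 `^ (- (3 / 2)) <= T1 `^ (- (3 / 2)) * (2 * ((T2 - T1) / T2)).
Proof.
move=> T10 T12; have T20 : 0 < T2 by lra.
have x0 : 0 < T1 / T2 by rewrite divr_gt0.
have x1 : T1 / T2 <= 1 by rewrite ler_pdivrMr// mul1r.
have H := powR_half_ratio x0 x1.
have -> : T2 `^ (- (3 / 2)) = T1 `^ (- (3 / 2)) * (T1 / T2) `^ (3 / 2).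
  rewrite !powR_expE ?mulr_gt0 ?invr_gt0// -expRD; congr expR.
  by rewrite lnM ?posrE ?invr_gt0// lnV ?posrE//; ring.
have -> : T1 `^ (- (3 / 2)) - T1 `^ (- (3 / 2)) * (T1 / T2) `^ (3 / 2) = T1 `^ (- (3 / 2)) * (1 - (T1 / T2) `^ (3 / 2)) by ring.
rewrite ler_wpM2l ?powR_ge0//; apply: le_trans H _.
have -> : 1 - T1 / T2 = (T2 - T1) / T2 by field; rewrite gt_eqF.
by [].
Qed.

Lemma shift_three (d1 d2 d3 w1 w2 w3 tau z : R) : 0 < tau -> 0 <= z ->
  `|d1| + `|d2| + `|d3| <= tau -> w1 ^+ 2 + w2 ^+ 2 + w3 ^+ 2 = z * tau ^+ 2 ->
  `|- d1 * (2 * w1 + - d1) + - d2 * (2 * w2 + - d2) + - d3 * (2 * w3 + - d3)| <=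
  (`|d1| + `|d2| + `|d3|) * (tau * (2 + z)).
Proof.
move=> tau0 z0 n1tau zE.
have q1 := sqr_ge0 w1; have q2 := sqr_ge0 w2; have q3 := sqr_ge0 w3.
have p1 := normr_ge0 d1; have p2 := normr_ge0 d2; have p3 := normr_ge0 d3.
have B1 := @shift_bound (- d1) w1 tau z tau0 z0.
have B2 := @shift_bound (- d2) w2 tau z tau0 z0.
have B3 := @shift_bound (- d3) w3 tau z tau0 z0.
rewrite !normrN in B1 B2 B3.
apply: (le_trans (ler_normD _ _)); apply: (le_trans (lerD (ler_normD _ _) (lexx _))).
have -> : (`|d1| + `|d2| + `|d3|) * (tau * (2 + z)) = `|d1| * (tau * (2 + z)) + `|d2| * (tau * (2 + z)) + `|d3| * (tau * (2 + z)) by ring.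
apply: lerD; first apply: lerD.
- by apply: B1; lra.
- by apply: B2; lra.
- by apply: B3; lra.
Qed.

Lemma powR_temp_ratio (T1 T2 : R) : 0 < T2 -> T2 <= 2 * T1 ->
  T1 `^ (- (3 / 2)) <= 2 `^ (3 / 2) * T2 `^ (- (3 / 2)).
Proof.
move=> T20 T21.
have -> : 2 `^ (3 / 2) = 2^-1 `^ (- (3 / 2)) :> R.
  by rewrite -[2^-1]powR_inv1// -powRrM mulN1r opprK.
by rewrite -powRM; [apply: powRN_antitone; lra|lra|lra].
Qed.

(** The exponents [a] and [z / 2] of the two Gaussians differ by at most [D (2 + z)], and both are
    above [z / 4 - 1 / 2], so that a fraction of the Gaussian remains to absorb the factor [2 + z]. *)
Lemma gauss_diff_alg (A1 A2 a z X D : R) : 0 <= A1 -> A1 <= X -> `|A1 - A2| <= X * (2 * D) ->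
  0 <= D -> 0 <= z -> z / 4 - 2^-1 <= a -> `|a - z / 2| <= D * (2 + z) ->
  `|A1 * expR (- a) - A2 * expR (- (z / 2))| <=
  X * (4 * D) * expR 1 * (4 `^ 4 * (4 `^ 4 * expR 1) * (1 + z) `^ (- 3)).
Proof.
move=> A10 A1le A12 D0 z0 ma ab; have X0 := le_trans A10 A1le.
set m := z / 4 - 2^-1 in ma.
have mb : m <= z / 2 by rewrite /m; lra.
have -> : A1 * expR (- a) - A2 * expR (- (z / 2)) = A1 * (expR (- a) - expR (- (z / 2))) + (A1 - A2) * expR (- (z / 2)) by ring.
apply: (le_trans (ler_normD _ _)); rewrite !normrM (ger0_norm A10) (ger0_norm (expR_ge0 (- (z / 2)))).
have Ed := expR_diff ma mb.
have em : expR (- m) <= expR 1 * expR (- (z / 4)) by rewrite -expRD ler_expR /m; lra.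
have ez : expR (- (z / 2)) <= expR 1 * expR (- (z / 4)) by rewrite -expRD ler_expR; lra.
set W := expR 1 * expR (- (z / 4)) in em ez.
have W0 : 0 <= W := mulr_ge0 (expR_ge0 _) (expR_ge0 _).
have S1 : A1 * `|expR (- a) - expR (- (z / 2))| <= X * (D * (2 + z) * W).
  apply: ler_pM => //; apply: (le_trans Ed); apply: ler_pM => //; exact: expR_ge0.
have S2 : `|A1 - A2| * expR (- (z / 2)) <= X * (2 * D) * W.
  by apply: ler_pM => //; exact: expR_ge0.
apply: (le_trans (lerD S1 S2)).
apply: (@le_trans _ _ (X * (4 * D) * ((1 + z) * W))).
  by have := mulr_ge0 (mulr_ge0 (mulr_ge0 X0 D0) W0) z0; lra.
have XD : 0 <= X * (4 * D) * expR 1 by rewrite mulr_ge0 ?expR_ge0// mulr_ge0// mulr_ge0.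
have -> : X * (4 * D) * ((1 + z) * W) = X * (4 * D) * expR 1 * ((1 + z) * expR (- (z / 4))) by rewrite /W; ring.
by rewrite ler_wpM2l// expR_poly4.
Qed.

(** At nearby parameters the difference of two Gaussians is of first order in the shift of the mean
    relative to the thermal speed [tau] and in the relative change of the temperature. *)
Lemma gauss_diff_pt (U1 U2 v : R3) (T1 T2 tau : R) :
  0 < T1 -> T1 <= T2 -> T2 <= 2 * T1 -> 0 < tau -> tau ^+ 2 = T2 -> n1 (U1 - U2) <= tau ->
  `|gauss U1 T1 v - gauss U2 T2 v| <=
  Cgd * (n1 (U1 - U2) / tau + (T2 - T1) / T2) * T2 `^ (- (3 / 2)) *
  (1 + T2^-1 * sqnorm (v - U2)) `^ (- 3).
Proof.
move=> T10 T12 T21 tau0 tauE n1tau.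
have T20 : 0 < T2 by lra.
have n10 := n1_ge0 (U1 - U2).
set D := _ / tau + _.
have D1 : 0 <= n1 (U1 - U2) / tau by nng.
have D2 : 0 <= (T2 - T1) / T2 by rewrite divr_ge0//; lra.
have D0 : 0 <= D by rewrite /D; lra.
set z := T2^-1 * sqnorm (v - U2).
have z0 : 0 <= z by rewrite /z; nng.
have zE : sqnorm (v - U2) = z * tau ^+ 2 by rewrite tauE /z mulrAC mulVf ?mul1r// gt_eqF.
set a := sqnorm (v - U1) / (2 * T1).
have bE : sqnorm (v - U2) / (2 * T2) = z / 2 by rewrite /z; field; rewrite gt_eqF.
set m := z / 4 - 2^-1.
have ma : m <= a.
  have H1 : sqnorm (v - U2) <= 2 * sqnorm (v - U1) + 2 * sqnorm (U1 - U2) by exact: sqnormD2.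
  have H2 : sqnorm (U1 - U2) <= tau ^+ 2.
    by apply: le_trans (sqnorm_n1 _) _; rewrite ler_sqr ?nnegrE// ltW.
  have H3 : sqnorm (v - U1) / (2 * T2) <= a.
    by rewrite /a ler_wpM2l ?sqnorm_ge0// lef_pV2 ?posrE ?mulr_gt0// ler_pM2l.
  apply: le_trans H3; rewrite ler_pdivlMr ?mulr_gt0// /m -tauE.
  by rewrite zE in H1; lra.
have ab : `|a - z / 2| <= D * (2 + z).
  have E : a - z / 2 = (sqnorm (v - U1) - sqnorm (v - U2)) / (2 * T1) + z * ((T2 - T1) / (2 * T1)).
    rewrite -bE /a /z; field; rewrite !gt_eqF//.
  have S : `|sqnorm (v - U1) - sqnorm (v - U2)| <= n1 (U1 - U2) * (tau * (2 + z)).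
    have -> : sqnorm (v - U1) - sqnorm (v - U2) =
      - (U1 - U2).1.1 * (2 * (v - U2).1.1 + - (U1 - U2).1.1) +
      - (U1 - U2).1.2 * (2 * (v - U2).1.2 + - (U1 - U2).1.2) +
      - (U1 - U2).2 * (2 * (v - U2).2 + - (U1 - U2).2).
      by rewrite /sqnorm /=; ring.
    exact: shift_three.
  rewrite E; apply: (le_trans (ler_normD _ _)).
  have t1 : (2 * T1)^-1 <= T2^-1 by rewrite lef_pV2 ?posrE ?mulr_gt0.
  have h1 : `|(sqnorm (v - U1) - sqnorm (v - U2)) / (2 * T1)| <= n1 (U1 - U2) / tau * (2 + z).
    rewrite normrM [`|(2 * T1)^-1|]ger0_norm; last by nng.
    apply: le_trans (ler_pM _ _ S t1) _; rewrite ?normr_ge0//; first by nng.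
    rewrite -tauE le_eqVlt; apply/orP; left; apply/eqP; field; rewrite gt_eqF//.
  have h2 : `|z * ((T2 - T1) / (2 * T1))| <= (T2 - T1) / T2 * z.
    have T210 : 0 <= T2 - T1 by rewrite subr_ge0.
    rewrite ger0_norm; last by rewrite mulr_ge0// divr_ge0// mulr_ge0// ltW.
    by rewrite mulrC ler_wpM2r// ler_wpM2l.
  rewrite /D [X in _ <= X]mulrDl; apply: lerD => //; apply: le_trans h2 _; rewrite ler_wpM2l//; lra.
set A1 := (2 * pi * T1) `^ (- (3 / 2)); set A2 := (2 * pi * T2) `^ (- (3 / 2)).
have pi0 : 1 <= 2 * pi :> R by have := @pi_ge2 R; lra.
have pi00 : 0 <= 2 * pi :> R by lra.
have T1T2 := powR_temp_ratio T20 T21.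
have pileq1 : (2 * pi) `^ (- (3 / 2)) <= 1 :> R.
  by have := @powRN_antitone R (3 / 2) 1 (2 * pi); rewrite powR1; apply=> //; lra.
have A1le : A1 <= 2 `^ (3 / 2) * T2 `^ (- (3 / 2)).
  apply: le_trans T1T2; rewrite /A1 powRM ?(ltW T10)// ger_pMl ?powR_gt0//.
have A12 : `|A1 - A2| <= 2 `^ (3 / 2) * T2 `^ (- (3 / 2)) * (2 * D).
  rewrite /A1 /A2 !(powRM _ pi00) ?(ltW T10) ?(ltW T20)// -mulrBr normrM ger0_norm ?powR_ge0//.
  apply: (@le_trans _ _ (`|T1 `^ (- (3 / 2)) - T2 `^ (- (3 / 2))|)); first by rewrite ler_piMl ?normr_ge0.
  have H0 : T2 `^ (- (3 / 2)) <= T1 `^ (- (3 / 2)) by apply: powRN_antitone => //; lra.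
  rewrite ger0_norm ?subr_ge0//.
  apply: le_trans (powR_prefactor T10 T12) _.
  apply: ler_pM => //; first exact: powR_ge0.
    by rewrite mulr_ge0.
  by rewrite ler_wpM2l// /D lerDr.
rewrite /gauss -/A1 -/A2 -/a bE.
apply: le_trans (gauss_diff_alg (powR_ge0 _ _) A1le A12 D0 z0 ma ab) _.
rewrite le_eqVlt; apply/orP; left; apply/eqP; rewrite /Cgd; ring.
Qed.

Definition Cgdi : R := 4 * Cgm + Cgd * 4 * japint 4.
Lemma Cgdi_ge0 : 0 <= Cgdi. Proof. by rewrite /Cgdi; have := Cgm_ge0; have := Cgd_ge0 => ? ?; nng. Qed.

Lemma ii_gauss_diff (U1 U2 : R3) (T1 T2 : R) : 0 < T1 -> 0 < T2 ->
  ii (fun v => (1 + sqnorm v) * `|gauss U1 T1 v - gauss U2 T2 v|).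
Proof.
move=> T10 T20.
apply: (ii_le _ _ (iiD (ii_gauss_weight U1 T10) (ii_gauss_weight U2 T20))).
- apply: measurable_funM; first by apply: measurable_funD => //; exact: measurable_sqnorm.
  apply: (measurableT_comp (@normr_measurable R setT)).
  by apply: measurable_funB; exact: measurable_gauss.
- move=> v; have v0 : 0 <= 1 + sqnorm v by nng.
  rewrite normrM normr_id ger0_norm// -mulrDr ler_wpM2l//.
  by apply: (le_trans (ler_normB _ _)); rewrite !ger0_norm ?gauss_ge0.
Qed.

(** For parameters that are far apart the triangle inequality suffices, since the factor [D] on the
    right is then at least [1 / 2]; otherwise the pointwise bound is integrated. The larger
    temperature sets the scale. *)
Lemma gauss_diff (U1 U2 : R3) (T1 T2 tau Y : R) :
  0 < T1 -> T1 <= T2 -> 0 < tau -> tau ^+ 2 = T2 ->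
  1 + sqnorm U1 <= Y -> 1 + sqnorm U2 <= Y -> T2 <= Y ->
  \int[leb3]_v ((1 + sqnorm v) * `|gauss U1 T1 v - gauss U2 T2 v|) <=
  Cgdi * Y * (n1 (U1 - U2) / tau + (T2 - T1) / T2).
Proof.
move=> T10 T12 tau0 tauE U1Y U2Y TY.
have T20 : 0 < T2 by lra.
have n10 := n1_ge0 (U1 - U2).
set D := _ / tau + _.
have D1 : 0 <= n1 (U1 - U2) / tau by nng.
have D2 : 0 <= (T2 - T1) / T2 by rewrite divr_ge0//; lra.
have D0 : 0 <= D by rewrite /D; lra.
have Y0 : 0 <= Y by have := sqnorm_ge0 U1; lra.
have CJ : 0 <= Cgd * 4 * japint 4 * Y * D by have := Cgd_ge0 => ?; nng.
have CM : 0 <= Cgm * Y by have := Cgm_ge0 => ?; nng.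
have CMD := mulr_ge0 CM D0.
(* The case of distant parameters. *)
have triv : 2^-1 <= D -> \int[leb3]_v ((1 + sqnorm v) * `|gauss U1 T1 v - gauss U2 T2 v|) <=
  Cgdi * Y * D.
  move=> hD.
  apply: (@le_trans _ _ (Cgm * Y + Cgm * Y)); last first.
    by have := ler_wpM2l CM hD; rewrite /Cgdi; lra.
  have T1Y : T1 <= Y by lra.
  apply: le_trans (lerD (gauss_weight T10 U1Y T1Y) (gauss_weight T20 U2Y TY)).
  rewrite -I3D; [|exact: ii_gauss_weight|exact: ii_gauss_weight].
  apply: I3_le; [exact: ii_gauss_diff|apply: iiD; exact: ii_gauss_weight|] => v.
  have v0 : 0 <= 1 + sqnorm v by nng.
  rewrite -mulrDr ler_wpM2l//.
  by apply: (le_trans (ler_normB _ _)); rewrite !ger0_norm ?gauss_ge0.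
have [hT|hT] := leP T2 (2 * T1); last first.
  apply: triv; have : 2^-1 <= (T2 - T1) / T2 by rewrite ler_pdivlMr//; lra.
  rewrite /D; lra.
have [hn|hn] := leP (n1 (U1 - U2)) tau; last first.
  apply: triv; have : 1 <= n1 (U1 - U2) / tau by rewrite ler_pdivlMr ?mul1r// ltW.
  rewrite /D; lra.
have ti : 0 < T2^-1 by rewrite invr_gt0.
have ki : ii (fun v : R3 => (1 + T2^-1 * sqnorm (v - U2)) `^ (- (4 / 2))) by apply: ii_bracketE; rewrite ?ltr_nat.
have H := I3_le (ii_gauss_diff U1 U2 T10 T20) (iiZ (4 * Y * (Cgd * D * T2 `^ (- (3 / 2)))) ki) _.
apply: le_trans (H _) _ => [v|].
  have v0 : 0 <= 1 + sqnorm v by nng.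
  have z0 : 0 <= T2^-1 * sqnorm (v - U2) by nng.
  rewrite -bracket_mul//.
  have W : 1 + sqnorm v <= 4 * Y * (1 + T2^-1 * sqnorm (v - U2)).
    apply: le_trans (weight_center v T20 U2Y TY) _.
    have : (2 * T2)^-1 * sqnorm (v - U2) <= T2^-1 * sqnorm (v - U2).
      by rewrite ler_wpM2r ?sqnorm_ge0// lef_pV2 ?posrE ?mulr_gt0// ler_peMl ?(ltW T20)// ler1n.
    by move=> hh; rewrite ler_wpM2l ?mulr_ge0// lerD2l.
  apply: le_trans (ler_pM v0 (normr_ge0 _) W (gauss_diff_pt v T10 T12 hT tau0 tauE hn)) _.
  rewrite -/D le_eqVlt; apply/orP; left; apply/eqP; ring.
rewrite I3Z// I3_bracketE ?ltr_nat//.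
have -> : T2^-1 `^ (- (3 / 2)) = T2 `^ (3 / 2).
  by rewrite -powR_inv1 ?(ltW T20)// -powRrM mulN1r opprK.
have E1 : T2 `^ (3 / 2) * T2 `^ (- (3 / 2)) = 1 by rewrite powRN mulfV// gt_eqF// powR_gt0.
apply: (@le_trans _ _ (Cgd * 4 * japint 4 * Y * D)); last first.
  have -> : Cgdi * Y * D = 4 * (Cgm * Y * D) + Cgd * 4 * japint 4 * Y * D by rewrite /Cgdi; ring.
  by rewrite lerDr mulr_ge0.
rewrite le_eqVlt; apply/orP; left; apply/eqP.
transitivity (Cgd * 4 * japint 4 * Y * D * (T2 `^ (3 / 2) * T2 `^ (- (3 / 2)))); first by ring.
by rewrite E1 mulr1.
Qed.
End gaussians.

(** * Interplay of density, temperature and energy *)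

Section weighted_class.
Context {R : realType}.
Local Notation R3 := (R3 R).

(** The velocity profiles [f(t, x, .)] of a function that is bounded in the weight [w_q]. *)
Definition dclass (q N : R) (g : R3 -> R) :=
  [/\ measurable_fun [set: R3] g, forall v, 0 <= g v & forall v, weight_w q v * g v <= N].

Section dclass.
Variables (q N : R) (g : R3 -> R).
Hypotheses (q5 : 5 < q) (N0 : 0 <= N) (cg : dclass q N g).

Lemma sqnormB0 (v : R3) : sqnorm (v - 0) = sqnorm v.
Proof. by rewrite /sqnorm /= !subr0. Qed.

Lemma dclass_bracket (v : R3) : (1 + 1 * sqnorm (v - 0)) `^ (q / 2) * g v <= N.
Proof. by case: cg => _ _ /(_ v); rewrite mul1r sqnormB0. Qed.

Lemma dclass_dens : dens g.
Proof.
case: cg => mg g0 gN; split => //.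
apply: (ii_le _ _ (iiZ N (@ii_bracketE R (q - 2) 1 (0 : R3) _ _))) => //; last by move: q5; lra.
- by apply: measurable_funM => //; apply: measurable_funD => //; exact: measurable_sqnorm.
- move=> v; have v0 : 0 < 1 + sqnorm v by rewrite ltr_wpDr//; nng.
  have w0 : 0 <= 1 + sqnorm v by nng.
  rewrite (ger0_norm (mulr_ge0 w0 (g0 v))) mul1r sqnormB0.
  have H : g v <= N * (1 + sqnorm v) `^ (- (q / 2)).
    by rewrite powRN ler_pdivlMr ?powR_gt0// mulrC; exact: gN.
  apply: le_trans (ler_wpM2l w0 H) _.
  rewrite mulrCA ler_wpM2l// le_eqVlt; apply/orP; left; apply/eqP.
  rewrite !powR_expE// -[X in X * _]lnK ?posrE// -expRD; congr expR; by field.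
Qed.

Lemma dclass_le (v : R3) : g v <= N.
Proof.
case: cg => mg g0 gN; apply: le_trans (gN v); rewrite ler_peMl//.
have := @ge0_ler_powR R (q / 2) _ 1 (1 + sqnorm v); rewrite powR1; apply; rewrite ?nnegrE//; last 2 first.
- by nng.
- by rewrite lerDl; nng.
- by rewrite divr_ge0//; move: q5; lra.
Qed.

Definition CY (q : R) : R := 2 `^ ((q - 3) / 2) * (japint q + Cmom q).
Lemma CY_ge0 : 0 <= CY q.
Proof. by rewrite /CY; have := @Cmom_ge0 R q => ?; nng. Qed.

Lemma dclass_rho : rho g <= japint q * N.
Proof.
have q3 : 3 < q by move: q5; lra.
by have := rho_decay dclass_dens ltr01 q3 N0 dclass_bracket; rewrite powR1 mulr1.
Qed.

Hypothesis rho0 : 0 < rho g.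
Let U := bulk_velocity g.
Let T := temperature g.

Lemma dclass_temp : 0 < T.
Proof. exact: (temp_gt0 dclass_dens rho0 dclass_le). Qed.

Lemma dclass_moment : rho g * (3 * T + sqnorm U) `^ ((q - 3) / 2) <= Cmom q * N.
Proof.
have := @moment_bound R g dclass_dens rho0 1 q N (0 : R3) ltr01 q5 N0 _.
rewrite powR1 mulr1 sqnormB0; apply => v.
case: cg => mg g0 gN; apply: le_trans (dclass_bracket v); rewrite ler_wpM2r//.
have X0 : 0 <= 1 * sqnorm (v - 0) by nng.
apply: ge0_ler_powR; rewrite ?nnegrE//; [by rewrite divr_ge0//; move: q5; lra|lra|lra].
Qed.

(** Every interpolation between density and energy below goes through this moment. *)
Lemma dclass_Y : rho g * (1 + sqnorm U + 3 * T) `^ ((q - 3) / 2) <= CY q * N.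
Proof.
have T0 := dclass_temp; have U0 := sqnorm_ge0 U; have r0 := ltW rho0.
have k0 : 0 <= (q - 3) / 2 by rewrite divr_ge0//; move: q5; lra.
set e := 3 * T + sqnorm U; have e0 : 0 <= e by rewrite /e; lra.
have -> : 1 + sqnorm U + 3 * T = 1 + e by rewrite /e; ring.
have H : (1 + e) `^ ((q - 3) / 2) <= 2 `^ ((q - 3) / 2) * (1 + e `^ ((q - 3) / 2)).
  have X0 := powR_ge0 e ((q - 3) / 2).
  have [h|h] := leP e 1.
  - apply: (@le_trans _ _ (2 `^ ((q - 3) / 2))); last by rewrite ler_peMr ?powR_ge0//; lra.
    by apply: ge0_ler_powR => //; rewrite ?nnegrE; lra.
  - apply: (@le_trans _ _ ((2 * e) `^ ((q - 3) / 2))).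
      by apply: ge0_ler_powR => //; rewrite ?nnegrE; lra.
    rewrite powRM//; rewrite ler_wpM2l ?powR_ge0//; lra.
apply: le_trans (ler_wpM2l r0 H) _.
have := dclass_moment; rewrite -/e => H1; have H2 := dclass_rho.
rewrite mulrCA /CY -mulrA ler_wpM2l ?powR_ge0//; lra.
Qed.
End dclass.

Definition Bkey (q : R) : R := 1 + CY q.
Definition B2key (q : R) : R := 1 + 8 * japint 4 * 6 `^ (3 / 2) * 8 `^ (q / 2).
Definition Kkey (q : R) : R := 27 * (Bkey q * B2key q).

Lemma key_const (a b : R) : 1 <= a -> 1 <= b -> a * b <= 27 * (a * b) /\ 27 * a <= 27 * (a * b).
Proof.
move=> a1 b1; have ab : a * 1 <= a * b by rewrite ler_wpM2l// (le_trans ler01).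
by split; lra.
Qed.

(** The lower bound on [3 al + 2 be] keeps a nonnegative power of [rho], and the lower bound on [q]
    a nonpositive power of [Y], in the proof of the key bound. *)
Lemma key_exponents (al be q : R) : 2 <= 3 * al + 2 * be -> 2 * (1 + be) <= al * (q - 3) ->
  0 <= al - 2 * (1 - be) / 3 /\
  2 - 2 * (1 - be) / 3 * (q / 2) - (al - 2 * (1 - be) / 3) * ((q - 3) / 2) <= 0.
Proof. by move=> *; split; lra. Qed.

Lemma powR_le1_exp (y a : R) : 1 <= y -> a <= 0 -> y `^ a <= 1.
Proof. by move=> y1 a0; rewrite -[leRHS](powRr0 y) ler_powR. Qed.

(** A power [r^a] pays for powers of [Y] up to [a k]. *)
Lemma powR_interpolate (r Y B k a b : R) : 0 < r -> 1 <= Y -> 1 <= B -> r * Y `^ k <= B ->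
  0 <= a -> a <= 1 -> b - a * k <= 0 -> r `^ a * Y `^ b <= B.
Proof.
move=> r0 Y1 B1 rY a0 a1 hb.
have Y0 : 0 < Y := lt_le_trans ltr01 Y1.
have B0 : 0 <= B := le_trans ler01 B1.
have rE : r <= B * Y `^ (- k) by rewrite powRN ler_pdivlMr ?powR_gt0.
have H : r `^ a <= (B * Y `^ (- k)) `^ a.
  by apply: ge0_ler_powR; rewrite ?nnegrE ?(ltW r0) ?(mulr_ge0 B0 (powR_ge0 _ _)).
apply: le_trans (ler_wpM2r (powR_ge0 _ _) H) _.
rewrite (powRM _ B0 (powR_ge0 _ _)) -powRrM -mulrA -powRD; last by rewrite (gt_eqF Y0) implybT.
apply: (@le_trans _ _ (B `^ a)); last exact: ler1_powR.
by rewrite ler_piMr ?powR_ge0// powR_le1_exp// mulNr addrC mulrC.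
Qed.

(** The case in which the mean velocity dominates, with [X = 1 + |U|^2]: the mass is then controlled
    by concentration near [U]. *)
Lemma key_bound_fast (al be q r T X Y C B : R) : 2 <= 3 * al + 2 * be -> al <= 1 ->
  2 * (1 + be) <= al * (q - 3) -> 0 <= be -> be <= 1 -> 0 <= q ->
  0 < r -> 0 < T -> 0 < X -> 1 <= Y -> Y <= 2 * X -> 0 <= C -> 1 <= B ->
  r * Y `^ ((q - 3) / 2) <= B ->
  r <= C * (6 * T) `^ (3 / 2) * (X / 4) `^ (- (q / 2)) ->
  r `^ al * T `^ (be - 1) * Y `^ 2 <= (1 + C * 6 `^ (3 / 2) * 8 `^ (q / 2)) * B.
Proof.
move=> hab al1 hq be0 be1 q0 r0 T0 X0 Y1 YX C0 B1 rY rT.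
have Y0 : 0 < Y := lt_le_trans ltr01 Y1.
have [g0 g1] := key_exponents hab hq.
have gam0 : 0 <= 2 * (1 - be) / 3 by rewrite divr_ge0// mulr_ge0// subr_ge0.
have gamE : 3 / 2 * - (2 * (1 - be) / 3) = be - 1 by field.
have gam1 : 2 * (1 - be) / 3 <= 1 by clear -be0; lra.
move: (2 * (1 - be) / 3) gam0 gamE gam1 g0 g1 => gam gam0 gamE gam1 g0 g1.
set D := C * 6 `^ (3 / 2) * 8 `^ (q / 2).
have D0 : 0 <= D by rewrite /D !mulr_ge0 ?powR_ge0.
have D1 : 1 <= 1 + D by rewrite lerDl.
have X40 : 0 < X / 4 by rewrite divr_gt0.
have r1 : 0 < r * Y `^ (q / 2) by rewrite mulr_gt0 ?powR_gt0.
(* Concentration near [U] bounds [r Y^(q/2)] by [T^(3/2)]; its power [- gam] turns the negative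
   power of [T] into powers of [r] and [Y]. *)
have H2 : r * Y `^ (q / 2) <= (1 + D) * T `^ (3 / 2).
  have H3 : Y `^ (q / 2) <= 8 `^ (q / 2) * (X / 4) `^ (q / 2).
    rewrite -(powRM _ (ler0n _ 8) (ltW X40)).
    have E8 : 8 * (X / 4) = 2 * X by field.
    by apply: ge0_ler_powR; rewrite ?nnegrE ?E8 ?(ltW Y0) ?mulr_ge0 ?(ltW X0) ?divr_ge0.
  apply: le_trans (ler_pM (ltW r0) (powR_ge0 _ _) rT H3) _.
  have E : (X / 4) `^ (- (q / 2)) * (X / 4) `^ (q / 2) = 1.
    by rewrite powRN mulVf// gt_eqF// powR_gt0.
  rewrite (powRM _ (ler0n _ 6) (ltW T0)).
  move: ((X / 4) `^ (- (q / 2))) ((X / 4) `^ (q / 2)) E => x1 x2 E.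
  have -> : C * (6 `^ (3 / 2) * T `^ (3 / 2)) * x1 * (8 `^ (q / 2) * x2) = D * T `^ (3 / 2) * (x1 * x2).
    by rewrite /D; ring.
  by rewrite E mulr1 ler_wpM2r ?powR_ge0// lerDr.
have H4 : T `^ (be - 1) <= (1 + D) * (r * Y `^ (q / 2)) `^ (- gam).
  have := powRN_antitone gam0 r1 H2.
  rewrite (powRM _ (le_trans ler01 D1) (powR_ge0 _ _)) -[T `^ _ `^ _]powRrM gamE.
  rewrite [(1 + D) `^ _]powRN mulrC ler_pdivrMr ?powR_gt0 ?(lt_le_trans ltr01 D1)//.
  move=> H5; apply: le_trans H5 _; rewrite mulrC ler_wpM2r ?powR_ge0//.
  by apply: ler1_powR.
have key : r `^ (al - gam) * Y `^ (2 - gam * (q / 2)) <= B.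
  apply: (powR_interpolate r0 Y1 B1 rY g0) g1.
  by rewrite lerBlDr -[al]addr0 lerD.
apply: le_trans (ler_wpM2l _ key); last exact: le_trans D1.
apply: (@le_trans _ _ (r `^ al * ((1 + D) * (r * Y `^ (q / 2)) `^ (- gam)) * Y `^ 2)).
  by rewrite ler_wpM2r ?powR_ge0// ler_wpM2l ?powR_ge0.
rewrite (powRM _ (ltW r0) (powR_ge0 _ _)) -powRrM le_eqVlt; apply/orP; left; apply/eqP.
rewrite !powRD ?(gt_eqF r0) ?(gt_eqF Y0) ?implybT//.
by rewrite mulrN [q / 2 * gam]mulrC; ring.
Qed.

(** The case in which the temperature dominates and is comparable to [Y]. *)
Lemma key_bound_hot (al be k r T Y B : R) : 0 <= al -> al <= 1 -> 0 <= be -> be <= 1 ->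
  1 + be <= al * k -> 0 < r -> 1 <= Y -> Y / 27 <= T -> 1 <= B -> r * Y `^ k <= B ->
  r `^ al * T `^ (be - 1) * Y `^ 2 <= 27 * B.
Proof.
move=> al0 al1 be0 be1 hq r0 Y1 YT B1 rY.
have Y0 : 0 < Y := lt_le_trans ltr01 Y1.
have b0 : 0 <= 1 - be by rewrite subr_ge0.
have H : T `^ (be - 1) <= 27 * Y `^ (be - 1).
  have Y27 : 0 < Y / 27 by rewrite divr_gt0.
  have := powRN_antitone b0 Y27 YT; rewrite opprB => H; apply: le_trans H _.
  rewrite powRM ?(ltW Y0) ?invr_ge0// mulrC ler_wpM2r ?powR_ge0//.
  rewrite -[27^-1]powR_inv1// -powRrM mulN1r opprB.
  by apply: ler1_powR; rewrite ?ler1n// gerBl.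
have key : r `^ al * Y `^ (1 + be) <= B.
  by apply: (powR_interpolate r0 Y1 B1 rY) => //; rewrite subr_le0.
apply: le_trans (ler_wpM2l (ler0n _ 27) key).
apply: (@le_trans _ _ (r `^ al * (27 * Y `^ (be - 1)) * Y `^ 2)).
  by rewrite ler_wpM2r ?powR_ge0// ler_wpM2l ?powR_ge0.
rewrite le_eqVlt; apply/orP; left; apply/eqP.
have -> : 1 + be = (be - 1) + 2 by ring.
by rewrite [Y `^ (be - 1 + 2)]powRD ?(gt_eqF Y0) ?implybT//; ring.
Qed.
Lemma le_double_of_cold (u T : R) : 0 < T -> 24 * T <= 1 + u -> 1 + u + 3 * T <= 2 * (1 + u).
Proof. by move=> *; lra. Qed.

Lemma energy_le_of_hot (u T : R) : 1 + u < 24 * T -> (1 + u + 3 * T) / 27 <= T.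
Proof. by move=> *; lra. Qed.

Lemma Bkey_ge1 q : 1 <= Bkey q.
Proof. by rewrite /Bkey lerDl CY_ge0. Qed.

Lemma B2key_ge1 q : 1 <= B2key q.
Proof. by rewrite /B2key lerDl; nng. Qed.

Lemma Kkey_ge1 q : 1 <= Kkey q.
Proof.
have [_ h] := key_const (Bkey_ge1 q) (B2key_ge1 q); apply: le_trans h.
by apply: (le_trans (Bkey_ge1 q)); rewrite ler_peMl ?(le_trans ler01 (Bkey_ge1 q))// ler1n.
Qed.

Section key.
Variables (q al be : R).
Hypotheses (q5 : 5 < q) (al0 : 0 < al) (al1 : al <= 1) (be0 : 0 <= be) (be1 : be <= 1).
Hypotheses (hab : 2 <= 3 * al + 2 * be) (hq : 2 * (1 + be) <= al * (q - 3)).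
Variable g : R3 -> R.
Hypothesis cg : dclass q 1 g.
Hypothesis rho0 : 0 < rho g.
Let U := bulk_velocity g.
Let T := temperature g.
Let Y := 1 + sqnorm U + 3 * T.

(** The coefficient of the Lipschitz estimate: as [be <= 1] it degenerates at small temperatures,
    and it grows with the energy [Y]. Concentration excludes small temperatures unless the density
    is small as well, and the high moment bounds powers of [Y] by powers of [1 / rho]. *)
Lemma key_bound : rho g `^ al * T `^ (be - 1) * Y ^+ 2 <= Kkey q.
Proof.
have T0 : 0 < T := dclass_temp q5 ler01 cg rho0.
have B1 := Bkey_ge1 q; have B21 := B2key_ge1 q.
have rY : rho g * Y `^ ((q - 3) / 2) <= Bkey q.
  by apply: (le_trans (dclass_Y q5 ler01 cg rho0)); rewrite mulr1 /Bkey lerDr.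
have conc : 24 * T <= 1 + sqnorm U ->
    rho g <= 8 * japint 4 * (6 * T) `^ (3 / 2) * ((1 + sqnorm U) / 4) `^ (- (q / 2)).
  have := @concentration_weight R g (dclass_dens q5 ler01 cg) rho0 T0 1 1 q 1 (0 : R3) ler01 ltr01
    (lt_trans (ltr0n _ 5) q5) ler01 (dclass_bracket cg).
  by rewrite sqnormB0 !mulr1 !mul1r.
have U0 := sqnorm_ge0 U; have q0 : 0 <= q := le_trans (ler0n _ 5) (ltW q5).
rewrite /Y in rY *; move: (sqnorm U) (rho g) rho0 T T0 U0 rY conc => u r r0 T1 T0' U0 rY conc.
have Y1 : 1 <= 1 + u + 3 * T1 by rewrite -addrA lerDl addr_ge0// mulr_ge0// ltW.
rewrite -powR_mulrn ?(le_trans ler01 Y1)//.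
have [h|h] := leP (24 * T1) (1 + u).
- apply: le_trans (key_bound_fast hab al1 hq be0 be1 q0 r0 T0' _ Y1 _ _ B1 rY (conc h)) _.
  + by rewrite ltr_wpDr.
  + exact: le_double_of_cold.
  + by rewrite mulr_ge0// japint_ge0.
  + by rewrite -/(B2key q) mulrC; exact: (key_const B1 B21).1.
- apply: le_trans (key_bound_hot (ltW al0) al1 be0 be1 _ r0 Y1 _ B1 rY) (key_const B1 B21).2.
  + by rewrite mulrA ler_pdivlMr// mulrC.
  + exact: energy_le_of_hot.
Qed.
End key.
End weighted_class.

(** * Differences of the macroscopic fields *)

Section field_differences.
Context {R : realType}.
Local Notation R3 := (R3 R).

Lemma coords_le_radius (s T a b c : R) : 0 <= s -> 0 <= T ->
  1 + (a ^+ 2 + b ^+ 2 + c ^+ 2) + 3 * T <= s ^+ 2 -> [/\ `|a| <= s, `|b| <= s & `|c| <= s].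
Proof.
move=> s0 T0 H; have a2 := sqr_ge0 a; have b2 := sqr_ge0 b; have c2 := sqr_ge0 c.
by split; rewrite -ler_sqr ?nnegrE// real_normK ?num_real//; lra.
Qed.

Lemma le_succ_add (a b : R) : a + b <= 1 + a + b. Proof. by rewrite -addrA lerDr. Qed.

Lemma sum_three (r d s x y z x' y' z' : R) :
  r * x <= d * (1 + x') -> r * y <= d * (1 + y') -> r * z <= d * (1 + z') ->
  d * (1 + x') <= d * (2 * s) -> d * (1 + y') <= d * (2 * s) -> d * (1 + z') <= d * (2 * s) ->
  r * x + r * y + r * z <= 6 * d * s.
Proof. by move=> *; lra. Qed.

Lemma temp_split (rf rg Tf Tg a1 a2 a3 b1 b2 b3 : R) :
  rf * (Tf - Tg) = 3^-1 * (rf * (a1 ^+ 2 + a2 ^+ 2 + a3 ^+ 2 + 3 * Tf) - rg * (b1 ^+ 2 + b2 ^+ 2 + b3 ^+ 2 + 3 * Tg)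
   - (rf - rg) * (b1 ^+ 2 + b2 ^+ 2 + b3 ^+ 2 + 3 * Tg)
   - rf * (a1 ^+ 2 - b1 ^+ 2) - rf * (a2 ^+ 2 - b2 ^+ 2) - rf * (a3 ^+ 2 - b3 ^+ 2)).
Proof. by field. Qed.

Lemma temp_sum (x A B q1 q2 q3 d s2 : R) : x <= A + B + q1 + q2 + q3 -> A <= d -> B <= d * s2 ->
  q1 <= 4 * d * s2 -> q2 <= 4 * d * s2 -> q3 <= 4 * d * s2 -> 0 <= d -> d <= d * s2 -> 3^-1 * x <= 5 * d * s2.
Proof. by move=> *; lra. Qed.

(** Since [a <= 1] and [x <= y], [x^a] is at least [x y^(a - 1)]. *)
Lemma powR_lip (a x y : R) : 0 <= a -> a <= 1 -> 0 < x -> x <= y ->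
  y `^ a - x `^ a <= y `^ (a - 1) * (y - x).
Proof.
move=> a0 a1 x0 xy; have y0 : 0 < y by lra.
have H : y `^ (a - 1) * x <= x `^ a.
  have E : x `^ a = x `^ (a - 1) * x.
    by rewrite !powR_expE// -[X in _ = _ * X]lnK ?posrE// -expRD; congr expR; ring.
  rewrite E ler_wpM2r ?(ltW x0)//.
  have := @powRN_antitone R (1 - a) x y; rewrite opprB; apply=> //; lra.
have E : y `^ a = y `^ (a - 1) * y.
  by rewrite !powR_expE// -[X in _ = _ * X]lnK ?posrE// -expRD; congr expR; ring.
rewrite mulrBr -E; lra.
Qed.

Lemma powR_lip_max (a x y : R) : 0 <= a -> a <= 1 -> 0 < x -> 0 < y ->
  `|x `^ a - y `^ a| <= Num.max x y `^ (a - 1) * `|x - y|.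
Proof.
move=> a0 a1; wlog xy : x y / x <= y => [H|] x0 y0.
  case/orP: (le_total x y) => h; first exact: H.
  by rewrite distrC [`|x - y|]distrC maxC; apply: H.
rewrite (max_idPr xy) distrC [`|x - y|]distrC !ger0_norm ?subr_ge0//.
  exact: powR_lip.
by apply: ge0_ler_powR; rewrite ?nnegrE ?(ltW x0) ?(ltW y0).
Qed.

Section moment_diff.
Variables (f g : R3 -> R).
Hypotheses (df : dens f) (dg : dens g) (rf : 0 < rho f) (rg : 0 < rho g).
Let w (v : R3) := 1 + sqnorm v.
Definition wdist : R := \int[leb3]_v ((1 + sqnorm v) * `|f v - g v|).
Let d := wdist.
Let Yf := 1 + sqnorm (bulk_velocity f) + 3 * temperature f.
Let Yg := 1 + sqnorm (bulk_velocity g) + 3 * temperature g.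

Lemma ii_wdist : ii (fun v => (1 + sqnorm v) * `|f v - g v|).
Proof.
have [mf f0 fi] := df; have [mg g0 gi] := dg.
apply: (ii_le _ _ (iiD fi gi)).
- apply: measurable_funM; first by apply: measurable_funD => //; exact: measurable_sqnorm.
  by apply: (measurableT_comp (@normr_measurable R setT)); exact: measurable_funB.
- move=> v; have v0 : 0 <= 1 + sqnorm v by nng.
  rewrite normrM normr_id ger0_norm// -mulrDr ler_wpM2l//.
  by apply: (le_trans (ler_normB _ _)); rewrite !ger0_norm.
Qed.

Lemma wdist_ge0 : 0 <= d.
Proof. by apply: I3_ge0 => v; nng. Qed.

Lemma moment_diff (k : R3 -> R) : measurable_fun [set: R3] k ->
  (forall v, `|k v| <= 1 + sqnorm v) ->
  `|\int[leb3]_v (k v * f v) - \int[leb3]_v (k v * g v)| <= d.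
Proof.
move=> mk kw.
have kf : ii (fun v => k v * f v) by apply: (dens_ii df (K := 1)) => // v; rewrite mul1r.
have kg : ii (fun v => k v * g v) by apply: (dens_ii dg (K := 1)) => // v; rewrite mul1r.
rewrite -I3B//; apply: (le_trans (I3_abs (iiB kf kg))).
apply: I3_le; [exact: ii_abs (iiB kf kg)|exact: ii_wdist|] => v.
by rewrite -mulrBr normrM ler_wpM2r.
Qed.

Lemma rho_diff : `|rho f - rho g| <= d.
Proof.
have := @moment_diff (fun=> 1) (measurable_cst _) _.
under eq_Rintegral do rewrite mul1r.
under [X in _ - X]eq_Rintegral do rewrite mul1r.
by apply => v; rewrite normr1 lerDl; nng.
Qed.

Lemma coord_le_weight (x y z : R) : 0 <= y -> 0 <= z -> `|x| <= 1 + (x ^+ 2 + y + z).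
Proof.
move=> y0 z0; have := sqr_ge0 (x - 2^-1); have := sqr_ge0 (x + 2^-1).
by rewrite ler_norml; lra.
Qed.

Let coordU (u1 u2 r1 r2 : R) : 0 < r1 -> `|r1 * u1 - r2 * u2| <= d -> `|r1 - r2| <= d ->
  r1 * `|u1 - u2| <= d * (1 + `|u2|).
Proof.
move=> r0 H1 H2; have -> : r1 * `|u1 - u2| = `|r1 * u1 - r2 * u2 - (r1 - r2) * u2|.
  by rewrite -[r1 in LHS](ger0_norm (ltW r0)) -normrM; congr `|_|; ring.
apply: (le_trans (ler_normB _ _)); rewrite normrM mulrDr mulr1; apply: lerD => //.
exact: ler_wpM2r.
Qed.

(** By [rho f (U f - U g) = (rho f U f - rho g U g) - (rho f - rho g) U g]. The factor [rho f]
    cannot be removed, as the mean velocity is not continuous at the vacuum. *)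
Lemma velocity_diff : [/\
  rho f * `|(bulk_velocity f).1.1 - (bulk_velocity g).1.1| <= d * (1 + `|(bulk_velocity g).1.1|),
  rho f * `|(bulk_velocity f).1.2 - (bulk_velocity g).1.2| <= d * (1 + `|(bulk_velocity g).1.2|) &
  rho f * `|(bulk_velocity f).2 - (bulk_velocity g).2| <= d * (1 + `|(bulk_velocity g).2|)].
Proof.
have Hr := rho_diff.
split; apply: coordU => //; try exact: Hr.
- rewrite -(mom1 rf) -(mom1 rg); apply: moment_diff; first exact: measurable_R3_1.
  by move=> v; apply: coord_le_weight; exact: sqr_ge0.
- rewrite -(mom2 rf) -(mom2 rg); apply: moment_diff; first exact: measurable_R3_2.
  move=> v; apply: le_trans (coord_le_weight v.1.2 (sqr_ge0 v.1.1) (sqr_ge0 v.2)) _.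
  by rewrite /sqnorm; lra.
- rewrite -(mom3 rf) -(mom3 rg); apply: moment_diff; first exact: measurable_R3_3.
  move=> v; apply: le_trans (coord_le_weight v.2 (sqr_ge0 v.1.1) (sqr_ge0 v.1.2)) _.
  by rewrite /sqnorm; lra.
Qed.

Variable s : R.
Hypotheses (s0 : 0 <= s) (Ys : Yf <= s ^+ 2) (Yg_s : Yg <= s ^+ 2).

Let s1 : 1 <= s.
Proof.
rewrite -ler_sqr ?nnegrE// expr1n; apply: le_trans Ys; rewrite /Yf.
have := sqnorm_ge0 (bulk_velocity f); have := temp_ge0 df rf; lra.
Qed.

Let velo (h : R3 -> R) : dens h -> 0 < rho h ->
  1 + sqnorm (bulk_velocity h) + 3 * temperature h <= s ^+ 2 ->
  [/\ `|(bulk_velocity h).1.1| <= s, `|(bulk_velocity h).1.2| <= s & `|(bulk_velocity h).2| <= s].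
Proof. by move=> dh rh; exact: coords_le_radius s0 (temp_ge0 dh rh). Qed.

Lemma velocity_diff_n1 : rho f * n1 (bulk_velocity f - bulk_velocity g) <= 6 * d * s.
Proof.
have [v1 v2 v3] := velocity_diff; have [g1 g2 g3] := velo dg rg Yg_s.
have d0 := wdist_ge0; have s1' := s1.
rewrite /n1 /= !mulrDr.
have K (x : R) : x <= s -> d * (1 + x) <= d * (2 * s).
  by move=> xs; rewrite ler_wpM2l//; lra.
exact: (sum_three v1 v2 v3 (K _ g1) (K _ g2) (K _ g3)).
Qed.

Let sqdiff (r x y : R) : 0 <= r -> r * `|x - y| <= d * (1 + `|y|) -> `|x| <= s -> `|y| <= s ->
  r * `|x ^+ 2 - y ^+ 2| <= 4 * d * s ^+ 2.
Proof.
move=> r0 H xs ys; have -> : x ^+ 2 - y ^+ 2 = (x - y) * (x + y) by ring.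
have d0 := wdist_ge0; have s1' := s1.
rewrite normrM mulrA; apply: (@le_trans _ _ (d * (1 + `|y|) * (2 * s))).
  apply: ler_pM => //; first by rewrite mulr_ge0.
  apply: (le_trans (ler_normD _ _)); lra.
have -> : 4 * d * s ^+ 2 = d * (2 * s) * (2 * s) by ring.
rewrite ler_wpM2r//; [lra|rewrite ler_wpM2l//; lra].
Qed.

(** Here [s] bounds all velocities and thermal speeds, and [s^2] plays the role of [Y]. *)
Lemma temp_diff : rho f * `|temperature f - temperature g| <= 5 * d * s ^+ 2.
Proof.
have [v1 v2 v3] := velocity_diff.
have [f1 f2 f3] := velo df rf Ys; have [g1 g2 g3] := velo dg rg Yg_s.
have d0 := wdist_ge0; have s1' := s1; have r0 := ltW rf.
set uf := bulk_velocity f in v1 v2 v3 f1 f2 f3 *; set ug := bulk_velocity g in v1 v2 v3 g1 g2 g3 *.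
have q1 := sqdiff r0 v1 f1 g1; have q2 := sqdiff r0 v2 f2 g2; have q3 := sqdiff r0 v3 f3 g3.
have E : `|rho f * (sqnorm uf + 3 * temperature f) - rho g * (sqnorm ug + 3 * temperature g)| <= d.
  rewrite -(momE rf) -(momE rg); apply: moment_diff; first exact: measurable_sqnorm.
  by move=> v; rewrite ger0_norm ?sqnorm_ge0// lerDr.
have Hr := rho_diff.
have eg : `|(rho f - rho g) * (sqnorm ug + 3 * temperature g)| <= d * s ^+ 2.
  rewrite normrM; apply: ler_pM => //.
  have T0 := temp_ge0 dg rg; have n0 := sqnorm_ge0 ug.
  rewrite ger0_norm; last by rewrite addr_ge0// mulr_ge0.
  exact: le_trans (le_succ_add _ _) Yg_s.
have -> : rho f * `|temperature f - temperature g| = 3^-1 * `|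
   (rho f * (sqnorm uf + 3 * temperature f) - rho g * (sqnorm ug + 3 * temperature g))
   - (rho f - rho g) * (sqnorm ug + 3 * temperature g)
   - rho f * (uf.1.1 ^+ 2 - ug.1.1 ^+ 2) - rho f * (uf.1.2 ^+ 2 - ug.1.2 ^+ 2)
   - rho f * (uf.2 ^+ 2 - ug.2 ^+ 2)|.
  rewrite -[rho f in LHS](ger0_norm r0) -normrM -[3^-1]ger0_norm ?invr_ge0// -normrM; congr `|_|.
  exact: temp_split.
have := ler_normB; move=> nB.
set A := _ - rho g * _ in E *; set B := (rho f - rho g) * _ in eg *.
set Q1 := rho f * (uf.1.1 ^+ 2 - _); set Q2 := rho f * (uf.1.2 ^+ 2 - _); set Q3 := rho f * (uf.2 ^+ 2 - _).
have n1' : `|Q1| <= 4 * d * s ^+ 2 by rewrite normrM (ger0_norm r0).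
have n2' : `|Q2| <= 4 * d * s ^+ 2 by rewrite normrM (ger0_norm r0).
have n3' : `|Q3| <= 4 * d * s ^+ 2 by rewrite normrM (ger0_norm r0).
have S : `|A - B - Q1 - Q2 - Q3| <= `|A| + `|B| + `|Q1| + `|Q2| + `|Q3|.
  do 3 (apply: (le_trans (ler_normB _ _)); rewrite lerD2r).
  exact: ler_normB.
have ss : d <= d * s ^+ 2 by rewrite ler_peMr//; rewrite expr_ge1.
exact: (temp_sum S E eg n1' n2' n3' d0 ss).
Qed.

End moment_diff.
End field_differences.

(** * Lipschitz estimate for the collision operator *)

Section lipschitz_algebra.
Context {R : realType}.
Section algebra.
Variables (al be K r1 r2 T1 T2 Y1 Y2 d : R).
Hypotheses (al0 : 0 < al) (al1 : al <= 1) (be0 : 0 <= be) (be1 : be <= 1).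
Hypotheses (r10 : 0 < r1) (r12 : r1 <= r2) (T10 : 0 < T1) (T20 : 0 < T2).
Hypotheses (Y11 : 1 <= Y1) (Y21 : 1 <= Y2) (TY1 : T1 <= Y1) (TY2 : T2 <= Y2).
Hypotheses (d0 : 0 <= d) (k1 : r1 `^ al * T1 `^ (be - 1) * Y1 ^+ 2 <= K)
  (k2 : r2 `^ al * T2 `^ (be - 1) * Y2 ^+ 2 <= K).

Lemma powR_pred (x a : R) : 0 < x -> x `^ a = x `^ (a - 1) * x.
Proof.
by move=> x0; rewrite !powR_expE// -[X in _ = _ * X]lnK ?posrE// -expRD; congr expR; ring.
Qed.

(** The key bound for mixed arguments: the smaller density with the larger temperature and the
    larger energy. It holds because [T^(be - 1)] decreases in [T] and [r^al] increases in [r]. *)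
Lemma lip_key : r1 `^ al * Num.max T1 T2 `^ (be - 1) * Num.max Y1 Y2 ^+ 2 <= K.
Proof.
have b0 : 0 <= 1 - be by rewrite subr_ge0.
have anti x : 0 < x -> x <= Num.max T1 T2 -> Num.max T1 T2 `^ (be - 1) <= x `^ (be - 1).
  by move=> x0 xT; have := powRN_antitone b0 x0 xT; rewrite opprB.
have r20 : 0 < r2 := lt_le_trans r10 r12.
have rr : r1 `^ al <= r2 `^ al.
  by apply: ge0_ler_powR; rewrite ?nnegrE ?(ltW al0) ?(ltW r10) ?(ltW r20).
case/orP: (le_total Y1 Y2) => h.
- rewrite (max_idPr h); apply: le_trans k2; rewrite ler_wpM2r ?sqr_ge0//.
  apply: ler_pM; [exact: powR_ge0|exact: powR_ge0|exact: rr|].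
  by apply: anti => //; rewrite le_max lexx orbT.
- rewrite (max_idPl h); apply: le_trans k1; rewrite ler_wpM2r ?sqr_ge0//.
  by rewrite ler_wpM2l ?powR_ge0//; apply: anti => //; rewrite le_max lexx.
Qed.

Variables (Ts Ym : R).
Hypotheses (TsE : Ts = Num.max T1 T2) (YmE : Ym = Num.max Y1 Y2).

Lemma lip_Ts0 : 0 < Ts. Proof. by rewrite TsE lt_max T10. Qed.
Lemma lip_Ym0 : 0 <= Ym.
Proof. by rewrite YmE le_max (le_trans ler01). Qed.
Lemma lip_TsY : Ts <= Ym.
Proof. by rewrite TsE YmE ge_max !le_max TY1 TY2 orbT. Qed.
Lemma lip_T1s : T1 <= Ts. Proof. by rewrite TsE le_max lexx. Qed.
Lemma lip_T2s : T2 <= Ts. Proof. by rewrite TsE le_max lexx orbT. Qed.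

Lemma lip_F1 : r1 `^ al * Ts `^ (be - 1) * Ym ^+ 2 <= K.
Proof. by rewrite TsE YmE; exact: lip_key. Qed.

Lemma lip_F2 : r1 `^ al * Ts `^ be * Ym <= K.
Proof.
have Ts0 := lip_Ts0; have Ym0 := lip_Ym0.
apply: le_trans lip_F1; rewrite (powR_pred be Ts0).
have -> : r1 `^ al * (Ts `^ (be - 1) * Ts) * Ym = (r1 `^ al * Ts `^ (be - 1)) * (Ts * Ym) by ring.
by rewrite ler_wpM2l ?mulr_ge0 ?powR_ge0// expr2 ler_wpM2r// lip_TsY.
Qed.

Lemma lip_nuY : r2 `^ al * T2 `^ be * Y2 <= K.
Proof.
have Y20 : 0 <= Y2 by apply: le_trans Y21.
apply: le_trans k2; rewrite (powR_pred be T20).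
have -> : r2 `^ al * (T2 `^ (be - 1) * T2) * Y2 = (r2 `^ al * T2 `^ (be - 1)) * (T2 * Y2) by ring.
by rewrite ler_wpM2l ?mulr_ge0 ?powR_ge0// expr2 ler_wpM2r.
Qed.

Hypothesis dr : `|r1 - r2| <= d.
Hypothesis dT : `|T1 - T2| * r1 <= 5 * d * Ym.

(** The differences of density and temperature are known with the smaller density as a factor, which
    is why [r1] stands in front; the loss [Ts^(be - 1) Ym^2] is the one of the key bound. *)
Lemma lip_nu_diff : `|r1 `^ al * T1 `^ be - r2 `^ al * T2 `^ be| * r1 * Ym <= 6 * K * d.
Proof.
have Ts0 := lip_Ts0; have Ym0 := lip_Ym0; have r0 := ltW r10.
have F1 := lip_F1; have F2 := lip_F2.
have -> : r1 `^ al * T1 `^ be - r2 `^ al * T2 `^ be =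
  r1 `^ al * (T1 `^ be - T2 `^ be) + (r1 `^ al - r2 `^ al) * T2 `^ be by ring.
have A : `|r1 `^ al * (T1 `^ be - T2 `^ be)| * r1 * Ym <= 5 * K * d.
  rewrite normrM ger0_norm ?powR_ge0//.
  have L := powR_lip_max be0 be1 T10 T20; rewrite -TsE in L.
  apply: (@le_trans _ _ (r1 `^ al * (Ts `^ (be - 1) * `|T1 - T2|) * r1 * Ym)).
    by rewrite ler_wpM2r// ler_wpM2r// ler_wpM2l ?powR_ge0.
  apply: (@le_trans _ _ (r1 `^ al * Ts `^ (be - 1) * (5 * d * Ym) * Ym)).
    rewrite ler_wpM2r// -!mulrA ler_wpM2l ?powR_ge0// ler_wpM2l ?powR_ge0//.
    by move: dT; rewrite !mulrA.
  have -> : r1 `^ al * Ts `^ (be - 1) * (5 * d * Ym) * Ym = 5 * (r1 `^ al * Ts `^ (be - 1) * Ym ^+ 2 * d) by ring.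
  by rewrite -[X in _ <= X]mulrA ler_wpM2l// ler_wpM2r.
have B : `|(r1 `^ al - r2 `^ al) * T2 `^ be| * r1 * Ym <= K * d.
  rewrite normrM [`|T2 `^ be|]ger0_norm ?powR_ge0//.
  have r20 : 0 < r2 := lt_le_trans r10 r12.
  have L := powR_lip_max (ltW al0) al1 r10 r20; rewrite (max_idPr r12) in L.
  have e : r2 `^ (al - 1) <= r1 `^ (al - 1).
    have b0 : 0 <= 1 - al by rewrite subr_ge0.
    by have := powRN_antitone b0 r10 r12; rewrite opprB.
  have {}L : `|r1 `^ al - r2 `^ al| <= r1 `^ (al - 1) * d.
    by apply: (le_trans L); apply: ler_pM; rewrite ?powR_ge0.
  apply: (@le_trans _ _ (r1 `^ (al - 1) * d * Ts `^ be * r1 * Ym)).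
    rewrite ler_wpM2r// ler_wpM2r//; apply: ler_pM; rewrite ?powR_ge0//.
    by apply: ge0_ler_powR; rewrite ?nnegrE ?(ltW T20) ?(ltW Ts0)// lip_T2s.
  have -> : r1 `^ (al - 1) * d * Ts `^ be * r1 * Ym = r1 `^ al * Ts `^ be * Ym * d.
    by rewrite (powR_pred al r10); ring.
  by rewrite ler_wpM2r.
apply: le_trans (ler_wpM2r Ym0 (ler_wpM2r r0 (ler_normD _ _))) _.
apply: (@le_trans _ _ (5 * K * d + K * d)); last first.
  by rewrite le_eqVlt; apply/orP; left; apply/eqP; ring.
by rewrite [_ * r1]mulrDl [_ * Ym]mulrDl; apply: lerD.
Qed.

Variables (n tau s : R).
Hypotheses (n0 : 0 <= n) (tau0 : 0 < tau) (tauE : tau ^+ 2 = Ts) (s0 : 0 <= s) (sE : s ^+ 2 = Ym).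
Hypothesis (dn : r1 * n <= 6 * d * s).

(** The distance of the Gaussians costs [1 / tau] for the velocities and [1 / Ts] for the
    temperatures; both turn [Ts^be] into at worst [Ts^(be - 1)]. *)
Lemma lip_gauss : r1 `^ al * T1 `^ be * r1 * (Ym * (n / tau + `|T1 - T2| / Ts)) <= 11 * K * d.
Proof.
have Ts0 := lip_Ts0; have Ym0 := lip_Ym0; have r0 := ltW r10; have F1 := lip_F1.
have tauS : tau <= s by rewrite -ler_sqr ?nnegrE ?(ltW tau0)// tauE sE lip_TsY.
have TT : T1 `^ be <= Ts `^ be.
  by apply: ge0_ler_powR; rewrite ?nnegrE ?(ltW T10) ?(ltW Ts0)// lip_T1s.
have P1 : r1 `^ al * Ts `^ be * Ym * (r1 * n / tau) <= 6 * K * d.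
  apply: (@le_trans _ _ (r1 `^ al * Ts `^ be * Ym * (6 * d * s / tau))).
    by rewrite ler_wpM2l ?mulr_ge0 ?powR_ge0// ler_wpM2r ?invr_ge0 ?(ltW tau0).
  have -> : r1 `^ al * Ts `^ be * Ym * (6 * d * s / tau) = 6 * (r1 `^ al * Ts `^ (be - 1) * Ym * (tau * s)) * d.
    by rewrite (powR_pred be Ts0) -{2}tauE; field; rewrite gt_eqF.
  rewrite ler_wpM2r// ler_wpM2l//; apply: le_trans F1.
  rewrite -[X in X <= _]mulrA ler_wpM2l ?mulr_ge0 ?powR_ge0// expr2 ler_wpM2l//.
  by rewrite -[leRHS]sE expr2 ler_wpM2r.
have P2 : r1 `^ al * Ts `^ be * Ym * (`|T1 - T2| * r1 / Ts) <= 5 * K * d.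
  apply: (@le_trans _ _ (r1 `^ al * Ts `^ be * Ym * (5 * d * Ym / Ts))).
    by rewrite ler_wpM2l ?mulr_ge0 ?powR_ge0// ler_wpM2r ?invr_ge0 ?(ltW Ts0).
  have -> : r1 `^ al * Ts `^ be * Ym * (5 * d * Ym / Ts) = 5 * (r1 `^ al * Ts `^ (be - 1) * Ym ^+ 2) * d.
    by rewrite (powR_pred be Ts0); field; rewrite gt_eqF.
  by rewrite ler_wpM2r// ler_wpM2l.
apply: (@le_trans _ _ (r1 `^ al * Ts `^ be * Ym * (r1 * n / tau) +
   r1 `^ al * Ts `^ be * Ym * (`|T1 - T2| * r1 / Ts))).
  have -> : r1 `^ al * T1 `^ be * r1 * (Ym * (n / tau + `|T1 - T2| / Ts)) =
    r1 `^ al * T1 `^ be * Ym * (r1 * n / tau + `|T1 - T2| * r1 / Ts) by ring.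
  rewrite -mulrDr ler_wpM2r ?addr_ge0 ?mulr_ge0 ?invr_ge0 ?(ltW tau0) ?(ltW Ts0)//.
  by rewrite ler_wpM2r// ler_wpM2l ?powR_ge0.
apply: le_trans (lerD P1 P2) _; rewrite le_eqVlt; apply/orP; left; apply/eqP; ring.
Qed.
End algebra.
End lipschitz_algebra.

Section lipschitz_sum.
Context {R : realType}.

Lemma energy_bounds (u T : R) : 0 <= u -> 0 < T ->
  [/\ T <= 1 + u + 3 * T, 1 <= 1 + u + 3 * T & 1 + u <= 1 + u + 3 * T].
Proof. by move=> u0 T0; split; lra. Qed.

(** The arithmetic of the Lipschitz estimate, separated from the integrals: [I1], [I2] and [I3]
    stand for the integrals of a Gaussian, of the difference of two Gaussians and of the profile
    with the smaller density. *)
Lemma lip_final (al be K cm cd uf ug Tf Tg r1 r2 nf ng d n I1 I2 I3 : R) :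
  0 < al -> al <= 1 -> 0 <= be -> be <= 1 ->
  0 <= cm -> 0 <= cd -> 0 <= uf -> 0 <= ug -> 0 < r1 -> r1 <= r2 -> 0 < Tf -> 0 < Tg ->
  0 <= nf -> 0 <= ng -> nf = r1 `^ al * Tf `^ be -> ng = r2 `^ al * Tg `^ be ->
  0 <= d -> 0 <= n -> `|r1 - r2| <= d ->
  r1 `^ al * Tf `^ (be - 1) * (1 + uf + 3 * Tf) ^+ 2 <= K ->
  r2 `^ al * Tg `^ (be - 1) * (1 + ug + 3 * Tg) ^+ 2 <= K ->
  (forall Y, 0 < Tg -> 1 + ug <= Y -> Tg <= Y -> I1 <= cm * Y) ->
  (forall tau Y, 0 < Tf -> Tf <= Tg -> 0 < tau -> tau ^+ 2 = Tg -> 1 + uf <= Y -> 1 + ug <= Y -> Tg <= Y ->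
    I2 <= cd * Y * (n / tau + (Tg - Tf) / Tg)) ->
  (forall tau Y, 0 < Tg -> Tg <= Tf -> 0 < tau -> tau ^+ 2 = Tf -> 1 + ug <= Y -> 1 + uf <= Y -> Tf <= Y ->
    I2 <= cd * Y * (n / tau + (Tf - Tg) / Tf)) ->
  I3 = r1 * (1 + uf + 3 * Tf) ->
  (forall s, 0 <= s -> 1 + uf + 3 * Tf <= s ^+ 2 -> 1 + ug + 3 * Tg <= s ^+ 2 ->
    r1 * `|Tf - Tg| <= 5 * d * s ^+ 2) ->
  (forall s, 0 <= s -> 1 + uf + 3 * Tf <= s ^+ 2 -> 1 + ug + 3 * Tg <= s ^+ 2 ->
    r1 * n <= 6 * d * s) ->
  `|nf * r1 - ng * r2| * I1 + nf * r1 * I2 + ng * d + `|nf - ng| * I3 <=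
  ((cm + 1) * (6 * K) + (cm + 1) * K + cd * (11 * K)) * d.
Proof.
move=> al0 al1 be0 be1 c0 c1 uf0 ug0 rf rfg Tf0 Tg0 nf0 ng0 nfE ngE d0 n0 dr kf kg gw gdf gdg mY dT dn.
have [TYf Yf1 ufY] := energy_bounds uf0 Tf0.
have [TYg Yg1 ugY] := energy_bounds ug0 Tg0.
have {}gw := gw _ Tg0 ugY TYg.
move: (1 + uf + 3 * Tf) (1 + ug + 3 * Tg) kf kg TYf TYg Yf1 Yg1 ufY ugY gw mY dT dn => Yf Yg kf kg TYf TYg Yf1 Yg1 ufY ugY gw mY dT dn.
have [Ym YmE] : exists Ym, Ym = Num.max Yf Yg by exists (Num.max Yf Yg).
have [Ts TsE] : exists Ts, Ts = Num.max Tf Tg by exists (Num.max Tf Tg).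
have YfY : Yf <= Ym by rewrite YmE le_max lexx.
have YgY : Yg <= Ym by rewrite YmE le_max lexx orbT.
have Ym0 : 0 <= Ym := le_trans (le_trans ler01 Yf1) YfY.
have Ts0 := lip_Ts0 Tf0 TsE.
have [s s0 sE] : exists2 s, 0 <= s & s ^+ 2 = Ym.
  exists (Ym `^ 2^-1); first exact: powR_ge0.
  by rewrite -powR_mulrn ?powR_ge0// -powRrM mulVf ?pnatr_eq0// powRr1.
have [tau tau0 tauE] : exists2 tau, 0 < tau & tau ^+ 2 = Ts.
  exists (Ts `^ 2^-1); first exact: powR_gt0.
  by rewrite -powR_mulrn ?powR_ge0// -powRrM mulVf ?pnatr_eq0// powRr1// ltW.
have {}dT : `|Tf - Tg| * r1 <= 5 * d * Ym.
  by rewrite mulrC -sE; apply: dT => //; rewrite sE.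
have {}dn : r1 * n <= 6 * d * s by apply: dn => //; rewrite sE.
have P1 := lip_nu_diff al0 al1 be0 be1 rf rfg Tf0 Tg0 Yf1 TYf TYg d0 kf kg TsE YmE dr dT.
have P2 := lip_nuY Tg0 Yg1 TYg kg.
have P3 := lip_gauss al0 be0 be1 rf rfg Tf0 Tg0 Yf1 TYf TYg d0 kf kg TsE YmE dT n0 tau0 tauE s0 sE dn.
rewrite -nfE -ngE in P1; rewrite -ngE in P2; rewrite -nfE in P3.
have ufm := le_trans ufY YfY; have ugm := le_trans ugY YgY.
have TsY := lip_TsY TYf TYg TsE YmE.
have {gdf gdg}gd : I2 <= cd * Ym * (n / tau + `|Tf - Tg| / Ts).
  move: tauE TsY; rewrite TsE; case/orP: (le_total Tf Tg) => h.
  - rewrite (max_idPr h) => tauE TsY; rewrite distrC [`|Tg - Tf|]ger0_norm ?subr_ge0//.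
    exact: gdf.
  - rewrite (max_idPl h) => tauE TsY; rewrite [`|Tf - Tg|]ger0_norm ?subr_ge0//.
    exact: gdg.
have r0 := ltW rf.
have Yg0 : 0 <= Yg := le_trans ler01 Yg1.
have E1 : `|nf * r1 - ng * r2| * I1 <= cm * (6 * K * d + K * d).
  apply: le_trans (ler_wpM2l (normr_ge0 _) gw) _.
  rewrite mulrCA ler_wpM2l//.
  have A1le : `|nf * r1 - ng * r2| <= `|nf - ng| * r1 + ng * d.
    have -> : nf * r1 - ng * r2 = (nf - ng) * r1 + ng * (r1 - r2) by ring.
    apply: (le_trans (ler_normD _ _)); rewrite !normrM (ger0_norm r0) (ger0_norm ng0) lerD2l ler_wpM2l//.
  apply: le_trans (ler_wpM2r Yg0 A1le) _; rewrite mulrDl; apply: lerD.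
    by apply: le_trans P1; rewrite ler_wpM2l// ?mulr_ge0//.
  by rewrite mulrAC ler_wpM2r.
have E2 : nf * r1 * I2 <= cd * (11 * K * d).
  apply: le_trans (ler_wpM2l (mulr_ge0 nf0 r0) gd) _.
  have -> : nf * r1 * (cd * Ym * (n / tau + `|Tf - Tg| / Ts)) = cd * (nf * r1 * (Ym * (n / tau + `|Tf - Tg| / Ts))) by ring.
  by rewrite ler_wpM2l.
have E3 : ng * d <= K * d.
  by rewrite ler_wpM2r//; apply: le_trans P2; rewrite ler_peMr.
have E4 : `|nf - ng| * I3 <= 6 * K * d.
  by apply: le_trans P1; rewrite mY mulrA ler_wpM2l// ?mulr_ge0//.
apply: le_trans (lerD (lerD (lerD E1 E2) E3) E4) _.
rewrite le_eqVlt; apply/orP; left; apply/eqP; ring.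
Qed.
End lipschitz_sum.

Section collision_operator.
Context {R : realType}.
Local Notation R3 := (R3 R).

Definition coll (al be : R) (g : R3 -> R) (v : R3) : R :=
  collision_freq g al be * (maxwellian g v - g v).

Section lip.
Variables (q al be : R).
Hypotheses (q5 : 5 < q) (al0 : 0 < al) (al1 : al <= 1) (be0 : 0 <= be) (be1 : be <= 1).
Hypotheses (hab : 2 <= 3 * al + 2 * be) (hq : 2 * (1 + be) <= al * (q - 3)).

Definition Klip : R := (Cgm + 1) * (6 * Kkey q) + (Cgm + 1) * Kkey q + Cgdi * (11 * Kkey q).

Lemma Klip_ge0 : 0 <= Klip.
Proof.
have K1 := @Kkey_ge1 R q.
have := @Cgm_ge0 R; have := @Cgdi_ge0 R => c1 c2.
have K0 : 0 <= Kkey q by lra.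
by rewrite /Klip; nng.
Qed.

Lemma maxwellian_ge0 (g : R3 -> R) v : (forall v, 0 <= g v) -> 0 <= maxwellian g v.
Proof.
move=> g0; have r0 : 0 <= rho g by apply: I3_ge0.
rewrite /maxwellian; case: ifP => // _; nng.
Qed.

Lemma collision_freq_ge0 (g : R3 -> R) : 0 <= collision_freq g al be.
Proof. by rewrite /collision_freq; case: ifP => // _; nng. Qed.

Section one.
Variable g : R3 -> R.
Hypothesis cg : dclass q 1 g.
Let dg := dclass_dens q5 ler01 cg.

Lemma ii_maxwellian : ii (fun v => (1 + sqnorm v) * maxwellian g v).
Proof.
have [r0|r0] := eqVneq (rho g) 0.
  have -> : (fun v => (1 + sqnorm v) * maxwellian g v) = fun=> 0.
    by apply/funext => v; rewrite /maxwellian r0 eqxx mulr0.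
  exact: integrable0.
have rp : 0 < rho g by rewrite lt_neqAle eq_sym r0 rho_ge0.
have -> : (fun v => (1 + sqnorm v) * maxwellian g v) =
  fun v => rho g * ((1 + sqnorm v) * gauss (bulk_velocity g) (temperature g) v).
  by apply/funext => v; rewrite maxwellianE// mulrCA.
apply: iiZ; apply: ii_gauss_weight; exact: dclass_temp q5 ler01 cg rp.
Qed.

(** The Maxwellian has the mass and energy of [g]; the constant comes from bounding the Gaussian by
    a bracket. *)
Lemma maxwellian_energy : \int[leb3]_v ((1 + sqnorm v) * maxwellian g v) <=
  Cgm * \int[leb3]_v ((1 + sqnorm v) * g v).
Proof.
have [mg g0 gi] := dg.
have [r0|r0] := eqVneq (rho g) 0.
  under eq_Rintegral do rewrite /maxwellian r0 eqxx mulr0.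
  rewrite Rintegral_cst// mul0r; apply: mulr_ge0; first exact: Cgm_ge0.
  by apply: I3_ge0 => v; rewrite mulr_ge0//; nng.
have rp : 0 < rho g by rewrite lt_neqAle eq_sym r0 rho_ge0.
have T0 := dclass_temp q5 ler01 cg rp.
under eq_Rintegral do rewrite maxwellianE// mulrCA.
rewrite I3Z; last exact: ii_gauss_weight.
rewrite (momY dg rp) mulrCA ler_wpM2l ?(ltW rp)//.
by apply: gauss_weight => //; have := sqnorm_ge0 (bulk_velocity g); lra.
Qed.

(** A consequence of the key bound, since [T <= Y <= Y^2]. *)
Lemma collision_freq_le : collision_freq g al be <= Kkey q.
Proof.
have K1 := @Kkey_ge1 R q.
rewrite /collision_freq; case: ifPn => r0; first lra.
have rp : 0 < rho g by rewrite lt_neqAle eq_sym r0 rho_ge0.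
have T0 := dclass_temp q5 ler01 cg rp.
apply: le_trans (key_bound q5 al0 al1 be0 be1 hab hq cg rp).
rewrite -mulrA ler_wpM2l ?powR_ge0//.
have E : temperature g `^ be = temperature g `^ (be - 1) * temperature g.
  by rewrite !powR_expE// -[X in _ = _ * X]lnK ?posrE// -expRD; congr expR; ring.
rewrite E ler_wpM2l ?powR_ge0//.
have n0 := sqnorm_ge0 (bulk_velocity g).
set Y := 1 + _ + _.
have Y1 : 1 <= Y by rewrite /Y; lra.
apply: (@le_trans _ _ Y); first by rewrite /Y; lra.
by rewrite expr2 ler_peMr//; lra.
Qed.

Lemma ii_coll : ii (fun v => (1 + sqnorm v) * coll al be g v).
Proof.
have [mg g0 gi] := dg.
have -> : (fun v => (1 + sqnorm v) * coll al be g v) =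
  fun v => collision_freq g al be * ((1 + sqnorm v) * maxwellian g v - (1 + sqnorm v) * g v).
  by apply/funext => v; rewrite /coll; ring.
by apply: iiZ; apply: iiB => //; exact: ii_maxwellian.
Qed.
End one.

Section two.
Variables f g : R3 -> R.
Hypotheses (cf : dclass q 1 f) (cg : dclass q 1 g).
Let df := dclass_dens q5 ler01 cf.
Let dg := dclass_dens q5 ler01 cg.

Definition collw (f g : R3 -> R) (v : R3) := (1 + sqnorm v) * `|coll al be f v - coll al be g v|.

Lemma ii_collw : ii (collw f g).
Proof.
have := ii_abs (iiB (ii_coll cf) (ii_coll cg)).
congr ii; apply/funext => v; rewrite -mulrBr normrM ger0_norm//; nng.
Qed.
End two.

Lemma collision_freqE (g : R3 -> R) : 0 < rho g ->
  collision_freq g al be = rho g `^ al * temperature g `^ be.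
Proof. by move=> r0; rewrite /collision_freq gt_eqF. Qed.

Lemma gauss_swap (U1 U2 : R3) (T1 T2 : R) :
  \int[leb3]_v ((1 + sqnorm v) * `|gauss U1 T1 v - gauss U2 T2 v|) =
  \int[leb3]_v ((1 + sqnorm v) * `|gauss U2 T2 v - gauss U1 T1 v|).
Proof. by apply: eq_Rintegral => v _; rewrite distrC. Qed.

Lemma n1C (a b : R3) : n1 (a - b) = n1 (b - a).
Proof.
by rewrite /n1 /=; congr (_ + _ + _); exact: distrC.
Qed.

(** With [M = rho gauss], the difference of [nu rho gauss - nu f] is telescoped so that the
    differences of velocity and temperature can be estimated with the density of [f], which will be
    the smaller one, as a factor. *)
Lemma coll_split (f g : R3 -> R) : (forall v, 0 <= f v) -> (forall v, 0 <= g v) ->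
  (rho f == 0) = false -> (rho g == 0) = false -> forall v,
  collw f g v <=
  `|collision_freq f al be * rho f - collision_freq g al be * rho g| * ((1 + sqnorm v) * gauss (bulk_velocity g) (temperature g) v)
   + collision_freq f al be * rho f * ((1 + sqnorm v) * `|gauss (bulk_velocity f) (temperature f) v - gauss (bulk_velocity g) (temperature g) v|)
   + collision_freq g al be * ((1 + sqnorm v) * `|f v - g v|)
   + `|collision_freq f al be - collision_freq g al be| * ((1 + sqnorm v) * f v).
Proof.
move=> f0 g0 rf rg v; rewrite /collw /coll !maxwellianE ?rf ?rg//.
have nf0 := collision_freq_ge0 f; have ng0 := collision_freq_ge0 g.
have r0 : 0 <= rho f by exact: I3_ge0.
have fv := f0 v.
have G0 := gauss_ge0 (bulk_velocity g) (temperature g) v.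
move: (gauss _ _ v) (gauss _ _ v) (collision_freq f al be) (collision_freq g al be) (rho f) (rho g) (f v) (g v) nf0 ng0 r0 fv G0.
move=> Gf Gg nf ng r1 r2 fv gv nf0 ng0 r0 fv0 G0.
have -> : nf * (r1 * Gf - fv) - ng * (r2 * Gg - gv) =
  (nf * r1 - ng * r2) * Gg + nf * r1 * (Gf - Gg) - ng * (fv - gv) - (nf - ng) * fv by ring.
have v0 : 0 <= 1 + sqnorm v by nng.
apply: (@le_trans _ _ ((1 + sqnorm v) * (`|nf * r1 - ng * r2| * Gg + nf * r1 * `|Gf - Gg| + ng * `|fv - gv| + `|nf - ng| * fv))); last first.
  by rewrite le_eqVlt; apply/orP; left; apply/eqP; ring.
rewrite ler_wpM2l//; apply: (le_trans (ler_normB _ _)).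
rewrite [`|(nf - ng) * _|]normrM (ger0_norm fv0) lerD2r.
apply: (le_trans (ler_normB _ _)); rewrite [`|ng * _|]normrM (ger0_norm ng0) lerD2r.
apply: (le_trans (ler_normD _ _)); rewrite !normrM (ger0_norm nf0) (ger0_norm r0) lerD2r.
by rewrite (ger0_norm G0).
Qed.

Lemma lip_assemble (h k1 k2 k3 k4 : R3 -> R) (a1 a2 a3 a4 C : R) :
  ii h -> ii k1 -> ii k2 -> ii k3 -> ii k4 ->
  (forall v, h v <= a1 * k1 v + a2 * k2 v + a3 * k3 v + a4 * k4 v) ->
  a1 * (\int[leb3]_v k1 v) + a2 * (\int[leb3]_v k2 v) + a3 * (\int[leb3]_v k3 v) + a4 * (\int[leb3]_v k4 v) <= C ->
  \int[leb3]_v h v <= C.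
Proof.
move=> hi i1 i2 i3 i4 pt; apply: le_trans.
have j1 := iiZ a1 i1; have j2 := iiZ a2 i2; have j3 := iiZ a3 i3; have j4 := iiZ a4 i4.
apply: le_trans (I3_le hi (iiD (iiD (iiD j1 j2) j3) j4) pt) _.
by rewrite (I3D (iiD (iiD j1 j2) j3) j4) (I3D (iiD j1 j2) j3) (I3D j1 j2) !I3Z.
Qed.

Lemma coll_lip_ordered (f g : R3 -> R) : dclass q 1 f -> dclass q 1 g ->
  0 < rho f -> rho f <= rho g -> \int[leb3]_v collw f g v <= Klip * wdist f g.
Proof.
move=> cf cg rf rfg; have rg : 0 < rho g := lt_le_trans rf rfg.
have df := dclass_dens q5 ler01 cf; have dg := dclass_dens q5 ler01 cg.
have [mf f0 fi] := df; have [mg g0 gi] := dg.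
have Tf0 := dclass_temp q5 ler01 cf rf; have Tg0 := dclass_temp q5 ler01 cg rg.
have kf := key_bound q5 al0 al1 be0 be1 hab hq cf rf.
have kg := key_bound q5 al0 al1 be0 be1 hab hq cg rg.
have pt := coll_split f0 g0 (gt_eqF rf) (gt_eqF rg).
have ic := ii_collw cf cg.
have iGg := ii_gauss_weight (bulk_velocity g) Tg0.
have iGd := ii_gauss_diff (bulk_velocity f) (bulk_velocity g) Tf0 Tg0.
have id := ii_wdist df dg.
have d0 := wdist_ge0 f g.
have dr := rho_diff df dg.
have dT := temp_diff df dg rf rg.
have dn := velocity_diff_n1 df dg rf rg.
have mY := momY df rf.
have gw := @gauss_weight R (bulk_velocity g) (temperature g).
have gdf := @gauss_diff R (bulk_velocity f) (bulk_velocity g) (temperature f) (temperature g).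
have gdg := @gauss_diff R (bulk_velocity g) (bulk_velocity f) (temperature g) (temperature f).
have n0 := n1_ge0 (bulk_velocity f - bulk_velocity g).
have nC : n1 (bulk_velocity g - bulk_velocity f) = n1 (bulk_velocity f - bulk_velocity g).
  exact: n1C.
have nfE := collision_freqE rf.
have ngE := collision_freqE rg.
have nf0 := collision_freq_ge0 f; have ng0 := collision_freq_ge0 g.
rewrite gauss_swap nC in gdg.
apply: (@lip_assemble (collw f g) _ _ _ _ _ _ _ _ _ ic iGg iGd id fi pt).
exact: (lip_final al0 al1 be0 be1 (@Cgm_ge0 R) (@Cgdi_ge0 R) (sqnorm_ge0 _) (sqnorm_ge0 _) rf rfg Tf0 Tg0 nf0 ng0
  nfE ngE d0 n0 dr kf kg gw gdf gdg mY dT dn).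
Qed.

Lemma lip_zero_algebra (cm cd K nu d X M : R) : 0 <= cm -> 0 <= cd -> 1 <= K -> 0 <= nu -> nu <= K ->
  0 <= X -> 0 <= M -> X <= d -> M <= cm * X ->
  nu * (M + X) <= ((cm + 1) * (6 * K) + (cm + 1) * K + cd * (11 * K)) * d.
Proof.
move=> c0 c1 K1 nu0 nuK X0 M0 Xd ME.
have d0 : 0 <= d := le_trans X0 Xd.
have K0 : 0 <= K := le_trans ler01 K1.
have H : M + X <= (cm + 1) * d.
  apply: (le_trans (lerD ME (lexx _))).
  by rewrite -[X in _ + X]mul1r -mulrDl ler_wpM2l// addr_ge0.
apply: (@le_trans _ _ (K * ((cm + 1) * d))); first by apply: ler_pM => //; rewrite addr_ge0.
have t1 : 0 <= (cm + 1) * (6 * K) * d by nng.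
have t2 : 0 <= cd * (11 * K) * d by nng.
lra.
Qed.

(** If [f] has no mass, it vanishes almost everywhere, [wdist f g] is the energy of [g], and
    boundedness of the collision frequency suffices. *)
Lemma coll_lip_zero (f g : R3 -> R) : dclass q 1 f -> dclass q 1 g -> rho f = 0 ->
  \int[leb3]_v collw f g v <= Klip * wdist f g.
Proof.
move=> cf cg r0.
have df := dclass_dens q5 ler01 cf; have dg := dclass_dens q5 ler01 cg.
have [mf f0 fi] := df; have [mg g0 gi] := dg.
have K1 : 1 <= Kkey q := @Kkey_ge1 R q.
have f_ae : ae_eq leb3 setT (EFin \o f) (cst 0%E).
  have : (\int[leb3]_v `|(f v)%:E| = 0)%E.
    under eq_integral do rewrite /= ger0_norm//.
    by rewrite -EFin_I3 ?[X in X%:E]r0//; exact: dens_ii0.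
  move/ae_eq_integral_abs => /(_ measurableT) H.
  by apply: H; exact/measurable_EFinP.
have wf0 : \int[leb3]_v ((1 + sqnorm v) * f v) = 0.
  rewrite /Rintegral (@ae_eq_integral _ _ _ leb3 setT (cst 0%E))//.
  - by rewrite integral0.
  - by apply/measurable_EFinP; apply: ii_measurable fi.
  - move: f_ae; apply: filterS => v fv _ /=; by move: (fv I) => [] ->; rewrite mulr0.
have gd : \int[leb3]_v ((1 + sqnorm v) * g v) <= wdist f g.
  have : \int[leb3]_v ((1 + sqnorm v) * g v) <= \int[leb3]_v ((1 + sqnorm v) * `|f v - g v| + (1 + sqnorm v) * f v).
    apply: I3_le => //; first by apply: iiD => //; exact: ii_wdist.
    move=> v; have v0 : 0 <= 1 + sqnorm v by nng.
    rewrite -mulrDr ler_wpM2l//; have := ler_norm (g v - f v); rewrite distrC; lra.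
  by rewrite I3D ?wf0 ?addr0//; exact: ii_wdist.
have n0 : collision_freq f al be = 0 by rewrite /collision_freq r0 eqxx.
have ng0 := collision_freq_ge0 g.
have c0 := @Cgm_ge0 R; have c1 := @Cgdi_ge0 R.
have im := ii_maxwellian cg.
have pt v : collw f g v <= collision_freq g al be * ((1 + sqnorm v) * maxwellian g v + (1 + sqnorm v) * g v).
  have v0 : 0 <= 1 + sqnorm v by nng.
  rewrite /collw /coll n0 mul0r sub0r normrN normrM (ger0_norm ng0) mulrCA ler_wpM2l//.
  rewrite -mulrDr ler_wpM2l//; apply: (le_trans (ler_normB _ _)).
  by rewrite !ger0_norm ?maxwellian_ge0.
apply: le_trans (I3_le (ii_collw cf cg) (iiZ _ (iiD im gi)) pt) _.
rewrite I3Z ?I3D//; last exact: iiD.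
have mE := maxwellian_energy cg.
have W0 : 0 <= \int[leb3]_v ((1 + sqnorm v) * g v) by apply: I3_ge0 => v; rewrite mulr_ge0//; nng.
have M0 : 0 <= \int[leb3]_v ((1 + sqnorm v) * maxwellian g v).
  by apply: I3_ge0 => v; rewrite mulr_ge0 ?maxwellian_ge0//; nng.
exact: (lip_zero_algebra c0 c1 K1 ng0 (collision_freq_le cg) W0 M0 gd mE).
Qed.

Lemma collwC (f g : R3 -> R) : collw f g = collw g f.
Proof. by apply/funext => v; rewrite /collw distrC. Qed.

Lemma wdistC (f g : R3 -> R) : wdist f g = wdist g f.
Proof. by apply: eq_Rintegral => v _; rewrite distrC. Qed.

(** The estimate is symmetric in the two profiles, so that the smaller density may be put first. *)
Lemma coll_lip (f g : R3 -> R) : dclass q 1 f -> dclass q 1 g ->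
  \int[leb3]_v collw f g v <= Klip * wdist f g.
Proof.
wlog h : f g / rho f <= rho g.
  move=> H cf cg; case/orP: (le_total (rho f) (rho g)) => h; first exact: H.
  by rewrite collwC wdistC; exact: H.
move=> cf cg; have [r0|r0] := eqVneq (rho f) 0; first exact: coll_lip_zero.
apply: coll_lip_ordered => //.
by rewrite lt_neqAle eq_sym r0 (rho_ge0 (dclass_dens q5 ler01 cf)).
Qed.
End lip.
End collision_operator.

(** * Decay in time *)

Section time_decay.
Context {R : realType}.
Local Notation R3 := (R3 R).

(** Completing the square in [v]. *)
Lemma weight_WE (t : R) (x v : R3) :
  1 + sqnorm (x - t *: v) + sqnorm v =
  (1 + sqnorm x / (1 + t ^+ 2)) + (1 + t ^+ 2) * sqnorm (v - (t / (1 + t ^+ 2)) *: x).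
Proof.
have s0 : 1 + t ^+ 2 != 0 by rewrite gt_eqF// ltr_wpDr// sqr_ge0.
rewrite /sqnorm /= /GRing.scale /=; field.
exact: s0.
Qed.

(** Independent of the exponents of the collision frequency, since the constant of its decay is
    chosen before them. *)
Definition Cnu (q r : R) : R := (1 + japint r) * (1 + CY q).

(** A bound that is uniform in the exponent, for constants that do not depend on it. *)
Lemma powR_le_sq (c e : R) : 0 <= c -> 0 <= e -> e <= 2 -> c `^ e <= (1 + c) ^+ 2.
Proof.
move=> c0 e0 e2; rewrite -powR_mulrn; last lra.
apply: (@le_trans _ _ ((1 + c) `^ e)).
  by apply: ge0_ler_powR; rewrite ?nnegrE//; lra.
by apply: ler_powR; lra.
Qed.

(** With [k = 2 b / (q - 3)] one has [ro^a Y^b = ro^(a - k) (ro Y^((q - 3) / 2))^k]: the density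
    decays, the high moment is bounded. *)
Lemma decay_pow_alg (q J C eps sg ro Y a b : R) : 5 < q -> 0 <= J -> 0 <= C -> 0 < eps ->
  0 < sg -> 0 < ro -> 0 < Y -> ro * Y `^ ((q - 3) / 2) <= C * eps ->
  ro <= J * eps * sg `^ (- (3 / 2)) ->
  0 <= a -> a <= 2 -> 0 <= b -> 2 * b / (q - 3) <= a ->
  ro `^ a * Y `^ b <= ((1 + J) * (1 + C)) ^+ 2 * eps `^ a * sg `^ (- (3 / 2) * (a - 2 * b / (q - 3))).
Proof.
move=> q5 J0 C0 eps0 s0 rp Y0 HY Hr a0 a2 b0 ba.
have e0 := ltW eps0.
have q3 : 0 < q - 3 by lra.
have kb0 : 0 <= 2 * b / (q - 3) by nng.
have kbE : (q - 3) / 2 * (2 * b / (q - 3)) = b by field; rewrite gt_eqF.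
move: (2 * b / (q - 3)) kb0 kbE ba => kb kb0 kbE ba.
have akb : 0 <= a - kb by rewrite subr_ge0.
have akb2 : a - kb <= 2 by rewrite lerBlDr ler_wpDr.
have kb2 : kb <= 2 by exact: le_trans a2.
have E : ro `^ a * Y `^ b = ro `^ (a - kb) * (ro * Y `^ ((q - 3) / 2)) `^ kb.
  rewrite (powRM _ (ltW rp) (powR_ge0 _ _)) -powRrM kbE mulrA; congr (_ * _).
  by rewrite !powR_expE// -expRD; congr expR; ring.
rewrite E.
apply: (@le_trans _ _ ((J * eps * sg `^ (- (3 / 2))) `^ (a - kb) * (C * eps) `^ kb)).
  apply: ler_pM; [exact: powR_ge0|exact: powR_ge0| |].
    by apply: ge0_ler_powR; rewrite ?nnegrE ?(ltW rp) ?(mulr_ge0 (mulr_ge0 J0 e0) (powR_ge0 _ _)).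
  by apply: ge0_ler_powR; rewrite ?nnegrE ?(mulr_ge0 C0 e0) ?(mulr_ge0 (ltW rp) (powR_ge0 _ _)).
rewrite (powRM _ (mulr_ge0 J0 e0) (powR_ge0 _ _)) (powRM _ J0 e0) (powRM _ C0 e0).
have -> : eps `^ a = eps `^ (a - kb) * eps `^ kb.
  by rewrite !powR_expE// -expRD; congr expR; ring.
rewrite -powRrM.
have B1 := powR_le_sq J0 akb akb2.
have B2 := powR_le_sq C0 kb0 kb2.
have P0 : 0 <= eps `^ (a - kb) * eps `^ kb * sg `^ (- (3 / 2) * (a - kb)) by nng.
have HH := ler_wpM2r P0 (ler_pM (powR_ge0 _ _) (powR_ge0 _ _) B1 B2).
apply: le_trans (le_trans HH _); rewrite le_eqVlt; apply/orP; left; apply/eqP; ring.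
Qed.

Lemma temp_le_Y (u T : R) : 0 <= u -> 0 <= T -> T <= 1 + u + 3 * T.
Proof. by move=> u0 T0; lra. Qed.

Lemma Y_gt0 (u T : R) : 0 <= u -> 0 <= T -> 0 < 1 + u + 3 * T.
Proof. by move=> u0 T0; lra. Qed.

Lemma decay_final_alg (C M X e : R) : 0 <= C -> X <= M * e -> C * (e + X) <= C * (1 + M) * e.
Proof. by move=> C0 H; rewrite -mulrA ler_wpM2l//; lra. Qed.

Section decay.
Variables (q r eps t : R) (x : R3) (h : R3 -> R).
Hypotheses (q5 : 5 < q) (r3 : 3 < r) (eps0 : 0 < eps) (t0 : 0 <= t).
Hypotheses (ch : dclass q eps h) (hW : forall v, weight_W r t x v * h v <= eps).
Let sg := 1 + t ^+ 2.
Let c := (t / sg) *: x.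
Let A := 1 + sqnorm x / sg.

Lemma sg_gt0 : 0 < 1 + t ^+ 2. Proof. by rewrite ltr_wpDr// sqr_ge0. Qed.
Let A1 : 1 <= A.
Proof. by rewrite /A lerDl; have := sg_gt0; rewrite -/sg => ?; nng. Qed.

Lemma decay_quad (v : R3) : (A + sg * sqnorm (v - c)) `^ (r / 2) * h v <= eps.
Proof. by have := hW v; rewrite /weight_W weight_WE. Qed.

Let h0 v : 0 <= h v. Proof. by case: ch. Qed.

Lemma decay_mono (X : R) (v : R3) : 0 <= X -> X <= A + sg * sqnorm (v - c) ->
  X `^ (r / 2) * h v <= eps.
Proof.
move=> X0 XA; apply: le_trans (decay_quad v); rewrite ler_wpM2r//.
have r2 : 0 <= r / 2 by rewrite divr_ge0//; move: r3; lra.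
by apply: ge0_ler_powR; rewrite ?nnegrE// (le_trans X0).
Qed.

Let dh := dclass_dens q5 (ltW eps0) ch.

Lemma decay_rho : 0 < rho h -> rho h <= japint r * eps * sg `^ (- (3 / 2)).
Proof.
move=> rp; have s0 := sg_gt0.
apply: (@rho_decay R h dh sg r eps c) => //; first exact: ltW.
move=> v; apply: decay_mono; first by rewrite /sg; nng.
by rewrite lerD2r.
Qed.

Hypothesis rp : 0 < rho h.
Let Y := 1 + sqnorm (bulk_velocity h) + 3 * temperature h.

Lemma decay_pow (a b : R) : 0 <= a -> a <= 2 -> 0 <= b -> 2 * b / (q - 3) <= a ->
  rho h `^ a * Y `^ b <= Cnu q r ^+ 2 * eps `^ a * sg `^ (- (3 / 2) * (a - 2 * b / (q - 3))).
Proof.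
move=> a0 a2 b0 ba.
have T0 := dclass_temp q5 (ltW eps0) ch rp.
have Y0 : 0 < Y.
  by apply: Y_gt0; [exact: sqnorm_ge0|exact: ltW].
exact: (decay_pow_alg q5 (@japint_ge0 R r) (@CY_ge0 R q) eps0 sg_gt0 rp Y0 (dclass_Y q5 (ltW eps0) ch rp) (decay_rho rp) a0 a2 b0 ba).
Qed.

(** The decay of the collision frequency, from [T <= Y]. *)
Lemma decay_nu (al be : R) : 0 <= al -> al <= 1 -> 0 <= be -> 2 * be / (q - 3) <= al ->
  collision_freq h al be <= Cnu q r ^+ 2 * eps `^ al * sg `^ (- (3 * al / 2) + 3 * be / (q - 3)).
Proof.
move=> al0 al1 be0 ba; rewrite collision_freqE//.
have q3 : 0 < q - 3 by move: q5; lra.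
have T0 := dclass_temp q5 (ltW eps0) ch rp.
have al2 : al <= 2 by apply: (le_trans al1); rewrite ler1n.
apply: le_trans (_ : _ <= rho h `^ al * Y `^ be) _.
  rewrite ler_wpM2l ?powR_ge0//; apply: ge0_ler_powR; rewrite ?nnegrE//; first exact: ltW.
    by apply/ltW/Y_gt0; [exact: sqnorm_ge0|exact: ltW].
  by rewrite /Y; apply: temp_le_Y; [exact: sqnorm_ge0|exact: ltW].
apply: (le_trans (decay_pow al0 al2 be0 ba)).
by rewrite le_eqVlt; apply/orP; left; apply/eqP; congr (_ * _ `^ _); field; rewrite gt_eqF.
Qed.

Lemma decay_maxw_w (v : R3) :
  weight_w q v * maxwellian h v <= Cmax q * (1 + Cmom q) * eps.
Proof.
have e0 := ltW eps0; have T0 := dclass_temp q5 e0 ch rp.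
have q0 : 0 < q by move: q5; lra.
have Hm := @maxwellian_weight R h dh rp T0 1 1 q eps (0 : R3) ler01 ltr01 q0 e0 (dclass_bracket ch) v.
rewrite mul1r sqnormB0 powR1 mulr1 in Hm; apply: (le_trans Hm).
have k0 : 0 <= (q - 3) / 2 by rewrite divr_ge0// subr_ge0; move: q5; lra.
have H2 : rho h * temperature h `^ ((q - 3) / 2) <= Cmom q * eps.
  apply: le_trans (dclass_moment q5 e0 ch rp); rewrite ler_wpM2l ?(ltW rp)//.
  apply: ge0_ler_powR; rewrite ?nnegrE ?(ltW T0)//.
    by rewrite addr_ge0 ?sqnorm_ge0// mulr_ge0// ltW.
  by rewrite ler_wpDr ?sqnorm_ge0// ler_peMl ?(ltW T0)// ler1n.
exact: decay_final_alg (@Cmax_ge0 R q) H2.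
Qed.

Lemma decay_maxw_W (v : R3) :
  weight_W r t x v * maxwellian h v <= Cmax r * (eps + rho h * temperature h `^ ((r - 3) / 2) * sg `^ (r / 2)).
Proof.
have e0 := ltW eps0; have T0 := dclass_temp q5 e0 ch rp.
have r0 : 0 < r by move: r3; lra.
have A0 : 0 <= A := le_trans ler01 A1.
have := @maxwellian_weight R h dh rp T0 A sg r eps c A0 sg_gt0 r0 e0 decay_quad v.
by rewrite /weight_W weight_WE.
Qed.

(** For [r > 5] the weight [W_r] controls the temperature by itself, at the scale [sg]. *)
Lemma decay_maxw_W5 (v : R3) : 5 < r ->
  weight_W r t x v * maxwellian h v <= Cmax r * (1 + Cmom r) * eps.
Proof.
move=> r5; apply: (le_trans (decay_maxw_W v)).
have e0 := ltW eps0; have T0 := dclass_temp q5 e0 ch rp; have s0 : 0 < sg := sg_gt0.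
apply: decay_final_alg (@Cmax_ge0 R r) _.
have := @moment_bound R h dh rp sg r eps c s0 r5 e0 _.
rewrite powRN ler_pdivlMr ?powR_gt0// => H; apply: le_trans (H _).
  rewrite ler_wpM2r ?powR_ge0// ler_wpM2l ?(ltW rp)//.
  have k0 : 0 <= (r - 3) / 2 by rewrite divr_ge0// subr_ge0 ltW.
  apply: ge0_ler_powR; rewrite ?nnegrE ?(ltW T0)//.
    by rewrite addr_ge0 ?sqnorm_ge0// mulr_ge0// ltW.
  by rewrite ler_wpDr ?sqnorm_ge0// ler_peMl ?(ltW T0)// ler1n.
move=> v'; apply: decay_mono; first by rewrite mulr_ge0 ?sqnorm_ge0// ltW.
by rewrite lerDr; apply: le_trans A1.
Qed.
End decay.

Lemma common_bound (a b c d : R) : 0 <= a -> 0 <= b -> 0 <= c -> 0 <= d ->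
  exists D : R, [/\ 1 <= D, a * (1 + b) <= D, c * (1 + d) <= D & c * 2 <= D].
Proof.
move=> a0 b0 c0 d0; exists (1 + a * (1 + b) + c * (1 + d) + c * 2).
by have := mulr_ge0 a0 b0; have := mulr_ge0 c0 d0; split; lra.
Qed.

Lemma exponent_gap (p X a r : R) : 1 < p -> 3 < r -> p = 3 * (a - X) - r -> X <= a.
Proof. by move=> *; lra. Qed.

Lemma le_decay (s a b K : R) : 1 <= s -> 0 <= K -> a <= b -> K * s `^ a <= K * s `^ b.
Proof. by move=> s1 K0 ab; rewrite ler_wpM2l// ler_powR. Qed.

Section rates.
Variables (q r al be : R).
Hypotheses (al3 : 3^-1 < al) (al1 : al <= 1) (be0 : 0 <= be) (be1 : be <= 1).
Hypotheses (hq1 : 3 + 2 * (1 + be) / al < q) (hq2 : 3 + 6 * be / (3 * al - 1) < q).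
Hypothesis hr : (3 < r /\ r < 3 * al + 2 - 3 * (3 * al + 2 * be - 1) / q) \/ 5 < r.

Lemma rate_al0 : 0 < al. Proof. by move: al3; lra. Qed.
Lemma rate_hq : 2 * (1 + be) <= al * (q - 3).
Proof.
have a0 := rate_al0; rewrite [al * _]mulrC -ler_pdivrMr//; move: hq1; lra.
Qed.
Lemma rate_q5 : 5 < q.
Proof.
have a0 := rate_al0; have : 2 <= 2 * (1 + be) / al.
  by rewrite ler_pdivlMr//; move: be0 al1; lra.
by move: hq1; lra.
Qed.
Lemma rate_r3 : 3 < r. Proof. by case: hr => [[]//|]; lra. Qed.
Lemma rate_kbe : 2 * be / (q - 3) <= al.
Proof.
have q5 := rate_q5; rewrite ler_pdivrMr; last lra.
by have := rate_hq; lra.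
Qed.

(** The second lower bound on [q] makes the collision frequency integrable in time. *)
Lemma rate_p1 : 1 < 3 * al - 6 * be / (q - 3).
Proof.
have q5 := rate_q5; have q3 : 0 < q - 3 by lra.
have a3 : 0 < 3 * al - 1 by move: al3; lra.
have H : 6 * be < (3 * al - 1) * (q - 3) by rewrite [_ * (q - 3)]mulrC -ltr_pdivrMr//; move: hq2; lra.
have : 6 * be / (q - 3) < 3 * al - 1 by rewrite ltr_pdivrMr.
lra.
Qed.

(** The upper bound on [r], multiplied by [q] and solved for the decay rate of
    [nu rho T^((r - 3) / 2) sg^(r / 2)]. *)
Lemma rate_p2 : r <= 5 -> 1 < 3 * (1 + al) - r - 3 * (2 * be + r - 3) / (q - 3).
Proof.
move=> r5; case: hr => [[r3 hr1]|]; last lra.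
have q5 := rate_q5; have q3 : 0 < q - 3 by lra.
have q0 : 0 < q by lra.
have H : r * q < (3 * al + 2) * q - 3 * (3 * al + 2 * be - 1).
  have -> : (3 * al + 2) * q - 3 * (3 * al + 2 * be - 1) = (3 * al + 2 - 3 * (3 * al + 2 * be - 1) / q) * q.
    by field; rewrite gt_eqF.
  by rewrite ltr_pM2r.
have : 3 * (2 * be + r - 3) / (q - 3) < 3 * (1 + al) - r - 1 by rewrite ltr_pdivrMr//; lra.
lra.
Qed.

(** One integrable rate for the collision frequency and for both weighted norms of the gain term.
    The factor [eps^al] makes it small. *)
Lemma decay_rates : exists p C0 : R, [/\ 1 < p, 0 <= C0 &
  forall (eps t : R) (x : R3) (h : R3 -> R), 0 < eps -> 0 <= t ->
    dclass q eps h -> (forall v, weight_W r t x v * h v <= eps) ->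
    [/\ collision_freq h al be <= C0 * eps `^ al * (1 + t) `^ (- p),
      forall v, weight_w q v * (collision_freq h al be * maxwellian h v) <=
        C0 * eps `^ al * (1 + t) `^ (- p) * eps &
      forall v, weight_W r t x v * (collision_freq h al be * maxwellian h v) <=
        C0 * eps `^ al * (1 + t) `^ (- p) * eps]].
Proof.
have a0 := rate_al0; have q5 := rate_q5; have r3 := rate_r3; have kbe := rate_kbe; have p1 := rate_p1.
have q3 : 0 < q - 3 by lra.
pose p1v := 3 * al - 6 * be / (q - 3).
(* For [r > 5] the temperature is controlled by the weight, and the decay of the collision frequency
   is the only constraint. *)
pose p2v := if r <= 5 then 3 * (1 + al) - r - 3 * (2 * be + r - 3) / (q - 3) else p1v.
have p2 : 1 < p2v by rewrite /p2v; case: ifP => // r5; exact: rate_p2.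
pose p := Num.min p1v p2v.
have p_gt1 : 1 < p by rewrite /p lt_min p1 p2.
have pp1 : p <= p1v by rewrite /p ge_min lexx.
have pp2 : p <= p2v by rewrite /p ge_min lexx orbT.
pose B := Cnu q r ^+ 2.
have B0 : 0 <= B by rewrite /B sqr_ge0.
have cmq := @Cmax_ge0 R q; have cmr := @Cmax_ge0 R r; have coq := @Cmom_ge0 R q; have cor := @Cmom_ge0 R r.
have [D [D1 Dq Dr D2]] := common_bound cmq coq cmr cor.
pose C0 := 2 `^ (p / 2) * (B * D).
have C00 : 0 <= C0 := mulr_ge0 (powR_ge0 _ _) (mulr_ge0 B0 (le_trans ler01 D1)).
have ppN (p' : R) : p <= p' -> - (p' / 2) <= - (p / 2) by move=> pp; rewrite lerN2 ler_wpM2r.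
exists p, C0; split => // eps t x h eps0 t0 ch hW.
have sg1 : 1 <= 1 + t ^+ 2 by rewrite lerDl sqr_ge0.
(* Passes from powers of [1 + t^2] to powers of [1 + t], at the price of the factor [2^(p/2)] in
   [C0]. *)
have cvt (z : R) : 0 <= z -> z <= D -> B * z * (1 + t ^+ 2) `^ (- (p / 2)) * eps `^ al <= C0 * eps `^ al * (1 + t) `^ (- p).
  move=> z0 zD; have p0 : 0 <= p := le_trans ler01 (ltW p_gt1).
  have H := bracket1_powR p0 t0.
  have e0 : 0 <= eps `^ al by exact: powR_ge0.
  have Bz : 0 <= B * z by rewrite mulr_ge0.
  have H2 : B * z <= B * D by rewrite ler_wpM2l.
  have H3 := ler_pM Bz (powR_ge0 _ _) H2 H.
  have := ler_wpM2r e0 H3; move=> HH; apply: le_trans (le_trans HH _); rewrite le_eqVlt; apply/orP; left; apply/eqP; rewrite ?/C0; ring.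
have e0 := ltW eps0.
have ea0 : 0 <= eps `^ al by exact: powR_ge0.
have [rz|rnz] := eqVneq (rho h) 0.
  have nu0 : collision_freq h al be = 0 by rewrite /collision_freq rz eqxx.
  rewrite nu0; split => [|v|v]; rewrite ?mul0r ?mulr0.
  - by rewrite (mulr_ge0 (mulr_ge0 C00 ea0) (powR_ge0 _ _)).
  - by rewrite (mulr_ge0 (mulr_ge0 (mulr_ge0 C00 ea0) (powR_ge0 _ _)) e0).
  - by rewrite (mulr_ge0 (mulr_ge0 (mulr_ge0 C00 ea0) (powR_ge0 _ _)) e0).
have rp : 0 < rho h by rewrite lt_neqAle eq_sym rnz (rho_ge0 (dclass_dens q5 e0 ch)).
have n0 := collision_freq_ge0 al be h.
have hnu : collision_freq h al be <= B * (1 + t ^+ 2) `^ (- (p / 2)) * eps `^ al.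
  have Hnu := decay_nu q5 r3 eps0 ch hW rp (ltW a0) al1 be0 kbe.
  apply: le_trans Hnu _.
  rewrite -/B mulrAC ler_wpM2r//; apply: le_decay => //.
  have -> : - (3 * al / 2) + 3 * be / (q - 3) = - (p1v / 2) by rewrite /p1v; field; rewrite gt_eqF.
  exact: ppN.
split => [|v|v].
- have := cvt 1 ler01 D1; rewrite mulr1; exact: le_trans.
- have Hw := decay_maxw_w q5 eps0 ch rp v.
  rewrite mulrCA; apply: le_trans (ler_pM n0 _ hnu Hw) _.
    by rewrite mulr_ge0 ?powR_ge0// maxwellian_ge0//; case: ch.
  have := cvt (Cmax q * (1 + Cmom q)) _ _ => H.
  rewrite mulrA ler_wpM2r//; apply: le_trans (H _ _).
  + by rewrite le_eqVlt; apply/orP; left; apply/eqP; ring.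
  + exact: mulr_ge0 cmq (addr_ge0 ler01 coq).
  + exact: Dq.
- have M0 : 0 <= weight_W r t x v * maxwellian h v.
    by rewrite mulr_ge0 ?powR_ge0// maxwellian_ge0//; case: ch.
  rewrite mulrCA; have [r5|r5] := leP r 5; last first.
    have Hw := decay_maxw_W5 q5 r3 eps0 ch hW rp v r5.
    apply: le_trans (ler_pM n0 M0 hnu Hw) _.
    have H := cvt (Cmax r * (1 + Cmom r)) _ _.
    rewrite mulrA ler_wpM2r//; apply: le_trans (H _ _).
    + by rewrite le_eqVlt; apply/orP; left; apply/eqP; ring.
    + exact: mulr_ge0 cmr (addr_ge0 ler01 cor).
    + exact: Dr.
  have Hw := decay_maxw_W q5 r3 eps0 ch hW rp v.
  apply: (le_trans (ler_wpM2l n0 Hw)).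
  have T0 := dclass_temp q5 e0 ch rp.
  have u0 := sqnorm_ge0 (bulk_velocity h).
  set Y := 1 + sqnorm (bulk_velocity h) + 3 * temperature h.
  have TY : temperature h <= Y := temp_le_Y u0 (ltW T0).
  have Y0 : 0 < Y := Y_gt0 u0 (ltW T0).
  have b0 : 0 <= be + (r - 3) / 2 by rewrite addr_ge0// divr_ge0// subr_ge0 ltW.
  have p2E : p2v = 3 * (1 + al) - r - 3 * (2 * be + r - 3) / (q - 3) by rewrite /p2v r5.
  have kb : 2 * (be + (r - 3) / 2) / (q - 3) <= 1 + al.
    have -> : 2 * (be + (r - 3) / 2) / (q - 3) = (2 * be + r - 3) / (q - 3) by field; rewrite gt_eqF.
    have : p2v = 3 * (1 + al - (2 * be + r - 3) / (q - 3)) - r by rewrite p2E; ring.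
    exact: exponent_gap p2 r3.
  have a2 : 1 + al <= 2 by rewrite -[2]/(1 + 1) lerD2l.
  have a10 : 0 <= 1 + al by rewrite addr_ge0// ltW.
  have Hp := decay_pow q5 r3 eps0 ch hW rp a10 a2 b0 kb.
  (* Here the decay of [rho^(1 + al)] has to compensate the growth of the weight. *)
  have N2 : collision_freq h al be * (rho h * temperature h `^ ((r - 3) / 2) * (1 + t ^+ 2) `^ (r / 2)) <=
    B * (1 + t ^+ 2) `^ (- (p / 2)) * eps `^ al * eps.
    rewrite collision_freqE//.
    have E : rho h `^ al * temperature h `^ be * (rho h * temperature h `^ ((r - 3) / 2) * (1 + t ^+ 2) `^ (r / 2)) =
      rho h `^ (1 + al) * temperature h `^ (be + (r - 3) / 2) * (1 + t ^+ 2) `^ (r / 2).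
      have -> : rho h `^ (1 + al) = rho h `^ al * rho h.
        by rewrite (powR_pred (1 + al) rp); congr (_ `^ _ * _); ring.
      have -> : temperature h `^ (be + (r - 3) / 2) = temperature h `^ be * temperature h `^ ((r - 3) / 2).
        by rewrite !powR_expE// -expRD; congr expR; ring.
      ring.
    rewrite E.
    apply: (@le_trans _ _ (rho h `^ (1 + al) * Y `^ (be + (r - 3) / 2) * (1 + t ^+ 2) `^ (r / 2))).
      rewrite ler_wpM2r ?powR_ge0// ler_wpM2l ?powR_ge0//.
      by apply: ge0_ler_powR; rewrite ?nnegrE// ?(ltW T0) ?(ltW Y0).
    apply: (le_trans (ler_wpM2r (powR_ge0 _ _) Hp)); rewrite -/B.
    have -> : eps `^ (1 + al) = eps `^ al * eps.
      by rewrite (powR_pred (1 + al) eps0); congr (_ `^ _ * _); ring.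
    have s0 : 0 < 1 + t ^+ 2 := lt_le_trans ltr01 sg1.
    have Es : (1 + t ^+ 2) `^ (- (3 / 2) * (1 + al - 2 * (be + (r - 3) / 2) / (q - 3))) * (1 + t ^+ 2) `^ (r / 2) = (1 + t ^+ 2) `^ (- (p2v / 2)).
      rewrite !powR_expE// -expRD; congr expR; rewrite p2E; field; rewrite gt_eqF//.
    rewrite -[X in X <= _]mulrA Es.
    have := @le_decay (1 + t ^+ 2) (- (p2v / 2)) (- (p / 2)) (B * (eps `^ al * eps)) sg1 _ _.
    move=> H; apply: le_trans (H _ _) _; [by rewrite mulr_ge0// mulr_ge0|exact: ppN|].
    by rewrite le_eqVlt; apply/orP; left; apply/eqP; ring.
  have H := cvt (Cmax r * 2) _ _.
  apply: (@le_trans _ _ (Cmax r * (B * (1 + t ^+ 2) `^ (- (p / 2)) * eps `^ al * eps + B * (1 + t ^+ 2) `^ (- (p / 2)) * eps `^ al * eps))).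
    rewrite mulrCA ler_wpM2l// mulrDr; apply: lerD => //.
    by rewrite ler_wpM2r.
  apply: (@le_trans _ _ (B * (Cmax r * 2) * (1 + t ^+ 2) `^ (- (p / 2)) * eps `^ al * eps)).
    by rewrite le_eqVlt; apply/orP; left; apply/eqP; ring.
  rewrite ler_wpM2r//; apply: H; first by rewrite mulr_ge0.
  exact: D2.
Qed.
End rates.
End time_decay.

(** * Measurability and Tonelli on phase space *)

Section phase_space.
Context {R : realType}.
Local Notation leb := (@lebesgue_measure R).
Local Notation R3 := (R3 R).

Lemma measurable_funV d (T : measurableType d) (f : T -> R) :
  measurable_fun [set: T] f -> measurable_fun [set: T] (fun x => (f x)^-1).
Proof.
move=> mf; have -> : (fun x => (f x)^-1) = fun x => f x * (f x ^+ 2) `^ (-1).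
  apply/funext => x; rewrite powR_inv1 ?sqr_ge0//.
  have [->|h] := eqVneq (f x) 0; first by rewrite invr0 mul0r.
  by rewrite expr2 invfM mulrA mulfV// mul1r.
by apply: measurable_funM => //; apply: measurable_powRl; exact: measurable_funX.
Qed.

Lemma measurable_Rint d1 d2 (T1 : measurableType d1) (T2 : measurableType d2)
    (m2 : {sigma_finite_measure set T2 -> \bar R}) (G : T1 -> T2 -> R) :
  measurable_fun [set: T1 * T2] (fun z => G z.1 z.2) ->
  measurable_fun [set: T1] (fun w => \int[m2]_v G w v).
Proof.
move=> mG; have mE : measurable_fun [set: T1 * T2] (fun z => (G z.1 z.2)%:E) by apply/measurable_EFinP.
apply: (measurableT_comp (fine_measurable measurableT)).
under eq_fun do rewrite integralE.
apply: emeasurable_funB.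
- apply: (@measurable_integral2 _ _ _ _ _ m2 (fun w v => ((fun v => (G w v)%:E)^\+ v)%E)); last first.
    by move=> x y; exact: funepos_ge0.
  by have := measurable_funepos mE; congr measurable_fun; apply/funext => z; rewrite !funeposE.
- apply: (@measurable_integral2 _ _ _ _ _ m2 (fun w v => ((fun v => (G w v)%:E)^\- v)%E)); last first.
    by move=> x y; exact: funeneg_ge0.
  by have := measurable_funeneg mE; congr measurable_fun; apply/funext => z; rewrite !funenegE.
Qed.

Section fields.
Context d (T : measurableType d) (F : T -> R3 -> R).
Hypothesis mF : measurable_fun [set: T * R3] (fun z => F z.1 z.2).

Lemma measurable_rho : measurable_fun [set: T] (fun w => rho (F w)).
Proof. by apply: measurable_Rint. Qed.

Lemma measurable_moment (k : R3 -> R) : measurable_fun [set: R3] k ->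
  measurable_fun [set: T] (fun w => \int[leb3]_v (k v * F w v)).
Proof.
move=> mk; apply: (@measurable_Rint _ _ _ _ leb3 (fun w v => k v * F w v)).
by apply: measurable_funM => //; exact: (measurableT_comp mk).
Qed.

Lemma measurable_bulk : measurable_fun [set: T] (fun w => bulk_velocity (F w)).
Proof.
rewrite /bulk_velocity.
apply: (measurable_R3Z (a := fun w => (rho (F w))^-1)); last first.
  by apply: measurable_funV; exact: measurable_rho.
apply: measurable_R3; apply: measurable_moment.
- exact: measurable_R3_1.
- exact: measurable_R3_2.
- exact: measurable_R3_3.
Qed.

Lemma measurable_temp : measurable_fun [set: T] (fun w => temperature (F w)).
Proof.
apply: measurable_funM => //; apply: measurable_funB.
- apply: measurable_funM; first by apply: measurable_funV; exact: measurable_rho.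
  by apply: measurable_moment; exact: measurable_sqnorm.
- by apply: measurable_sqnorm; exact: measurable_bulk.
Qed.

Lemma measurable_nu (al be : R) : al != 0 ->
  measurable_fun [set: T] (fun w => collision_freq (F w) al be).
Proof.
move=> al0; have -> : (fun w => collision_freq (F w) al be) =
    fun w => rho (F w) `^ al * temperature (F w) `^ be.
  apply/funext => w; rewrite /collision_freq; case: eqP => // ->.
  by rewrite powR0// mul0r.
by apply: measurable_funM; apply: measurable_powRl; [exact: measurable_rho|exact: measurable_temp].
Qed.

Lemma measurable_maxw : measurable_fun [set: T * R3] (fun z => maxwellian (F z.1) z.2).
Proof.
have -> : (fun z : T * R3 => maxwellian (F z.1) z.2) = fun z =>
  rho (F z.1) * (2 * pi * temperature (F z.1)) `^ (- (3 / 2)) *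
  expR (- (sqnorm (z.2 - bulk_velocity (F z.1)) * (2 * temperature (F z.1))^-1)).
  apply/funext => z; rewrite /maxwellian; case: eqP => [->|_]; first by rewrite !mul0r.
  by rewrite powRN.
have mr := measurableT_comp measurable_rho (@measurable_fst _ _ T R3).
have mt := measurableT_comp measurable_temp (@measurable_fst _ _ T R3).
have mb := measurableT_comp measurable_bulk (@measurable_fst _ _ T R3).
apply: measurable_funM; first apply: measurable_funM => //.
  by apply: measurable_powRl; exact: measurable_funM.
apply: (measurableT_comp (@measurable_expR R)); apply: measurable_funN.
apply: measurable_funM; first by apply: measurable_sqnorm; exact: measurable_R3B.
by apply: measurable_funV; exact: measurable_funM.
Qed.
End fields.

Lemma leb6E (K : R3 * R3 -> \bar R) : measurable_fun [set: R3 * R3] K -> (forall z, 0 <= K z)%E ->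
  (\int[leb6]_z K z = \int[leb3]_x \int[leb3]_v K (x, v))%E.
Proof. by move=> mK K0; rewrite [LHS]fubini_tonelli1. Qed.

Lemma leb6E' (K : R3 * R3 -> \bar R) : measurable_fun [set: R3 * R3] K -> (forall z, 0 <= K z)%E ->
  (\int[leb6]_z K z = \int[leb3]_v \int[leb3]_x K (x, v))%E.
Proof. by move=> mK K0; rewrite [LHS]fubini_tonelli2. Qed.

Lemma leb3_translate (k : R3 -> \bar R) (c : R3) :
  measurable_fun [set: R3] k -> (forall v, 0 <= k v)%E ->
  (\int[leb3]_v k (v - c)%R = \int[leb3]_v k v)%E.
Proof.
move=> mk k0; have := leb3_affine c ltr01 mk k0.
rewrite invr1 expr1n mul1e => <-; apply: eq_integral => v _.
by rewrite scale1r.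
Qed.

Lemma measurable_shear (t : R) :
  measurable_fun [set: R3 * R3] (fun z : R3 * R3 => ((z.1 - t *: z.2, z.2) : R3 * R3)).
Proof.
apply: measurable_fun_pair => //; apply: measurable_R3B => //.
exact: measurable_R3Z.
Qed.

(** Free transport preserves the measure of phase space: for fixed [v] it is a translation in [x]. *)
Lemma leb6_shear (t : R) (K : R3 * R3 -> \bar R) :
  measurable_fun [set: R3 * R3] K -> (forall z, 0 <= K z)%E ->
  (\int[leb6]_z K (z.1 - t *: z.2, z.2)%R = \int[leb6]_z K z)%E.
Proof.
move=> mK K0; have ms := measurableT_comp mK (measurable_shear t).
rewrite (leb6E' mK K0) (leb6E' (K := fun z => K (z.1 - t *: z.2, z.2)) ms (fun z => K0 _)).
apply: eq_integral => v _ /=.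
rewrite (leb3_translate (k := fun x => K (x, v)))//.
by apply: (measurableT_comp mK); exact: measurable_fun_pair.
Qed.

Lemma tonelli_time (K : R -> R3 * R3 -> \bar R) :
  measurable_fun [set: R * (R3 * R3)] (fun p => K p.1 p.2) -> (forall s z, 0 <= K s z)%E ->
  (\int[leb6]_z \int[leb]_s K s z = \int[leb]_s \int[leb6]_z K s z)%E.
Proof.
by move=> mK K0; have := @fubini_tonelli _ _ _ _ R leb leb6 _ mK (fun p => K0 p.1 p.2) => /= ->.
Qed.

(** The uncurried form, in which joint measurability in [(t, x, v)] is stated. *)
Definition uc (f : R -> R3 -> R3 -> R) (p : R * (R3 * R3)) : R := f p.1 p.2.1 p.2.2.

Lemma measurable_along :
  measurable_fun [set: (R * (R3 * R3)) * R]
   (fun w : (R * (R3 * R3)) * R => ((w.2, (w.1.2.1 - (w.1.1 - w.2) *: w.1.2.2, w.1.2.2)) : R * (R3 * R3))).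
Proof.
apply: measurable_fun_pair => //; apply: measurable_fun_pair.
  apply: measurable_R3B.
    by apply: measurableT_comp => //; apply: measurableT_comp.
  apply: (measurable_R3Z (a := fun w : (R * (R3 * R3)) * R => w.1.1 - w.2)).
    by apply: measurableT_comp => //; apply: measurableT_comp.
  by apply: measurable_funB => //; exact: measurableT_comp.
by apply: measurableT_comp => //; apply: measurableT_comp.
Qed.

(** The indicator of [0 <= s <= t] as a function of both times, which turns integrals over [0, t]
    into integrals over the line with a jointly measurable integrand. *)
Definition tind (t s : R) : R := if (0 <= s) && (s <= t) then 1 else 0.

Lemma measurable_tind d (T : measurableType d) (a b : T -> R) :
  measurable_fun [set: T] a -> measurable_fun [set: T] b ->
  measurable_fun [set: T] (fun x => tind (a x) (b x)).
Proof.
move=> ma mb; apply: measurable_fun_if => //.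
by apply: measurable_and; apply: measurable_fun_ler.
Qed.

Lemma tind_ge0 t s : 0 <= tind t s. Proof. by rewrite /tind; case: ifP. Qed.

Lemma int_tind (t : R) (k : R -> \bar R) :
  (\int[leb]_(s in `[0%R, t]) k s = \int[leb]_s ((tind t s)%:E * k s))%E.
Proof.
rewrite integral_mkcond; apply: eq_integral => s _; rewrite patchE mem_setE in_itv /= /tind.
by case: ifP => _; rewrite ?mul1e ?mul0e.
Qed.
End phase_space.

(** * Duhamel formula with damping *)

Section damped_ode.
Context {R : realType}.
Local Notation leb := (@lebesgue_measure R).
Local Notation R3 := (R3 R).

(** The primitive is smooth on a neighbourhood of the half line, so that no one-sided derivative
    occurs at 0. *)
Lemma ftc_half (f F : R -> R) (a b : R) :
  (forall y : R, -1 < y -> is_derive y 1 F (f y)) ->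
  (forall y : R, -1 < y -> {for y, continuous f}) -> 0 <= a -> a <= b ->
  (\int[leb]_(s in `[a, b]) (f s)%:E = (F b - F a)%:E)%E.
Proof.
move=> dF cf a0; rewrite le_eqVlt => /predU1P[->|ab].
  by rewrite set_itv1 integral_set1 subrr.
have cF y : -1 < y -> {for y, continuous F}.
  move=> y1; apply: differentiable_continuous; apply/derivable1_diffP.
  by have [] := dF y y1.
rewrite (@continuous_FTC2 _ f F)//.
- apply/continuous_within_itvP => //; split.
  + by move=> y; rewrite in_itv/= => /andP[ay _]; apply: cf; lra.
  + by apply: cvg_at_right_filter; apply: cf; lra.
  + by apply: cvg_at_left_filter; apply: cf; lra.
- split.
  + by move=> y; rewrite in_itv/= => /andP[ay _]; have [] : is_derive y 1 F (f y) by apply: dF; lra.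
  + by apply: cvg_at_right_filter; apply: cF; lra.
  + by apply: cvg_at_left_filter; apply: cF; lra.
- move=> y; rewrite in_itv/= => /andP[ay _]; rewrite derive1E.
  by have [_ ->] : is_derive y 1 F (f y) by apply: dF; lra.
Qed.

Section damping.
Variables (p eta : R).
Hypotheses (p1 : 1 < p) (eta0 : 0 <= eta).

(** The majorant of the collision frequency that is used as damping. *)
Definition lam (s : R) : R := eta * (1 + s) `^ (- p).

(** The primitive of [lam] that vanishes at 0; it is bounded as [p > 1]. *)
Definition Lam (t : R) : R := eta * (p - 1)^-1 * (1 - (1 + t) `^ (1 - p)).

Lemma lam_ge0 s : 0 <= lam s. Proof. by rewrite /lam mulr_ge0 ?powR_ge0. Qed.

Lemma lam_le s : 0 <= s -> lam s <= eta.
Proof.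
move=> s0; rewrite /lam ler_piMr//.
by have := @powRN_antitone R p 1 (1 + s); rewrite powR1; apply=> //; move: p1; lra.
Qed.

Lemma Lam0 : Lam 0 = 0. Proof. by rewrite /Lam addr0 powR1 subrr mulr0. Qed.

Lemma Lam_nd s t : 0 <= s -> s <= t -> Lam s <= Lam t.
Proof.
move=> s0 st; have pp : 0 < p - 1 by rewrite subr_gt0.
rewrite /Lam ler_wpM2l ?mulr_ge0 ?invr_ge0 ?(ltW pp)// lerD2l lerN2.
have -> : 1 - p = - (p - 1) by ring.
by apply: powRN_antitone; [exact: ltW|lra|lra].
Qed.

Lemma Lam_ge0 t : 0 <= t -> 0 <= Lam t.
Proof. by move=> t0; rewrite -Lam0 Lam_nd. Qed.

Lemma Lam_le t : Lam t <= eta * (p - 1)^-1.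
Proof.
have pp : 0 < p - 1 by rewrite subr_gt0.
by rewrite /Lam ler_piMr ?mulr_ge0 ?invr_ge0 ?(ltW pp)// lerBlDr lerDl powR_ge0.
Qed.

Lemma Lam_derive (y : R) : -1 < y -> is_derive y 1 Lam (lam y).
Proof.
move=> y1; have pp : p - 1 != 0 by rewrite gt_eqF// subr_gt0.
have H := is_derive_powR1D (1 - p) y1.
have H2 : is_derive y 1 (fun z : R => 1 - (1 + z) `^ (1 - p)) (0 - (1 - p) * (1 + y) `^ (1 - p - 1)).
  by apply: is_deriveB.
apply: (@is_derive_eq _ _ _ Lam y 1 _ _ (@is_deriveZ _ _ _ _ (eta * (p - 1)^-1) _ _ _ H2)).
have -> : 1 - p - 1 = - p by ring.
by rewrite /lam /GRing.scale /=; field.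
Qed.

Lemma lam_cts (y : R) : -1 < y -> {for y, continuous lam}.
Proof.
move=> y1; apply: (@continuousM _ _ (fun=> eta) (fun s : R => (1 + s) `^ (- p))).
  exact: cvg_cst.
exact: cts_powR1D.
Qed.

Lemma measurable_lam : measurable_fun [set: R] lam.
Proof. by apply: measurable_funM => //; apply: measurable_powRl; exact: measurable_funD. Qed.

Lemma measurable_Lam : measurable_fun [set: R] Lam.
Proof.
apply: measurable_funM => //; apply: measurable_funB => //.
by apply: measurable_powRl; exact: measurable_funD.
Qed.

Lemma int_lam t : 0 <= t -> (\int[leb]_(s in `[0%R, t]) (lam s)%:E = (Lam t)%:E)%E.
Proof.
move=> t0; rewrite (ftc_half Lam_derive lam_cts)//.
by rewrite Lam0 subr0.
Qed.

(** The integrand is the derivative of [- expR (Lam tau - Lam s)]. *)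
Lemma int_lamE (tau t : R) : 0 <= tau -> tau <= t ->
  (\int[leb]_(s in `[tau, t]) (lam s * expR (Lam tau - Lam s))%:E = (1 - expR (Lam tau - Lam t))%:E)%E.
Proof.
move=> tau0 tt.
have D (y : R) : -1 < y -> is_derive y 1 (fun s : R => - expR (Lam tau - Lam s)) (lam y * expR (Lam tau - Lam y)).
  move=> y1.
  have H : is_derive y 1 (fun s : R => Lam tau - Lam s) (0 - lam y).
    by have := Lam_derive y1 => ?; apply: is_deriveB.
  have H2 := @is_derive1_comp R expR (fun s => Lam tau - Lam s) y _ _ (is_derive_expR _) H.
  have := @is_deriveN _ _ _ _ _ _ _ H2; rewrite sub0r mulrN opprK mulrC; exact.
have C (y : R) : -1 < y -> {for y, continuous (fun s : R => lam s * expR (Lam tau - Lam s))}.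
  move=> y1; apply: (@continuousM _ _ lam (fun s => expR (Lam tau - Lam s))); first exact: lam_cts.
  apply: (@continuous_comp _ _ _ (fun s => Lam tau - Lam s) expR); last exact: continuous_expR.
  apply: cvgB; first exact: cvg_cst.
  apply: differentiable_continuous; apply/derivable1_diffP.
  by have [] := Lam_derive y1.
by apply: (etrans (ftc_half D C tau0 tt)); rewrite [Lam tau - Lam tau]subrr expR0 opprK addrC.
Qed.

Lemma bounded_integrable (t B : R) (k : R -> R) : measurable_fun [set: R] k ->
  (forall s : R, 0 <= s -> s <= t -> `|k s| <= B) -> leb.-integrable `[0%R, t] (EFin \o k).
Proof.
move=> mk kB; apply: measurable_bounded_integrable => //.
- by rewrite /= lebesgue_measure_itv; case: ifP => // _; rewrite -EFinD ltry.
- exact: measurable_funTS.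
- exists B; split; first exact: num_real.
  by move=> M BM s /=; rewrite in_itv/= => /andP[s0 st]; apply: (le_trans (kB s s0 st)); exact: ltW.
Qed.

(** The solution of [y' + lam y = h], [y(0) = y0]. *)
Definition duh (y0 : R) (h : R -> R) (t : R) : R :=
  expR (- Lam t) * y0 + \int[leb]_(s in `[0, t]) (expR (Lam s - Lam t) * h s).

Section mild.
Variables (y0 B : R) (h : R -> R).
Hypotheses (y00 : 0 <= y0) (mh : measurable_fun [set: R] h) (h0 : forall s : R, 0 <= s -> 0 <= h s)
  (hB : forall s : R, 0 <= s -> h s <= B).

Lemma expLam_le (s t : R) : 0 <= s -> s <= t -> expR (Lam s - Lam t) <= 1.
Proof. by move=> s0 st; rewrite -expR0 ler_expR subr_le0 Lam_nd. Qed.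

Lemma measurable_kern (t : R) : measurable_fun [set: R] (fun s => expR (Lam s - Lam t) * h s).
Proof.
apply: measurable_funM => //; apply: (measurableT_comp (@measurable_expR R)).
by apply: measurable_funB => //; exact: measurable_Lam.
Qed.

Lemma kern_bound (t s : R) : 0 <= s -> s <= t -> 0 <= expR (Lam s - Lam t) * h s <= h s.
Proof.
move=> s0 st; rewrite mulr_ge0 ?expR_ge0 ?h0//=.
by rewrite ler_piMl ?h0// expLam_le.
Qed.

Lemma integrable_kern (t : R) : leb.-integrable `[0%R, t] (EFin \o (fun s => expR (Lam s - Lam t) * h s)).
Proof.
apply: (@bounded_integrable _ B); first exact: measurable_kern.
move=> s s0 st; have /andP[a b] := kern_bound s0 st.
by rewrite ger0_norm// (le_trans b)// hB.
Qed.

Lemma integrable_h (t : R) : leb.-integrable `[0%R, t] (EFin \o h).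
Proof.
by apply: (@bounded_integrable _ B) => // s s0 st; rewrite ger0_norm ?h0 ?hB.
Qed.

Lemma duh_ge0 (t : R) : 0 <= duh y0 h t.
Proof.
rewrite /duh addr_ge0 ?mulr_ge0 ?expR_ge0//; apply: Rintegral_ge0 => s.
rewrite /= in_itv/= => /andP[s0 st]; by have /andP[] := kern_bound s0 st.
Qed.

Lemma EFin_duh (t : R) : (duh y0 h t)%:E =
  ((expR (- Lam t) * y0)%:E + \int[leb]_s ((tind t s)%:E * (expR (Lam s - Lam t) * h s)%:E))%E.
Proof.
by rewrite /duh EFinD /Rintegral fineK; [rewrite int_tind|exact: integrable_fin_num (integrable_kern t)].
Qed.

Lemma tind_swap (t s tau : R) : tind t s * tind s tau = tind t tau * (if (tau <= s) && (s <= t) then 1 else 0).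
Proof.
rewrite /tind; case: (leP 0 s) => s0; case: (leP s t) => st; case: (leP 0 tau) => t0;
  case: (leP tau s) => ts; case: (leP tau t) => tt; rewrite /= ?mulr1 ?mulr0 ?mul0r//; lra.
Qed.

Lemma tind_h (t s : R) : 0 <= tind t s * h s.
Proof. by rewrite /tind; case: ifP => [/andP[s0 _]|_]; rewrite ?mul1r ?mul0r// h0. Qed.

Lemma measurable_duh : measurable_fun [set: R] (duh y0 h).
Proof.
apply: measurable_funD.
  apply: measurable_funM => //; apply: (measurableT_comp (@measurable_expR R)).
  by apply: measurable_funN; exact: measurable_Lam.
under eq_fun do rewrite /Rintegral int_tind.
apply: (@measurable_Rint R _ _ _ _ leb (fun t s => tind t s * (expR (Lam s - Lam t) * h s))).
apply: measurable_funM; first exact: measurable_tind.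
apply: measurable_funM; last exact: (measurableT_comp mh).
apply: (measurableT_comp (@measurable_expR R)).
by apply: measurable_funB; apply: (measurableT_comp measurable_Lam).
Qed.

(** The equation integrated over [0, t]. Tonelli on the triangle [tau <= s <= t] leaves the integral
    of [lam s * expR (Lam tau - Lam s)] over [tau, t], which is explicit. *)
Lemma int_lam_duh (t : R) : 0 <= t ->
  (\int[leb]_(s in `[0%R, t]) (lam s * duh y0 h s)%:E + (duh y0 h t)%:E =
   y0%:E + \int[leb]_(s in `[0%R, t]) (h s)%:E)%E.
Proof.
move=> t0.
have mexp a : measurable_fun [set: R] (fun s => expR (a - Lam s)).
  apply: (measurableT_comp (@measurable_expR R)).
  by apply: measurable_funB => //; exact: measurable_Lam.
pose K s tau : \bar R := (tind t s * (lam s * (tind s tau * (expR (Lam tau - Lam s) * h tau))))%:E.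
have K0 s tau : (0 <= K s tau)%E.
  rewrite lee_fin; have := tind_h s tau => th.
  have -> : tind t s * (lam s * (tind s tau * (expR (Lam tau - Lam s) * h tau))) =
    tind t s * (lam s * expR (Lam tau - Lam s)) * (tind s tau * h tau) by ring.
  exact: mulr_ge0 (mulr_ge0 (tind_ge0 _ _) (mulr_ge0 (lam_ge0 _) (expR_ge0 _))) th.
have mK : measurable_fun [set: R * R] (fun z => K z.1 z.2).
  apply/measurable_EFinP; apply: measurable_funM; first exact: measurable_tind.
  apply: measurable_funM; first exact: (measurableT_comp measurable_lam).
  apply: measurable_funM; first exact: measurable_tind.
  apply: measurable_funM; last exact: (measurableT_comp mh).
  apply: (measurableT_comp (@measurable_expR R)).
  by apply: measurable_funB; apply: (measurableT_comp measurable_Lam).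
have E1 : (\int[leb]_(s in `[0%R, t]) (lam s * duh y0 h s)%:E =
  \int[leb]_(s in `[0%R, t]) (lam s * (expR (0 - Lam s) * y0))%:E + \int[leb]_s \int[leb]_tau K s tau)%E.
  rewrite !int_tind -ge0_integralD//; last 4 first.
  - move=> s _; rewrite -EFinM lee_fin mulr_ge0 ?tind_ge0// mulr_ge0 ?lam_ge0// mulr_ge0 ?expR_ge0//.
  - apply: emeasurable_funM; apply/measurable_EFinP; first exact: measurable_tind.
    apply: measurable_funM; first exact: measurable_lam.
    by apply: measurable_funM => //; exact: mexp.
  - by move=> s _; exact: integral_ge0.
  - by apply: (@measurable_integral2 _ _ _ _ _ leb K).
  apply: eq_integral => s _; rewrite EFinM EFin_duh.
  rewrite -[in RHS]EFinM -[in X in (_ + X)%E]/(K s).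
  have ki : (0 <= \int[leb]_x ((tind s x)%:E * (expR (Lam x - Lam s) * h x)%:E))%E.
    by apply: integral_ge0 => x _; rewrite -EFinM lee_fin mulrCA mulr_ge0 ?expR_ge0 ?tind_h.
  rewrite ge0_muleDr//; last by rewrite lee_fin mulr_ge0 ?expR_ge0.
  rewrite ge0_muleDr//; last 2 first.
  - by rewrite -EFinM lee_fin mulr_ge0 ?lam_ge0// mulr_ge0 ?expR_ge0.
  - by rewrite mule_ge0// lee_fin lam_ge0.
  congr (_ + _)%E; first by rewrite -!EFinM sub0r.
  rewrite muleA -EFinM -ge0_integralZl//.
  - by apply: eq_integral => tau _; rewrite /K -!EFinM; congr EFin; ring.
  - apply: emeasurable_funM; apply/measurable_EFinP; first exact: measurable_tind.
    exact: measurable_kern.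
  - by move=> x _; rewrite -EFinM lee_fin mulrCA mulr_ge0 ?expR_ge0 ?tind_h.
  - by rewrite lee_fin mulr_ge0 ?tind_ge0 ?lam_ge0.
have E2 : (\int[leb]_(s in `[0%R, t]) (lam s * (expR (0 - Lam s) * y0))%:E = ((1 - expR (- Lam t)) * y0)%:E)%E.
  have := int_lamE (lexx 0) t0; rewrite Lam0 !sub0r => H.
  rewrite EFinM -H -ge0_integralZr//=; last 2 first.
  - apply: measurable_funTS; apply/measurable_EFinP; apply: measurable_funM; first exact: measurable_lam.
    exact: mexp.
  - by move=> s _; rewrite lee_fin mulr_ge0 ?lam_ge0 ?expR_ge0.
  by apply: eq_integral => s _; rewrite -EFinM mulrA sub0r.
have E3 : (\int[leb]_s \int[leb]_tau K s tau =
   \int[leb]_tau ((tind t tau)%:E * ((1 - expR (Lam tau - Lam t)) * h tau)%:E))%E.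
  have -> : (\int[leb]_s \int[leb]_tau K s tau = \int[leb]_tau \int[leb]_s K s tau)%E.
    by have := @fubini_tonelli _ _ _ _ R leb leb _ mK (fun=> K0 _ _).
  apply: eq_integral => tau _; rewrite /K.
  have [/andP[tau0 taut]|tn] := boolP ((0 <= tau) && (tau <= t)); last first.
    rewrite [tind t tau]/tind (negPf tn) mul0e.
    apply: integral0_eq => s _; congr EFin.
    have -> : tind t s * (lam s * (tind s tau * (expR (Lam tau - Lam s) * h tau))) =
      (tind t s * tind s tau) * (lam s * (expR (Lam tau - Lam s) * h tau)) by ring.
    by rewrite tind_swap [tind t tau]/tind (negPf tn) !mul0r.
  have -> : tind t tau = 1 by rewrite /tind tau0 taut.
  rewrite mul1e EFinM -(int_lamE tau0 taut) -ge0_integralZr//=; last 3 first.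
  - apply: measurable_funTS; apply/measurable_EFinP; apply: measurable_funM; first exact: measurable_lam.
    exact: mexp.
  - by move=> s _; rewrite lee_fin mulr_ge0 ?lam_ge0 ?expR_ge0.
  - by rewrite lee_fin h0.
  rewrite [RHS]integral_mkcond; apply: eq_integral => s _; rewrite patchE mem_setE in_itv /=.
  have -> : tind t s * (lam s * (tind s tau * (expR (Lam tau - Lam s) * h tau))) =
      (tind t s * tind s tau) * (lam s * (expR (Lam tau - Lam s) * h tau)) by ring.
  rewrite tind_swap; have -> : tind t tau = 1 by rewrite /tind tau0 taut.
  by case: ifP => _; rewrite ?mul1r ?mul0r// -EFinM mulrA.
rewrite E1 E2 E3 EFin_duh.
have nn x : (0 <= (tind t x)%:E * (expR (Lam x - Lam t) * h x)%:E)%E.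
  by rewrite -EFinM lee_fin mulrCA mulr_ge0 ?expR_ge0 ?tind_h.
have nn2 x : (0 <= (tind t x)%:E * ((1 - expR (Lam x - Lam t)) * h x)%:E)%E.
  rewrite -EFinM lee_fin /tind; case: ifP => [/andP[x0 xt]|_]; rewrite ?mul1r ?mul0r//.
  by rewrite mulr_ge0 ?h0// subr_ge0 expLam_le.
have mm : measurable_fun [set: R] (fun x => (tind t x)%:E * (expR (Lam x - Lam t) * h x)%:E)%E.
  by apply: emeasurable_funM; apply/measurable_EFinP; [exact: measurable_tind|exact: measurable_kern].
have mm2 : measurable_fun [set: R] (fun x => (tind t x)%:E * ((1 - expR (Lam x - Lam t)) * h x)%:E)%E.
  apply: emeasurable_funM; apply/measurable_EFinP; first exact: measurable_tind.
  apply: measurable_funM => //; apply: measurable_funB => //.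
  apply: (measurableT_comp (@measurable_expR R)).
  by apply: measurable_funB => //; exact: measurable_Lam.
rewrite addeACA -EFinD.
have -> : (1 - expR (- Lam t)) * y0 + expR (- Lam t) * y0 = y0 by ring.
congr (_ + _)%E; rewrite int_tind -ge0_integralD//.
apply: eq_integral => s _; rewrite -!EFinM -EFinD; congr EFin; ring.
Qed.

Lemma duh_le (t : R) : 0 <= t -> duh y0 h t <= y0 + \int[leb]_(s in `[0, t]) h s.
Proof.
move=> t0; apply: lerD.
  by rewrite ler_piMl// -expR0 ler_expR oppr_le0 Lam_ge0.
apply: le_Rintegral => //; [exact: integrable_kern|exact: integrable_h|].
move=> s; rewrite /= in_itv/= => /andP[s0 st]; by have /andP[] := kern_bound s0 st.
Qed.

Lemma duh_bound (t : R) : 0 <= t -> duh y0 h t <= y0 + B * t.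
Proof.
move=> t0; apply: (le_trans (duh_le t0)); rewrite lerD2l.
have -> : B * t = \int[leb]_(s in `[0, t]) B.
  rewrite Rintegral_cst//= lebesgue_measure_itv /= lte_fin.
  by case: ltP => [_|]; [rewrite -EFinD /= subr0|move=> ?; have -> : t = 0 by lra; rewrite !mulr0].
apply: le_Rintegral => //; first exact: integrable_h.
  by apply: (@bounded_integrable _ `|B|).
by move=> s; rewrite /= in_itv/= => /andP[s0 st]; exact: hB.
Qed.

Lemma integrable_lam_duh (t : R) : leb.-integrable `[0%R, t] (EFin \o (fun s => lam s * duh y0 h s)).
Proof.
have [t0|t0] := leP 0 t; last by rewrite set_itv_ge ?integrable_set0// bnd_simp -ltNge.
apply: (@bounded_integrable _ (eta * (y0 + B * t))).
  by apply: measurable_funM; [exact: measurable_lam|exact: measurable_duh].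
move=> s s0 st; rewrite ger0_norm; last exact: mulr_ge0 (lam_ge0 _) (duh_ge0 _).
apply: ler_pM; [exact: lam_ge0|exact: duh_ge0|exact: lam_le|].
have B0 : 0 <= B by apply: le_trans (hB (lexx 0)); exact: h0.
by apply: (le_trans (duh_bound s0)); rewrite lerD2l ler_wpM2l.
Qed.

(** The source [h - lam y] will be the collision term, as [h] will be the gain along a
    characteristic. *)
Lemma duh_mild (t : R) : 0 <= t ->
  duh y0 h t = y0 + \int[leb]_(s in `[0, t]) (h s - lam s * duh y0 h s).
Proof.
move=> t0; have hi := integrable_h t; have li := integrable_lam_duh t.
rewrite RintegralB// addrA.
have := int_lam_duh t0.
have E1 : (\int[leb]_(s in `[0%R, t]) (lam s * duh y0 h s)%:E = (\int[leb]_(s in `[0, t]) (lam s * duh y0 h s))%:E)%E.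
  by rewrite /Rintegral fineK//; exact: integrable_fin_num li.
have E2 : (\int[leb]_(s in `[0%R, t]) (h s)%:E = (\int[leb]_(s in `[0, t]) h s)%:E)%E.
  by rewrite /Rintegral fineK//; exact: integrable_fin_num hi.
rewrite E1 E2 -!EFinD => -[] <-; by rewrite addrAC subrr add0r.
Qed.

Lemma duh_mild_ext (F : R -> R) (t : R) : 0 <= t -> (forall s : R, 0 <= s -> duh y0 h s = F s) ->
  F t = y0 + \int[leb]_(s in `[0, t]) (h s - lam s * F s).
Proof.
move=> t0 FE; rewrite -(FE t t0) (duh_mild t0); congr (_ + _).
by apply: eq_Rintegral => s; rewrite inE /= in_itv/= => /andP[s0 _]; rewrite FE.
Qed.
End mild.
End damping.
End damped_ode.

(** * The norm of [L^1_2] along characteristics *)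

Section L12_norm.
Context {R : realType}.
Local Notation leb := (@lebesgue_measure R).
Local Notation R3 := (R3 R).

Definition mR6 (h : R3 -> R3 -> R) : Prop :=
  measurable_fun [set: R3 * R3] (fun z : R3 * R3 => h z.1 z.2).

Lemma measurable_energy (h : R3 -> R3 -> R) : mR6 h ->
  measurable_fun [set: R3 * R3] (fun z : R3 * R3 => ((1 + sqnorm z.2) * `|h z.1 z.2|)%:E).
Proof.
move=> mh; apply/measurable_EFinP; apply: measurable_funM.
  by apply: measurable_funD => //; exact: measurable_sqnorm.
exact: measurableT_comp.
Qed.

Lemma energy_ge0 (h : R3 -> R3 -> R) (z : R3 * R3) :
  (0 <= ((1 + sqnorm z.2) * `|h z.1 z.2|)%:E)%E.
Proof. by rewrite lee_fin mulr_ge0// addr_ge0// sqnorm_ge0. Qed.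

Lemma norm_L12_ge0 (h : R3 -> R3 -> R) : (0 <= norm_L12 h)%E.
Proof. by apply: integral_ge0 => z _; exact: energy_ge0. Qed.

Lemma norm_L12_le (h k : R3 -> R3 -> R) : mR6 h -> mR6 k ->
  (forall x v, `|h x v| <= `|k x v|) -> (norm_L12 h <= norm_L12 k)%E.
Proof.
move=> mh mk hk; apply: (@ge0_le_integral _ _ _ leb6 _ measurableT).
- by move=> z _; exact: energy_ge0.
- exact: measurable_energy.
- exact: measurable_energy.
- by move=> z _; rewrite lee_fin ler_wpM2l// addr_ge0// sqnorm_ge0.
Qed.

Lemma norm_L12D (h k l : R3 -> R3 -> R) : mR6 h -> mR6 k -> mR6 l ->
  (forall x v, `|h x v| <= `|k x v| + `|l x v|) -> (norm_L12 h <= norm_L12 k + norm_L12 l)%E.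
Proof.
move=> mh mk ml hk; rewrite /norm_L12 -(@ge0_integralD _ _ _ leb6 _ measurableT); last 4 first.
- by move=> z _; exact: energy_ge0.
- exact: measurable_energy.
- by move=> z _; exact: energy_ge0.
- exact: measurable_energy.
apply: (@ge0_le_integral _ _ _ leb6 _ measurableT).
- by move=> z _; exact: energy_ge0.
- exact: measurable_energy.
- by apply: emeasurable_funD; exact: measurable_energy.
- by move=> z _; rewrite -EFinD lee_fin -mulrDr ler_wpM2l// addr_ge0// sqnorm_ge0.
Qed.

Lemma norm_L12Z (c : R) (h : R3 -> R3 -> R) : 0 <= c -> mR6 h ->
  norm_L12 (fun x v => c * h x v) = (c%:E * norm_L12 h)%E.
Proof.
move=> c0 mh; rewrite /norm_L12 -ge0_integralZl//; last 2 first.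
- exact: measurable_energy.
- by move=> z _; exact: energy_ge0.
by apply: eq_integral => z _; rewrite -EFinM normrM (ger0_norm c0) mulrCA.
Qed.

Lemma mR6B (h k : R3 -> R3 -> R) : mR6 h -> mR6 k -> mR6 (fun x v => h x v - k x v).
Proof. by move=> mh mk; exact: measurable_funB. Qed.

Lemma mR6_slice (h : R3 -> R3 -> R) (x : R3) : mR6 h -> measurable_fun [set: R3] (h x).
Proof. by move=> mh; apply: (measurableT_comp mh (g := fun v : R3 => (x, v))); exact: measurable_fun_pair. Qed.

Lemma norm_L12E (h : R3 -> R3 -> R) : mR6 h ->
  norm_L12 h = (\int[leb3]_x \int[leb3]_v ((1 + sqnorm v) * `|h x v|)%:E)%E.
Proof. by move=> mh; rewrite /norm_L12 leb6E//; [exact: measurable_energy|exact: energy_ge0]. Qed.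

(** Lipschitz bounds in velocity at each point [x] integrate to bounds on phase space. *)
Lemma norm_L12_fiber (h k : R3 -> R3 -> R) (C : R) : 0 <= C -> mR6 h -> mR6 k ->
  (forall x, \int[leb3]_v ((1 + sqnorm v) * `|h x v|)%:E <=
             C%:E * \int[leb3]_v ((1 + sqnorm v) * `|k x v|)%:E)%E ->
  (norm_L12 h <= C%:E * norm_L12 k)%E.
Proof.
move=> C0 mh mk hk; rewrite !norm_L12E//.
have mf l : mR6 l -> measurable_fun [set: R3] (fun x => \int[leb3]_v ((1 + sqnorm v) * `|l x v|)%:E)%E.
  move=> ml; apply: (@measurable_integral2 _ _ _ _ _ leb3 (fun x v => ((1 + sqnorm v) * `|l x v|)%:E)).
    exact: measurable_energy.
  by move=> x v; exact: (energy_ge0 l (x, v)).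
have f0 (l : R3 -> R3 -> R) (x : R3) : (0 <= \int[leb3]_v ((1 + sqnorm v) * `|l x v|)%:E)%E.
  by apply: integral_ge0 => v _; exact: (energy_ge0 l (x, v)).
rewrite -(@ge0_integralZl _ _ _ leb3 _ measurableT); last 3 first.
- exact: mf.
- by move=> x _; exact: f0.
- by rewrite lee_fin.
apply: (@ge0_le_integral _ _ _ leb3 _ measurableT).
- by move=> x _; exact: f0.
- exact: mf.
- by apply: emeasurable_funM; [exact: measurable_cst|exact: mf].
- by move=> x _; exact: hk.
Qed.

Lemma uc_slice (H : R -> R3 -> R3 -> R) (s : R) : measurable_fun [set: R * (R3 * R3)] (uc H) -> mR6 (H s).
Proof. by move=> mH; apply: (measurableT_comp mH (g := fun z : R3 * R3 => (s, z))); exact: measurable_fun_pair. Qed.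

Lemma measurable_norm_L12 (H : R -> R3 -> R3 -> R) :
  measurable_fun [set: R * (R3 * R3)] (uc H) -> measurable_fun [set: R] (fun s => norm_L12 (H s)).
Proof.
move=> mH; apply: (@measurable_integral2 _ _ _ _ _ leb6 (fun s (z : R3 * R3) => ((1 + sqnorm z.2) * `|H s z.1 z.2|)%:E)).
  apply/measurable_EFinP; apply: measurable_funM.
    apply: measurable_funD => //; apply: measurable_sqnorm.
    by apply: measurableT_comp => //; apply: measurableT_comp.
  exact: measurableT_comp.
by move=> s z; exact: energy_ge0.
Qed.

Lemma measurable_shear_time (t : R) :
  measurable_fun [set: R * (R3 * R3)]
   (fun w : R * (R3 * R3) => ((w.1, (w.2.1 - (t - w.1) *: w.2.2, w.2.2)) : R * (R3 * R3))).
Proof.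
apply: measurable_fun_pair => //; apply: measurable_fun_pair.
  apply: measurable_R3B; first exact: measurableT_comp.
  apply: (measurable_R3Z (a := fun w : R * (R3 * R3) => t - w.1)); first exact: measurableT_comp.
  exact: measurable_funB.
exact: measurableT_comp.
Qed.

(** Free transport preserves the norm of [L^1_2], so that the contributions of all times add up
    along characteristics. *)
Lemma L12_along (t : R) (H : R -> R3 -> R3 -> R) : measurable_fun [set: R * (R3 * R3)] (uc H) ->
  (\int[leb6]_z ((1 + sqnorm z.2)%:E * \int[leb]_(s in `[0%R, t]) (`|H s (z.1 - (t - s) *: z.2)%R z.2|)%:E)
   = \int[leb]_(s in `[0%R, t]) norm_L12 (H s))%E.
Proof.
move=> mH.
pose K (s : R) (z : R3 * R3) : \bar R := ((1 + sqnorm z.2)%:E * ((tind t s)%:E * (`|H s (z.1 - (t - s) *: z.2)%R z.2|)%:E))%E.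
have w0 (z : R3 * R3) : (0 <= (1 + sqnorm z.2)%:E)%E by rewrite lee_fin addr_ge0// sqnorm_ge0.
have i0 (s : R) (z : R3 * R3) : (0 <= (tind t s)%:E * (`|H s (z.1 - (t - s) *: z.2)%R z.2|)%:E)%E.
  by rewrite mule_ge0// lee_fin tind_ge0.
have K0 s z : (0 <= K s z)%E by rewrite mule_ge0.
have mi : measurable_fun [set: R * (R3 * R3)]
    (fun p => (tind t p.1)%:E * (`|H p.1 (p.2.1 - (t - p.1) *: p.2.2)%R p.2.2|)%:E)%E.
  apply: emeasurable_funM; apply/measurable_EFinP; first exact: measurable_tind.
  apply: measurableT_comp => //; exact: (measurableT_comp mH (measurable_shear_time t)).
have mK : measurable_fun [set: R * (R3 * R3)] (fun p => K p.1 p.2).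
  apply: emeasurable_funM => //; apply/measurable_EFinP; apply: measurable_funD => //.
  by apply: measurable_sqnorm; exact: measurableT_comp.
transitivity (\int[leb6]_z \int[leb]_s K s z)%E.
  apply: eq_integral => z _; rewrite int_tind ge0_integralZl//.
  by apply: (measurableT_comp mi (g := fun s : R => (s, z))); exact: measurable_fun_pair.
rewrite (tonelli_time mK K0) int_tind; apply: eq_integral => s _.
have ms := uc_slice s mH.
rewrite /norm_L12 -ge0_integralZl//; last 3 first.
- exact: measurable_energy.
- by move=> z _; exact: energy_ge0.
- by rewrite lee_fin tind_ge0.
rewrite -(leb6_shear (t - s) (K := fun z => ((tind t s)%:E * ((1 + sqnorm z.2) * `|H s z.1 z.2|)%:E)%E)).
- by apply: eq_integral => z _; rewrite /K /= -!EFinM mulrCA.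
- by apply: emeasurable_funM => //; exact: measurable_energy.
- by move=> z; rewrite mule_ge0 ?energy_ge0// lee_fin tind_ge0.
Qed.

Section lift.
Variables (q al be : R).
Hypotheses (q5 : 5 < q) (al0 : 0 < al) (al1 : al <= 1) (be0 : 0 <= be) (be1 : be <= 1).
Hypotheses (hab : 2 <= 3 * al + 2 * be) (hq : 2 * (1 + be) <= al * (q - 3)).

Lemma measurable_coll6 d (T : measurableType d) (F : T -> R3 -> R) :
  measurable_fun [set: T * R3] (fun z => F z.1 z.2) ->
  measurable_fun [set: T * R3] (fun z => coll al be (F z.1) z.2).
Proof.
move=> mF; apply: measurable_funM.
  have an0 : al != 0 by rewrite gt_eqF.
  have mn := measurable_nu mF be an0.
  by apply: (measurableT_comp (f := fun w : T => collision_freq (F w) al be) (g := fst) mn); exact: measurable_fst.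
by apply: measurable_funB => //; exact: measurable_maxw.
Qed.

Lemma measurable_coll_uc (f : R -> R3 -> R3 -> R) : measurable_fun [set: R * (R3 * R3)] (uc f) ->
  measurable_fun [set: R * (R3 * R3)] (uc (fun t x v => coll al be (f t x) v)).
Proof.
move=> mf; have mf' : measurable_fun [set: (R * R3) * R3] (fun z : (R * R3) * R3 => f z.1.1 z.1.2 z.2).
  apply: (measurableT_comp mf (f := uc f) (g := fun z : (R * R3) * R3 => (z.1.1, (z.1.2, z.2)))).
  apply: measurable_fun_pair; first exact: measurableT_comp.
  by apply: measurable_fun_pair => //; exact: measurableT_comp.
have := measurable_coll6 (F := fun w : R * R3 => f w.1 w.2) mf' => mc.
apply: (measurableT_comp mc (g := fun p : R * (R3 * R3) => ((p.1, p.2.1), p.2.2))).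
apply: measurable_fun_pair; last exact: measurableT_comp.
by apply: measurable_fun_pair => //; exact: measurableT_comp.
Qed.

(** The Lipschitz estimate on phase space, from the one at each point [x]. *)
Lemma norm_L12_coll (h k : R3 -> R3 -> R) : mR6 h -> mR6 k ->
  (forall x, dclass q 1 (h x)) -> (forall x, dclass q 1 (k x)) ->
  (norm_L12 (fun x v => coll al be (h x) v - coll al be (k x) v)%R
   <= (Klip q)%:E * norm_L12 (fun x v => h x v - k x v)%R)%E.
Proof.
move=> mh mk ch ck; apply: norm_L12_fiber; first exact: Klip_ge0.
- apply: (mR6B (h := fun x v => coll al be (h x) v) (k := fun x v => coll al be (k x) v)).
  + exact: measurable_coll6 mh.
  + exact: measurable_coll6 mk.
- exact: mR6B.
move=> x; have := coll_lip q5 al0 al1 be0 be1 hab hq (ch x) (ck x).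
rewrite -lee_fin EFinM (EFin_I3 (ii_collw al be q5 (ch x) (ck x))).
by rewrite /wdist EFin_I3//; apply: ii_wdist; [exact: dclass_dens q5 ler01 (ch x)|exact: dclass_dens q5 ler01 (ck x)].
Qed.
End lift.
End L12_norm.

(** * Geometric convergence and a Gronwall step *)

Section limits.
Context {R : realType}.
Local Notation leb := (@lebesgue_measure R).
Local Notation R3 := (R3 R).

Lemma summable_increments_cvg (a : nat -> R) (B : R) :
  (forall n, \sum_(0 <= k < n) `|a k.+1 - a k| <= B) ->
  a @ \oo --> limn a /\ fine (limn_esup (fun n => (a n)%:E)) = limn a.
Proof.
move=> aB.
have c : cvgn (series (telescope a)).
  apply: normed_cvg; apply: nondecreasing_is_cvgn.
    apply: nondecreasing_series => n _ _; exact: normr_ge0.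
  by exists B => _ [n _ <-]; exact: aB.
have ca : cvgn a.
  have -> : a = (fun n => a 0%N + series (telescope a) n) by apply/funext => n; exact: eq_sum_telescope.
  by apply: is_cvgD => //; exact: is_cvg_cst.
split; first exact: ca.
have ce : (a n)%:E @[n --> \oo] --> (limn a)%:E by apply: cvg_EFin => //; exact: nearW.
by have [_ ->] := cvg_limn_einf_sup ce.
Qed.

Lemma dist_lim_le (a : nat -> R) (w M : R) (n : nat) : 0 <= w -> a @ \oo --> limn a ->
  (forall j, \sum_(0 <= k < j) w * `|a (n + k).+1 - a (n + k)%N| <= M) -> w * `|limn a - a n| <= M.
Proof.
move=> w0 ca aM.
have c : (w * `|a m - a n|) @[m --> \oo] --> w * `|limn a - a n|.
  apply: cvgM; first exact: cvg_cst.
  by apply: cvg_norm; apply: cvgB => //; exact: cvg_cst.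
rewrite -(cvg_lim _ c)//; apply: limr_le; first by apply/cvg_ex; eexists; exact: c.
exists n => // m /= nm; apply: le_trans (aM (m - n)%N).
rewrite -mulr_sumr ler_wpM2l//.
have -> : a m - a n = \sum_(0 <= k < m - n) (a (n + k).+1 - a (n + k)%N).
  have := @telescope_sumr _ 0 (m - n) (fun k => a (n + k)%N) isT.
  rewrite addn0 subnKC// => <-; apply: eq_bigr => k _; by rewrite addnS.
exact: ler_norm_sum.
Qed.

Lemma geometric_tail (b : R) (n j : nat) : 0 <= b ->
  \sum_(0 <= k < j) b / 2 ^+ (n + k) <= 2 * b / 2 ^+ n.
Proof.
move=> b0; have -> : \sum_(0 <= k < j) b / 2 ^+ (n + k) = 2 * b / 2 ^+ n - 2 * b / 2 ^+ (n + j).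
  elim: j => [|j IH]; first by rewrite big_nil addn0 subrr.
  rewrite big_nat_recr//= IH addnS exprS; field.
  by rewrite !expf_neq0.
by rewrite gerBl// divr_ge0 ?mulr_ge0// exprn_ge0.
Qed.

Lemma limn_esup_between (a : nat -> R) (m M : R) : (forall n, m <= a n <= M) ->
  m <= fine (limn_esup (fun n => (a n)%:E)) <= M.
Proof.
move=> aM; rewrite limn_esup_lim.
have H1 : (m%:E <= limn (esups (fun n => (a n)%:E)))%E.
  apply: lime_ge; first exact: is_cvg_esups.
  apply: nearW => n; apply: (@le_trans _ _ (a n)%:E); first by rewrite lee_fin; have /andP[] := aM n.
  by apply: ereal_sup_ubound; exists n => //=.
have H2 : (limn (esups (fun n => (a n)%:E)) <= M%:E)%E.
  apply: lime_le; first exact: is_cvg_esups.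
  apply: nearW => n; apply: ge_ereal_sup => _ [k _ <-]; rewrite lee_fin.
  by have /andP[] := aM k.
by move: H1 H2; case: (limn _) => //= y; rewrite !lee_fin => -> ->.
Qed.

(** Lets the number of halvings tend to infinity. *)
Lemma halves_le (x : \bar R) (c M : R) : 0 <= c ->
  (forall n, (x <= (c / 2 ^+ n + M)%:E)%E) -> (x <= M%:E)%E.
Proof.
move=> c0 H; apply/lee_addgt0Pr => e e0.
have ce0 : 0 <= c / e by rewrite divr_ge0// ltW.
have [n nb] : exists n : nat, c / e <= n%:R.
  by exists (Num.bound (c / e)); apply: ltW; exact: archi_boundP.
apply: (le_trans (H n)); rewrite -EFinD lee_fin addrC lerD2l.
have p2 : 0 < (2 : R) ^+ n by rewrite exprn_gt0.
rewrite ler_pdivrMr// -ler_pdivrMl// mulrC; apply: (le_trans nb).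
by rewrite -natrX ler_nat ltnW// ltn_expl.
Qed.

Section fast.
Context d (T : measurableType d) (mu : {measure set T -> \bar R}).
Variables (w : T -> R) (a : nat -> T -> R) (b : R).
Hypotheses (mw : measurable_fun [set: T] w) (w1 : forall z, 1 <= w z).
Hypotheses (ma : forall n, measurable_fun [set: T] (a n)) (b0 : 0 <= b).
Hypothesis ab : forall n, (\int[mu]_z (w z * `|a n.+1 z - a n z|)%:E <= (b / 2 ^+ n)%:E)%E.

(** A limit superior, because it is defined and measurable everywhere and inherits every pointwise
    bound of the sequence, also where the sequence diverges. *)
Definition pointwise_lim (z : T) : R := fine (limn_esup (fun n => (a n z)%:E)).

Lemma measurable_pointwise_lim : measurable_fun [set: T] pointwise_lim.
Proof.
apply: (measurableT_comp (fine_measurable measurableT)).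
by apply: (measurable_fun_limn_esup (f := fun n z => (a n z)%:E)) => n; apply/measurable_EFinP.
Qed.

Let tail (n : nat) (z : T) : \bar R := (\sum_(0 <= k <oo) (w z * `|a (n + k).+1 z - a (n + k)%N z|)%:E)%E.

Let t0 (n : nat) (z : T) : (0 <= (w z * `|a n.+1 z - a n z|)%:E)%E.
Proof. by rewrite lee_fin mulr_ge0// (le_trans ler01). Qed.

Let mt (n : nat) : measurable_fun [set: T] (fun z => (w z * `|a n.+1 z - a n z|)%:E).
Proof.
apply/measurable_EFinP; apply: measurable_funM => //; apply: measurableT_comp => //.
exact: measurable_funB.
Qed.

Let tail_int (n : nat) : (\int[mu]_z tail n z <= (2 * b / 2 ^+ n)%:E)%E.
Proof.
rewrite integral_nneseries//.
apply: lime_le.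
  by apply: is_cvg_nneseries => k _ _; apply: integral_ge0 => z _; exact: t0.
apply: nearW => j; apply: (@le_trans _ _ (\sum_(0 <= k < j) (b / 2 ^+ (n + k))%:E)%E).
  by apply: lee_sum => k _; exact: ab.
by rewrite sumEFin lee_fin geometric_tail.
Qed.

Let mtail (n : nat) : measurable_fun [set: T] (tail n).
Proof. by apply: ge0_emeasurable_sum => // k z _ _; exact: t0. Qed.

Let tail_ge0 (n : nat) (z : T) : (0 <= tail n z)%E.
Proof. by apply: nneseries_ge0 => k _ _; exact: t0. Qed.

Let tail_part (n j : nat) (z : T) :
  ((\sum_(0 <= k < j) w z * `|a (n + k).+1 z - a (n + k)%N z|)%R%:E <= tail n z)%E.
Proof. by rewrite -sumEFin; apply: nneseries_lim_ge => k _ _; exact: t0. Qed.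

(** The series of weighted increments has a finite integral, so that it is finite almost everywhere;
    there the sequence converges, and the tail of the series bounds the distance to its limit. *)
Lemma fast_lim (n : nat) : (\int[mu]_z (w z * `|pointwise_lim z - a n z|)%:E <= (2 * b / 2 ^+ n)%:E)%E.
Proof.
apply: le_trans (tail_int n); apply: ae_ge0_le_integral => //.
- by move=> z _; rewrite lee_fin mulr_ge0// (le_trans ler01).
- apply/measurable_EFinP; apply: measurable_funM => //; apply: measurableT_comp => //.
  by apply: measurable_funB => //; exact: measurable_pointwise_lim.
(* The whole series is integrable, hence finite almost everywhere. *)
have i0 : mu.-integrable [set: T] (tail 0).
  apply/integrableP; split => //.
  under eq_integral do rewrite gee0_abs//.
  by apply: le_lt_trans (tail_int 0) _; rewrite ltry.
have := integrable_ae measurableT i0.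
apply: filterS => z /(_ I) zf _.
have w0 : 0 <= w z by rewrite (le_trans ler01).
have [cz lz] : (a^~ z) n @[n --> \oo] --> limn (a^~ z) /\ pointwise_lim z = limn (a^~ z).
  apply: (@summable_increments_cvg _ (fine (tail 0 z))) => m.
  rewrite -lee_fin fineK//; apply: le_trans (tail_part 0 m z); rewrite lee_fin.
  by apply: ler_sum => k _; rewrite add0n ler_peMl.
rewrite lz; have := tail_part n ^~ z; have := tail_ge0 n z.
case: (tail n z) => [M| |]; last 2 first.
- by move=> *; rewrite leey.
- by [].
by move=> _ H; rewrite lee_fin; apply: dist_lim_le => // j; rewrite -lee_fin; exact: H.
Qed.
End fast.

Lemma int_exp (K t : R) : 0 < K -> 0 <= t ->
  (\int[leb]_(s in `[0%R, t]) (expR (2 * K * s))%:E <= ((2 * K)^-1 * expR (2 * K * t))%:E)%E.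
Proof.
move=> K0 t0.
have D (y : R) : -1 < y -> is_derive y 1 (fun s : R => (2 * K)^-1 * expR (2 * K * s)) (expR (2 * K * y)).
  move=> _.
  have H : is_derive y 1 (fun s : R => (2 * K) * s) (2 * K).
    have H := @is_deriveZ _ _ _ id (2 * K) y 1 1 (is_derive_id _ _).
    by apply: (is_derive_eq H); rewrite /GRing.scale /= mulr1.
  have H2 := @is_derive1_comp R expR (fun s => 2 * K * s) y _ _ (is_derive_expR _) H.
  have H3 := @is_deriveZ _ _ _ _ (2 * K)^-1 _ _ _ H2.
  apply: (is_derive_eq H3); rewrite /GRing.scale /=; field; exact: lt0r_neq0.
have C (y : R) : -1 < y -> {for y, continuous (fun s : R => expR (2 * K * s))}.
  move=> _; apply: (@continuous_comp _ _ _ (fun s => 2 * K * s) expR); last exact: continuous_expR.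
  exact: mulrl_continuous.
rewrite (ftc_half D C)// lee_fin lerBlDr lerDl mulr_ge0 ?expR_ge0// invr_ge0.
by rewrite mulr_ge0// ltW.
Qed.

(** Since [K * int_0^t expR (2 K s)] is at most [expR (2 K t) / 2], the operator [K * int_0^t]
    halves every bound proportional to [expR (2 K t)]. The bound is assumed for almost every time
    only, as the mild formulation gives no more. *)
Lemma halving (K c t : R) (N : R -> \bar R) : 0 < K -> 0 <= c -> 0 <= t ->
  measurable_fun [set: R] N -> (forall s, 0 <= N s)%E ->
  (\forall s \ae leb, (0 <= s)%R -> (N s <= (c * expR (2 * K * s))%:E)%E) ->
  (K%:E * \int[leb]_(s in `[0%R, t]) N s <= (c / 2 * expR (2 * K * t))%:E)%E.
Proof.
move=> K0 c0 t0 mN N0 Nc.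
have me : measurable_fun [set: R] (fun s : R => expR (2 * K * s)).
  by apply: (measurableT_comp (@measurable_expR R)); exact: measurable_funM.
have H : (\int[leb]_(s in `[0%R, t]) N s <= c%:E * ((2 * K)^-1 * expR (2 * K * t))%:E)%E.
  apply: (@le_trans _ _ (\int[leb]_(s in `[0%R, t]) (c%:E * (expR (2 * K * s))%:E))%E).
    apply: ae_ge0_le_integral => //.
    - exact: measurable_funTS.
    - by move=> s _; rewrite -EFinM lee_fin mulr_ge0 ?expR_ge0.
    - apply: measurable_funTS; apply/measurable_EFinP; exact: measurable_funM.
    apply: (@filterS _ _ (ae_filter_ringOfSetsType _) _ _ _ Nc) => s Ns; rewrite /= in_itv/= => /andP[s0 _]; exact: Ns.
  rewrite ge0_integralZl//; last first.
  - by apply: measurable_funTS; apply/measurable_EFinP.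
  by apply: lee_wpmul2l => //; exact: int_exp.
apply: (@le_trans _ _ (K%:E * (c%:E * ((2 * K)^-1 * expR (2 * K * t))%:E))%E).
  by apply: lee_wpmul2l => //; rewrite lee_fin ltW.
rewrite -!EFinM lee_fin le_eqVlt; apply/orP; left; apply/eqP; field; exact: lt0r_neq0.
Qed.
End limits.

(** * Functions along characteristics *)

Section characteristics.
Context {R : realType}.
Local Notation leb := (@lebesgue_measure R).
Local Notation R3 := (R3 R).
Local Notation PS := (R * (R3 * R3))%type.

Lemma measurable_time_along (H : R -> R3 -> R3 -> R) (t : R) (x v : R3) :
  measurable_fun [set: PS] (uc H) -> measurable_fun [set: R] (fun s => H s (x - (t - s) *: v) v).
Proof.
move=> mH; apply: (measurableT_comp mH (g := fun s : R => (s, (x - (t - s) *: v, v)))).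
apply: measurable_fun_pair => //; apply: measurable_fun_pair => //.
apply: measurable_R3B => //; apply: measurable_R3Z => //; exact: measurable_funB.
Qed.

Lemma measurable_Rint_along (H : R -> R3 -> R3 -> R) : measurable_fun [set: PS] (uc H) ->
  measurable_fun [set: PS]
    (uc (fun t x v => \int[leb]_(s in `[0, t]) `|H s (x - (t - s) *: v) v|)).
Proof.
move=> mH; rewrite /uc; under eq_fun do rewrite /Rintegral int_tind.
apply: (@measurable_Rint R _ _ _ _ leb (fun (p : PS) s => tind p.1 s * `|H s (p.2.1 - (p.1 - s) *: p.2.2) p.2.2|)).
apply: measurable_funM; first by apply: measurable_tind => //; exact: measurableT_comp.
apply: measurableT_comp => //; exact: (measurableT_comp mH (@measurable_along R)).
Qed.

Lemma norm_L12_Rint (t B : R) (H : R -> R3 -> R3 -> R) : measurable_fun [set: PS] (uc H) ->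
  (forall (s : R) x v, 0 <= s -> `|H s x v| <= B) ->
  norm_L12 (fun x v => \int[leb]_(s in `[0, t]) `|H s (x - (t - s) *: v) v|)%R =
  (\int[leb]_(s in `[0%R, t]) norm_L12 (H s))%E.
Proof.
move=> mH HB; rewrite -(L12_along t mH); apply: eq_integral => -[x v] _ /=.
have ge0 : 0 <= \int[leb]_(s in `[0, t]) `|H s (x - (t - s) *: v) v| by exact: Rintegral_ge0.
rewrite EFinM (ger0_norm ge0) /Rintegral fineK//.
apply: (@integrable_fin_num _ _ _ leb `[0%R, t] _ (fun s : R => (`|H s (x - (t - s) *: v) v|)%:E)) => //.
apply: (@bounded_integrable _ t B (fun s : R => `|H s (x - (t - s) *: v) v|)).
  by apply: measurableT_comp => //; exact: measurable_time_along.
by move=> s s0 _; rewrite normr_id HB.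
Qed.

Lemma weight_w_ge1 (q : R) (v : R3) : 0 <= q -> 1 <= weight_w q v.
Proof.
move=> q0; rewrite /weight_w; have s0 := sqnorm_ge0 v.
have := @ge0_ler_powR R (q / 2) _ 1 (1 + sqnorm v).
rewrite powR1; apply; rewrite ?nnegrE ?divr_ge0//; lra.
Qed.

(** The weight is constant along characteristics: [x - t v] and [v] are. *)
Lemma weight_W_along (r t s : R) (x v : R3) :
  weight_W r s (x - (t - s) *: v) v = weight_W r t x v.
Proof.
rewrite /weight_W; congr ((1 + sqnorm _ + _) `^ _).
by rewrite -addrA -opprD -scalerDl subrK.
Qed.
End characteristics.

(** * Strong continuity of free transport *)

Section translations.
Context {R : realType}.
Local Notation leb := (@lebesgue_measure R).
Local Notation R3 := (R3 R).
Local Notation PS := (R * (R3 * R3))%type.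

Lemma cvge0_le T (F : set_system T) {FF : Filter F} (x : T -> \bar R) : (forall n, 0 <= x n)%E ->
  (forall e : R, 0 < e -> \forall n \near F, (x n <= e%:E)%E) -> x @ F --> 0%E.
Proof.
move=> x0 xe; have fx : \forall n \near F, x n \is a fin_num.
  apply: filterS (xe 1 ltr01) => n xn; rewrite ge0_fin_numE//.
  by rewrite (le_lt_trans xn)// ltry.
apply/fine_cvgP; split => //; apply/cvgr0Pnorm_le => e e0.
apply: filterS2 fx (xe e e0) => n /= fn xn.
by rewrite ger0_norm ?fine_ge0// -lee_fin fineK.
Qed.

Lemma cvge0_near T (F : set_system T) {FF : Filter F} (x : T -> \bar R) : x @ F --> 0%E ->
  forall e : R, 0 < e -> \forall n \near F, (x n <= e%:E)%E.
Proof.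
move=> /fine_cvgP[fx /cvgr0Pnorm_le xe] e e0.
apply: filterS2 fx (xe e e0) => n /= fn xn.
by rewrite -(fineK fn) lee_fin (le_trans (ler_norm _)).
Qed.

Lemma integral_shift_window (h : R -> \bar R) (u : R) : measurable_fun [set: R] h -> (forall s, 0 <= h s)%E ->
  `|u| <= 1 -> (\int[leb]_(s in `[1%R, 2%R]) h (s - u)%R <= \int[leb]_(s in `[0%R, 3%R]) h s)%E.
Proof.
move=> mh h0 u1.
pose k (s : R) : \bar R := ((tind 3 s)%:E * h s)%E.
have k0 s : (0 <= k s)%E by rewrite mule_ge0// lee_fin tind_ge0.
have mk : measurable_fun [set: R] k.
  by apply: emeasurable_funM => //; apply/measurable_EFinP; exact: measurable_tind.
rewrite [X in (_ <= X)%E]int_tind -[X in (_ <= X)%E](leb_translate u mk k0).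
have mks : measurable_fun [set: R] (fun s => k (s - u)).
  by apply: (measurableT_comp mk (g := fun s : R => s - u)); exact: measurable_funB.
apply: (@le_trans _ _ (\int[leb]_(s in `[1%R, 2%R]) k (s - u)%R)%E).
  apply: ge0_le_integral => //.
  - by apply: measurable_funTS; apply: (measurableT_comp mh (g := fun s : R => s - u)); exact: measurable_funB.
  - exact: measurable_funTS.
  move=> s; rewrite /= in_itv/= => /andP[s1 s2]; rewrite /k /tind.
  move: u1; rewrite ler_norml => /andP[ua ub].
  have -> : (0 <= s - u) && (s - u <= 3) by apply/andP; split; move: s1 s2 ua ub; lra.
  by rewrite mul1e.
by apply: ge0_subset_integral.
Qed.

Section window.
Variables (k : R -> R) (u : nat -> R).
Hypotheses (mk : measurable_fun [set: R] k) (ik : leb.-integrable `[0%R, 3%R] (EFin \o k)).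
Hypotheses (u1 : forall n, `|u n| <= 1) (u0 : u @ \oo --> 0).

Lemma window_continuous (g : R -> R) : continuous g ->
  (\int[leb]_(s in `[1%R, 2%R]) (`|g (s - u n)%R - g s|)%:E)%E @[n --> \oo] --> 0%E.
Proof.
move=> cg.
have cn : continuous (fun s => `|g s|) by move=> s; apply: cvg_norm; exact: cg.
have [c _ gc] : exists2 c : R, c \in `[0, 3] & forall t : R, t \in `[0, 3] -> `|g t| <= `|g c|.
  by apply: EVT_max => //; exact: continuous_subspaceT.
have mg : measurable_fun [set: R] g by exact: continuous_measurable_fun.
have -> : 0%E = (\int[leb]_(s in `[1%R, 2%R]) (cst 0%E s : \bar R))%E by rewrite integral_cst// mul0e.
apply: (@dominated_cvg _ _ _ leb _ _ _ _ (fun=> (2 * `|g c|)%:E)) => //.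
- move=> n; apply: measurable_funTS; apply/measurable_EFinP; apply: measurableT_comp => //.
  apply: measurable_funB => //; apply: (measurableT_comp mg (g := fun s : R => s - u n)); exact: measurable_funB.
- move=> s _; apply: cvg_EFin; first exact: nearW.
  have -> : 0 = `|g s - g s| by rewrite subrr normr0.
  apply: cvg_norm; apply: cvgB; last exact: cvg_cst.
  have H : (fun n => (s : R) - u n) @ \oo --> (s : R).
    by rewrite -[X in _ --> X](subr0 (s : R)); apply: cvgB => //; exact: cvg_cst.
  exact: (cvg_comp _ _ H (cg s)).
- have := @bounded_integrable R 2 (2 * `|g c|) (fun=> 2 * `|g c|).
  move=> H; apply: (@integrableS _ _ _ leb `[0%R, 2%R]) => //.
    by move=> s; rewrite /= !in_itv/= => /andP[a ->]; rewrite (le_trans _ a).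
  by apply: H => // s _ _; rewrite ger0_norm// mulr_ge0.
move=> n s; rewrite /= in_itv/= => /andP[s1 s2]; rewrite lee_fin normr_id.
have := u1 n; rewrite ler_norml => /andP[ua ub].
apply: (le_trans (ler_normB _ _)); rewrite mulrDl mul1r lerD// gc// in_itv/=; apply/andP; split; move: ua ub s1 s2; lra.
Qed.

(** Continuity of translations in [L^1], by approximation with continuous functions. Shifts of size
    at most 1 map [1, 2] into [0, 3]. *)
Lemma window_translate :
  (\int[leb]_(s in `[1%R, 2%R]) (`|k (s - u n)%R - k s|)%:E)%E @[n --> \oo] --> 0%E.
Proof.
apply: cvge0_le; first by move=> n; exact: integral_ge0.
move=> e e0.
have f3 : (leb `[0%R, 3%R]%classic < +oo)%E.
  by rewrite /= lebesgue_measure_itv; case: ifP => // _; rewrite -EFinD ltry.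
have [g_ [cg ig gk]] := approximation_continuous_integrable (measurable_itv _) f3 ik.
have e3 : 0 < e / 3 by rewrite divr_gt0.
have [N _ /(_ N (leqnn N)) gN] := cvge0_near gk e3.
have {cg ig} [cg ig] := (cg N, ig N).
have mg : measurable_fun [set: R] (g_ N) by exact: continuous_measurable_fun.
move: (g_ N) mg gN cg ig => g mg gN cg ig.
apply: filterS (cvge0_near (window_continuous cg) e3) => n gn.
have mkg : measurable_fun [set: R] (fun s => (`|k s - g s|)%:E).
  by apply/measurable_EFinP; apply: measurableT_comp => //; exact: measurable_funB.
have msh (h : R -> R) : measurable_fun [set: R] h -> measurable_fun [set: R] (fun s => h (s - u n)).
  by move=> mh; apply: (measurableT_comp mh (g := fun s : R => s - u n)); exact: measurable_funB.
have A1 : (\int[leb]_(s in `[1%R, 2%R]) (`|k (s - u n)%R - g (s - u n)%R|)%:E <= (e / 3)%:E)%E.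
  exact: le_trans (integral_shift_window mkg (fun=> ltac:(by rewrite lee_fin)) (u1 n)) gN.
have A3 : (\int[leb]_(s in `[1%R, 2%R]) (`|k s - g s|)%:E <= (e / 3)%:E)%E.
  have z1 : `|0 : R| <= 1 by rewrite normr0.
  have := integral_shift_window mkg (fun=> ltac:(by rewrite lee_fin)) z1.
  under eq_integral do rewrite subr0.
  by move=> H; exact: le_trans H gN.
have -> : e%:E = ((e / 3)%:E + ((e / 3)%:E + (e / 3)%:E))%E by rewrite -!EFinD; congr EFin; field.
apply: le_trans (leeD A1 (leeD gn A3)).
have m1 : measurable_fun [set: R] (fun s => (`|k (s - u n) - g (s - u n)|)%:E).
  by apply/measurable_EFinP; apply: measurableT_comp => //; apply: measurable_funB; exact: msh.
have m2 : measurable_fun [set: R] (fun s => (`|g (s - u n) - g s|)%:E).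
  by apply/measurable_EFinP; apply: measurableT_comp => //; apply: measurable_funB => //; exact: msh.
rewrite -ge0_integralD//; [|exact: measurable_funTS|exact: measurable_funTS].
rewrite -ge0_integralD//; [|exact: measurable_funTS| |].
- apply: ge0_le_integral => //.
  + apply: measurable_funTS; apply/measurable_EFinP; apply: measurableT_comp => //.
    by apply: measurable_funB => //; exact: msh.
  + by apply: measurable_funTS; do ![apply: emeasurable_funD => //].
  move=> s _; rewrite -!EFinD lee_fin.
  have -> : k (s - u n) - k s = (k (s - u n) - g (s - u n)) + ((g (s - u n) - g s) - (k s - g s)) by ring.
  by apply: (le_trans (ler_normD _ _)); rewrite lerD2l; exact: ler_normB.
- by move=> s _; rewrite -EFinD lee_fin addr_ge0.
- by apply: measurable_funTS; apply: emeasurable_funD.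
Qed.
End window.
End translations.

Section free_transport.
Context {R : realType}.
Local Notation leb := (@lebesgue_measure R).
Local Notation R3 := (R3 R).
Local Notation PS := (R * (R3 * R3))%type.

Section transport.
Variable h : R3 -> R3 -> R.
Hypotheses (mh : mR6 h) (fh : (norm_L12 h < +oo)%E).

Let kap (z : R3 * R3) (s : R) : R := h (z.1 - (3 - s) *: z.2) z.2.

Let mkap2 : measurable_fun [set: (R3 * R3) * R] (fun w => kap w.1 w.2).
Proof.
apply: (measurableT_comp mh (g := fun w : (R3 * R3) * R => (w.1.1 - (3 - w.2) *: w.1.2, w.1.2))).
apply: measurable_fun_pair; last exact: measurableT_comp.
apply: measurable_R3B; first exact: measurableT_comp.
apply: (measurable_R3Z (a := fun w : (R3 * R3) * R => 3 - w.2)); first exact: measurableT_comp.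
exact: measurable_funB.
Qed.

Let mkap z : measurable_fun [set: R] (kap z).
Proof. by apply: (measurableT_comp mkap2 (g := fun s : R => (z, s))); exact: measurable_fun_pair. Qed.

Let win (s : R) : R := tind 1 (s - 1).

Let mwin : measurable_fun [set: R] win.
Proof. by apply: measurable_tind => //; exact: measurable_funB. Qed.

Let int_win (k : R -> \bar R) : (\int[leb]_(s in `[1%R, 2%R]) k s = \int[leb]_s ((win s)%:E * k s))%E.
Proof.
rewrite integral_mkcond; apply: eq_integral => s _; rewrite patchE mem_setE in_itv /= /win /tind.
have -> : (0 <= s - 1) && (s - 1 <= 1) = (1 <= s <= 2).
  by congr (_ && _); [rewrite subr_ge0|rewrite lerBlDr -natr1].
by case: ifP => _; rewrite ?mul1e ?mul0e.
Qed.

Let w0 (z : R3 * R3) : (0 <= (1 + sqnorm z.2)%:E)%E.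
Proof. by rewrite lee_fin addr_ge0// sqnorm_ge0. Qed.

Let mw : measurable_fun [set: R3 * R3] (fun z : R3 * R3 => (1 + sqnorm z.2)%:E).
Proof. by apply/measurable_EFinP; apply: measurable_funD => //; exact: measurable_sqnorm. Qed.

Section shift.
Variable u : R.
Hypothesis u1 : `|u| <= 1.

Let J (z : R3 * R3) : \bar R :=
  ((1 + sqnorm z.2)%:E * \int[leb]_(s in `[1%R, 2%R]) (`|kap z (s - u)%R - kap z s|)%:E)%E.

Let mk2 : measurable_fun [set: (R3 * R3) * R] (fun w => (`|kap w.1 (w.2 - u) - kap w.1 w.2|)%:E).
Proof.
apply/measurable_EFinP; apply: measurableT_comp => //; apply: measurable_funB => //.
apply: (measurableT_comp mkap2 (g := fun w : (R3 * R3) * R => (w.1, w.2 - u))).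
by apply: measurable_fun_pair => //; exact: measurable_funB.
Qed.

Lemma measurable_window : measurable_fun [set: R3 * R3] J.
Proof.
rewrite /J; apply: emeasurable_funM => //; under eq_fun do rewrite int_win.
apply: (@measurable_integral2 _ _ _ _ _ leb (fun z s => ((win s)%:E * (`|kap z (s - u) - kap z s|)%:E)%E)).
  apply: emeasurable_funM => //; apply/measurable_EFinP; exact: (measurableT_comp mwin).
by move=> z s; rewrite mule_ge0// lee_fin tind_ge0.
Qed.

(** The norm of [L^1_2] is invariant under transport, hence equal to its average over the transport
    times [3 - s] with [s] in [1, 2]. After Tonelli the inner integral compares a function of one
    variable with its translate by [u]. *)
Lemma transport_window : norm_L12 (fun x v => h (x - u *: v) v - h x v)%R = (\int[leb6]_z J z)%E.
Proof.
pose H (s : R) (x v : R3) := win s * (h (x - u *: v) v - h x v).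
have mhu : mR6 (fun x v => h (x - u *: v) v).
  by apply: (measurableT_comp mh (g := fun z : R3 * R3 => (z.1 - u *: z.2, z.2))); exact: measurable_shear.
have md : mR6 (fun x v => h (x - u *: v) v - h x v) by exact: mR6B.
have mH : measurable_fun [set: PS] (uc H).
  apply: measurable_funM; first exact: (measurableT_comp mwin).
  exact: (measurableT_comp md).
have := L12_along 3 mH.
have -> : (\int[leb]_(s in `[0%R, 3%R]) norm_L12 (H s) = norm_L12 (fun x v => h (x - u *: v) v - h x v)%R)%E.
  transitivity (\int[leb]_(s in `[0%R, 3%R]) ((win s)%:E * norm_L12 (fun x v => h (x - u *: v) v - h x v)%R))%E.
    by apply: eq_integral => s _; rewrite norm_L12Z// tind_ge0.
  transitivity (\int[leb]_(s in `[1%R, 2%R]) (cst (norm_L12 (fun x v => h (x - u *: v) v - h x v)%R) s))%E.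
    rewrite int_win int_tind; apply: eq_integral => s _; rewrite muleA; congr (_ * _)%E.
    rewrite -EFinM; congr EFin; rewrite /win /tind.
    case: (boolP ((0 <= s - 1) && (s - 1 <= 1))) => [/andP[a b]|]; rewrite ?mulr0//.
    have -> : (0 <= s) && (s <= 3) by apply/andP; split; move: a b; lra.
    by rewrite mulr1.
  rewrite integral_cst//= lebesgue_measure_itv/= lte_fin ltr1n/= -EFinD.
  by have -> : (2 - 1 : R) = 1 by [ring]; rewrite mule1.
move=> <-; apply: eq_integral => z _; congr (_ * _)%E.
rewrite int_win int_tind; apply: eq_integral => s _.
rewrite /H normrM (ger0_norm (tind_ge0 _ _)) EFinM muleA; congr (_ * _)%E.
  rewrite -EFinM; congr EFin; rewrite /win /tind.
  case: (boolP ((0 <= s - 1) && (s - 1 <= 1))) => [/andP[a b]|]; rewrite ?mulr0//.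
  have -> : (0 <= s) && (s <= 3) by apply/andP; split; move: a b; lra.
  by rewrite mulr1.
congr (`| h _ _ - _|%:E).
by rewrite -addrA -opprD -scalerDl; congr (_ - _ *: _); ring.
Qed.

(** The dominating function for the limit over phase space. *)
Lemma window_dominated (z : R3 * R3) :
  (J z <= (2%:E * ((1 + sqnorm z.2)%:E * \int[leb]_(s in `[0%R, 3%R]) (`|kap z s|)%:E)))%E.
Proof.
have ma : measurable_fun [set: R] (fun s => (`|kap z s|)%:E).
  by apply/measurable_EFinP; apply: measurableT_comp => //; exact: mkap.
have a0 s : (0 <= (`|kap z s|)%:E)%E by rewrite lee_fin.
rewrite muleCA; apply: lee_wpmul2l => //.
have msh : measurable_fun [set: R] (fun s => kap z (s - u)).
  by apply: (measurableT_comp (mkap z) (g := fun s : R => s - u)); exact: measurable_funB.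
have mash : measurable_fun [set: R] (fun s => (`|kap z (s - u)|)%:E).
  by apply/measurable_EFinP; apply: measurableT_comp.
have z1 : `|0 : R| <= 1 by rewrite normr0.
have A := integral_shift_window ma a0 u1.
have B : (\int[leb]_(s in `[1%R, 2%R]) (`|kap z s|)%:E <= \int[leb]_(s in `[0%R, 3%R]) (`|kap z s|)%:E)%E.
  apply: le_trans (integral_shift_window ma a0 z1); rewrite le_eqVlt; apply/orP; left; apply/eqP.
  by apply: eq_integral => s _; rewrite subr0.
have -> : (2%:E * \int[leb]_(s in `[0%R, 3%R]) (`|kap z s|)%:E =
  \int[leb]_(s in `[0%R, 3%R]) (`|kap z s|)%:E + \int[leb]_(s in `[0%R, 3%R]) (`|kap z s|)%:E)%E.
  rewrite -[2]/(1 + 1)%R EFinD ge0_muleDl ?lee_fin// !mul1e//.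
apply: le_trans (leeD A B).
rewrite -ge0_integralD//; [|exact: measurable_funTS|exact: measurable_funTS].
apply: ge0_le_integral => //.
- apply: measurable_funTS; apply/measurable_EFinP; apply: measurableT_comp => //.
  by apply: measurable_funB => //; exact: mkap.
- by apply: measurable_funTS; apply: emeasurable_funD.
by move=> s _; rewrite -EFinD lee_fin ler_normB.
Qed.
End shift.

(** Dominated convergence on phase space: along almost every characteristic the datum is integrable
    over [0, 3], and translations are continuous in [L^1]. *)
Lemma transport_continuous (u : nat -> R) : (forall n, `|u n| <= 1) -> u @ \oo --> 0 ->
  norm_L12 (fun x v => h (x - u n *: v) v - h x v)%R @[n --> \oo] --> 0%E.
Proof.
move=> u1 u0; under eq_fun do rewrite transport_window.
pose G (z : R3 * R3) : \bar R := (2%:E * ((1 + sqnorm z.2)%:E * \int[leb]_(s in `[0%R, 3%R]) (`|kap z s|)%:E))%E.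
have i0 z : (0 <= \int[leb]_(s in `[0%R, 3%R]) (`|kap z s|)%:E)%E by apply: integral_ge0.
have mI : measurable_fun [set: R3 * R3] (fun z => (1 + sqnorm z.2)%:E * \int[leb]_(s in `[0%R, 3%R]) (`|kap z s|)%:E)%E.
  apply: emeasurable_funM => //; under eq_fun do rewrite int_tind.
  apply: (@measurable_integral2 _ _ _ _ _ leb (fun z s => ((tind 3 s)%:E * (`|kap z s|)%:E)%E)).
    apply: emeasurable_funM; first by apply/measurable_EFinP; exact: measurable_tind.
    by apply/measurable_EFinP; exact: measurableT_comp.
  by move=> z s; rewrite mule_ge0// lee_fin tind_ge0.
have G0 z : (0 <= G z)%E by rewrite !mule_ge0.
have mG : measurable_fun [set: R3 * R3] G by apply: emeasurable_funM.
have iG : leb6.-integrable [set: R3 * R3] G.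
  apply/integrableP; split => //; under eq_integral do rewrite gee0_abs//.
  rewrite /G ge0_integralZl//; last by move=> z _; rewrite mule_ge0.
  have mH : measurable_fun [set: PS] (uc (fun _ : R => h)) by exact: (measurableT_comp mh).
  have -> : (\int[leb6]_x ((1 + sqnorm x.2)%:E * \int[leb]_(s in `[0%R, 3%R]) (`|kap x s|)%:E) = norm_L12 h * 3%:E)%E.
    rewrite (L12_along 3 mH) integral_cst//; congr (_ * _)%E.
    by rewrite /= lebesgue_measure_itv/= lte_fin ltr0n/= -EFinD subr0.
  have fn : norm_L12 h \is a fin_num by rewrite ge0_fin_numE// norm_L12_ge0.
  by rewrite -(fineK fn) -!EFinM ltry.
have := @dominated_convergence _ _ _ leb6 setT measurableT (fun n z => _) (cst 0%E) G
  (fun n => measurable_window (u n)) (@measurable_cst _ _ _ _ _ _) _ iG.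
case.
- have := integrable_ae measurableT iG; apply: filterS => z /(_ I) Gz _.
  have ik : leb.-integrable `[0%R, 3%R] (EFin \o kap z).
    apply/integrableP; split; first by apply: measurable_funTS; apply/measurable_EFinP; exact: mkap.
    have wz : (0 < (1 + sqnorm z.2)%:E)%E by rewrite lte_fin ltr_wpDr// sqnorm_ge0.
    rewrite ltey; apply/negP => /eqP E.
    by move: Gz; rewrite /G E gt0_muley// gt0_muley// lte_fin.
  have := window_translate (mkap z) ik u1 u0.
  move=> H; have fw : (1 + sqnorm z.2)%:E \is a fin_num by [].
  by have := cvgeZl fw H; rewrite mule0.
- apply: aeW => z n _; rewrite gee0_abs; first exact: window_dominated.
  by rewrite mule_ge0// integral_ge0.
by move=> _ _; rewrite integral_cst// mul0e; exact.
Qed.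

Lemma transport_cvg0 : norm_L12 (fun x v => h (x - t *: v) v - h x v)%R @[t --> (0 : R)] --> 0%E.
Proof.
(* Truncates the transport time to [- 1, 1], where the statement for sequences applies. *)
pose c (t : R) : R := if `|t| <= 1 then t else 0.
have c1 t : `|c t| <= 1 by rewrite /c; case: ifP => // _; rewrite normr0.
have ct t : `|c t| <= `|t| by rewrite /c; case: ifP => // _; rewrite normr0.
have c0 (u : nat -> R) : u @ \oo --> 0 -> (c \o u) @ \oo --> 0.
  move=> /cvgr0Pnorm_le u0; apply/cvgr0Pnorm_le => e e0; apply: filterS (u0 e e0) => n un.
  exact: le_trans (ct _) un.
have H : (fine \o (fun t => norm_L12 (fun x v => h (x - c t *: v) v - h x v)%R)) t @[t --> (0 : R)] --> (0 : R).
  apply/(@cvg_nbhsP _ R^o) => u u0.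
  have := transport_continuous (u := c \o u) (fun n => c1 (u n)) (c0 u u0).
  by move=> /fine_cvgP[].
apply: cvge0_le => [t|e e0]; first exact: norm_L12_ge0.
have := (cvgr0Pnorm_le _).1 H e e0 => He.
have near1 : \forall t \near (0 : R), `|t| <= 1.
  exact: nbhs0_le.
apply: filterS2 near1 (He _) => t t1 /=; rewrite /c t1 => tb.
have fn : norm_L12 (fun x v => h (x - t *: v) v - h x v)%R \is a fin_num.
  rewrite ge0_fin_numE ?norm_L12_ge0//.
  have mhu : mR6 (fun x v => h (x - t *: v) v).
    by apply: (measurableT_comp mh (g := fun z : R3 * R3 => (z.1 - t *: z.2, z.2))); exact: measurable_shear.
  apply: le_lt_trans (norm_L12D (mR6B mhu mh) mhu mh _) _; first by move=> x v; exact: ler_normB.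
  apply: lte_add_pinfty => //.
  by rewrite /norm_L12 (leb6_shear t (K := fun z => ((1 + sqnorm z.2) * `|h z.1 z.2|)%:E))//; [exact: measurable_energy|exact: energy_ge0].
by rewrite -(fineK fn) lee_fin (le_trans (ler_norm _)).
Qed.
End transport.
End free_transport.

Section transport_steps.
Context {R : realType}.
Local Notation leb := (@lebesgue_measure R).
Local Notation R3 := (R3 R).
Local Notation PS := (R * (R3 * R3))%type.

Section steps.
Variables (F : R -> R3 -> R3 -> R) (C : R).
Hypotheses (mF : measurable_fun [set: PS] (uc F)) (fF : forall t : R, 0 <= t -> (norm_L12 (F t) < +oo)%E).
Hypothesis (step : forall a b : R, 0 <= a -> a <= b ->
  (norm_L12 (fun x v => F b x v - F a (x - (b - a) *: v) v)%R <= (C * (b - a))%:E)%E).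

Let mFs (a u : R) : mR6 (fun x v => F a (x - u *: v) v).
Proof.
by apply: (measurableT_comp (uc_slice a mF) (g := fun z : R3 * R3 => (z.1 - u *: z.2, z.2))); exact: measurable_shear.
Qed.

Let mFa (a : R) := uc_slice a mF.

(** Both orders of [t] and [t0] lead to the same bound, as the shear preserves the norm. *)
Lemma steps_diff (t0 t : R) : 0 <= t0 -> 0 <= t ->
  (norm_L12 (fun x v => F t x v - F t0 x v)%R <=
   (C * `|t - t0|)%:E + norm_L12 (fun x v => F t0 (x - `|t - t0| *: v) v - F t0 x v)%R)%E.
Proof.
move=> t00 tt.
case: (leP t0 t) => [le|lt].
  rewrite ger0_norm ?subr_ge0//; apply: le_trans (leeD (step t00 le) (lexx _)).
  by apply: norm_L12D; [exact: mR6B|exact: mR6B|exact: mR6B|] => x v; exact: ler_distD.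
rewrite distrC ger0_norm ?subr_ge0 ?(ltW lt)//.
apply: le_trans (leeD (step tt (ltW lt)) (lexx _)).
have -> : norm_L12 (fun x v => F t x v - F t0 x v)%R =
  norm_L12 (fun x v => F t (x - (t0 - t) *: v) v - F t0 (x - (t0 - t) *: v) v)%R.
  rewrite /norm_L12 -[LHS](leb6_shear (t0 - t))//.
    by apply: (measurable_energy (h := fun x v => F t x v - F t0 x v)); exact: mR6B.
  by move=> z; exact: (energy_ge0 (fun x v => F t x v - F t0 x v)).
apply: norm_L12D; [exact: mR6B|exact: mR6B|exact: mR6B|] => x v.
apply: (le_trans (ler_distD (F t0 x v) _ _)).
by rewrite (distrC (F t _ _)) lerD2l distrC.
Qed.

(** A curve that follows free transport up to a Lipschitz error is continuous, because free
    transport is. *)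
Lemma continuous_L12_of_steps : continuous_L12 F.
Proof.
split.
- by apply: measurable_funTS; exact: mF.
- by move=> t tt; split; [exact: mFa|exact: fF].
move=> t0 t00.
apply: (@squeeze_cvge _ _ _ _ (fun=> 0%E) _ (fun t => (C * `|t - t0|)%:E +
   norm_L12 (fun x v => F t0 (x - `|t - t0| *: v) v - F t0 x v)%R)%E).
- by rewrite near_withinE; apply: nearW => t tt; rewrite norm_L12_ge0/= steps_diff.
- exact: cvg_cst.
apply: cvg_within_filter.
have ct : `|t - t0| @[t --> t0] --> (0 : R).
  have -> : (0 : R) = `|t0 - t0| by rewrite subrr normr0.
  by apply: cvg_norm; apply: cvgB; [exact: cvg_id|exact: cvg_cst].
have A : (C * `|t - t0|)%:E @[t --> t0] --> 0%E.
  have := @cvgM _ _ _ _ (fun=> C) (fun t => `|t - t0|) _ _ (cvg_cst C) ct.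
  by rewrite mulr0 => H; apply: cvg_EFin; [exact: nearW|exact: H].
have B := cvg_comp _ _ ct (transport_cvg0 (mFa t0) (fF t00)).
have d0 : ((0 : \bar R) +? 0)%E by [].
have H := cvgeD d0 A B; rewrite adde0 in H; exact: H.
Qed.
End steps.
End transport_steps.

(** * Uniqueness *)

Section uniqueness_part.
Context {R : realType}.
Local Notation leb := (@lebesgue_measure R).
Local Notation R3 := (R3 R).
Local Notation PS := (R * (R3 * R3))%type.

(** Fubini for null sets. *)
Lemma ae_slices (P : set PS) : (\forall z \ae leb_txv, P z) ->
  \forall t \ae leb, \forall z \ae leb6, P (t, z).
Proof.
move=> [A [mA A0 PA]].
have mx : measurable_fun [set: R] (leb6 \o xsection A) by exact: measurable_fun_xsection.
have IE : (\int[leb]_t `|(leb6 \o xsection A) t| = 0)%E.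
  by rewrite -A0; apply: eq_integral => t _; rewrite gee0_abs.
have := (ae_eq_integral_abs leb measurableT mx).1 IE.
move=> ae; apply: (@filterS _ _ (ae_filter_ringOfSetsType leb) _ _ _ ae) => t /= /(_ I) At.
exists (xsection A t); split; [exact: measurable_xsection|exact: At|].
by move=> z Pz; rewrite /xsection /= inE; exact: PA.
Qed.

Lemma ae_meets_right (P : set R) (t d : R) : (\forall s \ae leb, P s) -> 0 < d ->
  exists s, [/\ t < s, s < t + d & P s].
Proof.
move=> [A [mA A0 PA]] d0; apply: contrapT => H.
have sub : `]t, (t + d)[%classic `<=` A.
  move=> s; rewrite /= in_itv/= => /andP[ts std]; apply: PA => Ps; apply: H; by exists s.
have LE := le_measure leb (mem_set (measurable_itv _)) (mem_set mA) sub.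
have : (leb `]t, (t + d)%R[%classic <= 0)%E.
  by apply: (le_trans LE); rewrite le_eqVlt; apply/orP; left; apply/eqP; exact: A0.
rewrite /= lebesgue_measure_itv /= lte_fin ltrDl d0 -EFinD addrAC subrr add0r lee_fin.
by rewrite leNgt d0.
Qed.

Lemma norm_L12_eq0 (h k : R3 -> R3 -> R) : mR6 h -> mR6 k ->
  norm_L12 (fun x v => h x v - k x v)%R = 0%E -> eq_L12 h k.
Proof.
move=> mh mk n0.
have me := measurable_energy (mR6B mh mk).
have IE : (\int[leb6]_z `|((1 + sqnorm z.2) * `|h z.1 z.2 - k z.1 z.2|)%:E| = 0)%E.
  by rewrite -n0; apply: eq_integral => z _; rewrite gee0_abs//; exact: (energy_ge0 (fun x v => h x v - k x v)).
have := (ae_eq_integral_abs leb6 measurableT me).1 IE.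
move=> ae; apply: (@filterS _ _ (ae_filter_ringOfSetsType leb6) _ _ _ ae) => z /= /(_ I) [] /eqP.
rewrite mulf_eq0 normr_eq0 subr_eq0 => /orP[|/eqP//].
by rewrite gt_eqF// ltr_wpDr ?sqnorm_ge0.
Qed.

Section uniqueness.
Variables (q al be M : R) (f0 : R3 -> R3 -> R).
Hypotheses (q5 : 5 < q) (al0 : 0 < al) (al1 : al <= 1) (be0 : 0 <= be) (be1 : be <= 1).
Hypotheses (hab : 2 <= 3 * al + 2 * be) (hq : 2 * (1 + be) <= al * (q - 3)).
Hypothesis M0 : 0 <= M.

(** Negative times are set to zero, where a solution need not be measurable. *)
Definition cut (f : R -> R3 -> R3 -> R) (t : R) (x v : R3) : R := if 0 <= t then f t x v else 0.

Lemma cutE f (t : R) : 0 <= t -> cut f t = f t.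
Proof. by move=> t0; apply/funext => x; apply/funext => v; rewrite /cut t0. Qed.

Lemma measurable_cut f : continuous_L12 f -> measurable_fun [set: PS] (uc (cut f)).
Proof.
move=> [mf _ _]; apply: measurable_fun_if => //.
  by apply: measurable_fun_ler => //; exact: measurable_cst.
rewrite setTI; have -> : ((fun z : PS => 0 <= z.1) @^-1` [set true]) = [set z : PS | 0 <= z.1].
  by apply/seteqP; split => z.
exact: mf.
Qed.

Section two.
Variables f g : R -> R3 -> R3 -> R.
Hypotheses (sf : mild_solution al be f0 f) (sg : mild_solution al be f0 g).
Hypotheses (cf : forall (t : R) x, 0 <= t -> dclass q 1 (f t x)) (cg : forall (t : R) x, 0 <= t -> dclass q 1 (g t x)).
Hypotheses (Mf : forall t : R, 0 <= t -> (norm_L12 (f t) <= M%:E)%E) (Mg : forall t : R, 0 <= t -> (norm_L12 (g t) <= M%:E)%E).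

Let F := cut f.
Let G := cut g.
Let mF : measurable_fun [set: PS] (uc F). Proof. by apply: measurable_cut; case: sf. Qed.
Let mG : measurable_fun [set: PS] (uc G). Proof. by apply: measurable_cut; case: sg. Qed.

Definition ucollF (s : R) (x v : R3) : R := coll al be (F s x) v - coll al be (G s x) v.

Let mC : measurable_fun [set: PS] (uc ucollF).
Proof. by apply: measurable_funB; apply: measurable_coll_uc. Qed.

Let D (t : R) : \bar R := norm_L12 (fun x v => F t x v - G t x v)%R.

Let mD : measurable_fun [set: R] D.
Proof. by apply: measurable_norm_L12; exact: measurable_funB. Qed.

Let D0 t : (0 <= D t)%E. Proof. exact: norm_L12_ge0. Qed.

Let DM (t : R) : 0 <= t -> (D t <= (2 * M)%:E)%E.
Proof.
move=> t0; have -> : (2 * M)%:E = (M%:E + M%:E)%E by rewrite -EFinD; congr EFin; ring.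
apply: le_trans (leeD (Mf t0) (Mg t0)); rewrite /D /F /G !cutE//.
have mf := uc_slice t mF; have mg := uc_slice t mG; rewrite /F /G !cutE// in mf mg.
by apply: norm_L12D => //; [exact: mR6B|move=> x v; exact: ler_normB].
Qed.

(** The difference of the two mild formulations, integrated over phase space: the transported data
    cancel, the Lipschitz estimate bounds the collision terms. *)
Let Dstep : \forall t \ae leb, (0 <= t)%R -> (D t <= (Klip q)%:E * \int[leb]_(s in `[0%R, t]) D s)%E.
Proof.
have ae2 := @filterS2 _ _ (ae_filter_ringOfSetsType leb_txv) _ _ _ (fun _ a b => conj a b) sf.2 sg.2.
have := ae_slices ae2.
move=> ae; apply: (@filterS _ _ (ae_filter_ringOfSetsType leb) _ _ _ ae) => t aez t0.
have mCt := uc_slice t mC.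
apply: (@le_trans _ _ (\int[leb]_(s in `[0%R, t]) norm_L12 (ucollF s))%E).
  rewrite -(L12_along t mC) /D; apply: (@ae_ge0_le_integral _ _ _ leb6 _ measurableT).
  - by move=> z _; exact: (energy_ge0 (fun x v => F t x v - G t x v)).
  - apply: (measurable_energy (h := fun x v => F t x v - G t x v)).
    exact: (mR6B (uc_slice t mF) (uc_slice t mG)).
  - move=> z _; apply: mule_ge0; first by rewrite lee_fin addr_ge0// sqnorm_ge0.
    exact: integral_ge0.
  - apply: emeasurable_funM.
      by apply/measurable_EFinP; apply: measurable_funD => //; exact: measurable_sqnorm.
    under eq_fun do rewrite int_tind.
    apply: (@measurable_integral2 _ _ _ _ _ leb (fun (z : R3 * R3) s => ((tind t s)%:E * (`|ucollF s (z.1 - (t - s) *: z.2)%R z.2|)%:E)%E)).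
      apply: emeasurable_funM; apply/measurable_EFinP; first exact: measurable_tind.
      apply: measurableT_comp => //.
      apply: (measurableT_comp mC (g := fun w : (R3 * R3) * R => (w.2, (w.1.1 - (t - w.2) *: w.1.2, w.1.2)))).
      apply: measurable_fun_pair => //; apply: measurable_fun_pair; last exact: measurableT_comp.
      apply: measurable_R3B; first exact: measurableT_comp.
      apply: (measurable_R3Z (a := fun w : (R3 * R3) * R => t - w.2)); first exact: measurableT_comp.
      exact: measurable_funB.
    by move=> z s; rewrite mule_ge0// lee_fin tind_ge0.
  apply: (@filterS _ _ (ae_filter_ringOfSetsType leb6) _ _ _ aez) => -[x v] /= [Hf Hg] _.
  have [iF eF] := Hf t0; have [iG eG] := Hg t0.
  rewrite EFinM; apply: lee_wpmul2l; first by rewrite lee_fin addr_ge0// sqnorm_ge0.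
  rewrite /F /G !cutE// eF eG opprD addrACA subrr add0r -RintegralB//.
  have iD := integrableB _ iF iG; have {}iD := iD (measurable_itv _).
  rewrite EFin_normr_Rintegral//.
  apply: (le_trans (le_abse_integral _ _ _)) => //; first exact: (measurable_int _ iD).
  rewrite le_eqVlt; apply/orP; left; apply/eqP; apply: eq_integral => s.
  by rewrite inE /= in_itv/= => /andP[s0 _]; rewrite /ucollF /F /G !cutE.
rewrite -(@ge0_integralZl _ _ _ leb _ (measurable_itv _)); last 3 first.
- exact: measurable_funTS.
- by move=> s _; exact: D0.
- by rewrite lee_fin Klip_ge0.
apply: (@ge0_le_integral _ _ _ leb _ (measurable_itv _)).
- by move=> s _; exact: norm_L12_ge0.
- by apply: measurable_funTS; exact: measurable_norm_L12 mC.
- by apply: emeasurable_funM; [exact: measurable_cst|exact: measurable_funTS].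
move=> s; rewrite /= in_itv/= => /andP[s0 _].
have ms := uc_slice s mF; have ns := uc_slice s mG.
rewrite /D /ucollF /F /G !cutE//; rewrite /F /G !cutE// in ms ns.
by apply: norm_L12_coll => // x; [exact: cf|exact: cg].
Qed.

Let K : R := Klip q + 1.
Let K0 : 0 < K. Proof. by rewrite ltr_wpDl// Klip_ge0. Qed.

Let DstepK : \forall t \ae leb, (0 <= t)%R -> (D t <= K%:E * \int[leb]_(s in `[0%R, t]) D s)%E.
Proof.
apply: (@filterS _ _ (ae_filter_ringOfSetsType leb) _ _ _ Dstep) => t Ht t0.
apply: (le_trans (Ht t0)); apply: lee_wpmul2r; first exact: integral_ge0.
by rewrite lee_fin lerDl.
Qed.

(** Each use of the integral inequality halves the constant. *)
Let Dhalf (n : nat) (t : R) : 0 <= t ->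
  (K%:E * \int[leb]_(s in `[0%R, t]) D s <= (2 * M / 2 ^+ n.+1 * expR (2 * K * t))%:E)%E.
Proof.
elim: n t => [|n IH] t t0.
  rewrite expr1; apply: halving => //; first by rewrite mulr_ge0.
  apply: aeW => s s0; apply: (le_trans (DM s0)); rewrite lee_fin ler_peMr ?mulr_ge0//.
  have := @expR_ge1Dx R (2 * K * s); apply: le_trans; rewrite lerDl mulr_ge0// mulr_ge0//; exact: ltW.
have -> : 2 * M / 2 ^+ n.+2 = 2 * M / 2 ^+ n.+1 / 2 by rewrite (exprS _ n.+1); field; exact: expf_neq0.
apply: halving => //; first by rewrite divr_ge0 ?mulr_ge0 ?exprn_ge0.
apply: (@filterS _ _ (ae_filter_ringOfSetsType leb) _ _ _ DstepK) => s Hs s0.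
exact: le_trans (Hs s0) (IH s s0).
Qed.

Let Dae : \forall t \ae leb, (0 <= t)%R -> D t = 0%E.
Proof.
apply: (@filterS _ _ (ae_filter_ringOfSetsType leb) _ _ _ DstepK) => t Ht t0.
apply/eqP; rewrite eq_le D0 andbT; apply: (le_trans (Ht t0)).
apply: (@halves_le _ _ (2 * M / 2 * expR (2 * K * t))).
  by rewrite mulr_ge0 ?expR_ge0// divr_ge0// mulr_ge0.
move=> n; apply: (le_trans (Dhalf n t0)); rewrite addr0 lee_fin le_eqVlt; apply/orP; left; apply/eqP.
by rewrite exprS; field; exact: expf_neq0.
Qed.

(** The distance of the solutions vanishes for almost every time, and every time is a limit of such
    times. *)
Lemma mild_solution_unique (t : R) : 0 <= t -> eq_L12 (f t) (g t).
Proof.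
move=> t0.
have [[_ inf cvf] _] := sf; have [[_ ing cvg_] _] := sg.
have mf s : 0 <= s -> mR6 (f s) by move=> s0; have [] := inf s s0.
have mg s : 0 <= s -> mR6 (g s) by move=> s0; have [] := ing s s0.
apply: norm_L12_eq0; [exact: mf|exact: mg|].
apply/eqP; rewrite eq_le norm_L12_ge0 andbT; apply/lee_addgt0Pr => e e0; rewrite add0e.
have e2 : 0 < e / 2 by rewrite divr_gt0.
have Nf := cvge0_near (cvf t t0) e2; have Ng := cvge0_near (cvg_ t t0) e2.
move: Nf Ng => [d1 /= d10 H1] [d2 /= d20 H2].
have d0 : 0 < Num.min d1 d2 by rewrite lt_min d10.
have [s [ts st Ds]] := ae_meets_right t Dae d0.
have s0 : 0 <= s by rewrite (le_trans t0)// ltW.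
have sb d : Num.min d1 d2 <= d -> `|t - s| < d.
  by move=> md; rewrite ltr_norml; apply/andP; split; move: ts st md; lra.
have fe := H1 s (sb d1 ltac:(by rewrite ge_min lexx)) s0.
have ge := H2 s (sb d2 ltac:(by rewrite ge_min lexx orbT)) s0.
have := Ds s0; rewrite /D /F /G !cutE// => Dz.
have -> : e%:E = ((e / 2)%:E + (0 + (e / 2)%:E))%E by rewrite add0e -EFinD; congr EFin; field.
rewrite -Dz; apply: le_trans (leeD fe (leeD (lexx _) ge)).
apply: (@le_trans _ _ (norm_L12 (fun x v => f s x v - f t x v)%R + norm_L12 (fun x v => f s x v - g t x v)%R)%E).
  apply: norm_L12D; [exact: mR6B (mf t t0) (mg t t0)|exact: mR6B (mf s s0) (mf t t0)|exact: mR6B (mf s s0) (mg t t0)|].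
  by move=> x v; rewrite (distrC (f s x v) (f t x v)); exact: ler_distD.
apply: leeD => //.
apply: norm_L12D; [exact: mR6B (mf s s0) (mg t t0)|exact: mR6B (mf s s0) (mg s s0)|exact: mR6B (mg s s0) (mg t t0)|].
by move=> x v; exact: ler_distD.
Qed.
End two.
End uniqueness.
End uniqueness_part.

(** * Existence *)

Section existence.
Context {R : realType}.
Local Notation leb := (@lebesgue_measure R).
Local Notation R3 := (R3 R).
Local Notation PS := (R * (R3 * R3))%type.

Section scheme.
Variables (q r al be p eta eps : R).
Hypotheses (q5 : 5 < q) (al0 : 0 < al) (al1 : al <= 1) (be0 : 0 <= be) (be1 : be <= 1).
Hypotheses (hab : 2 <= 3 * al + 2 * be) (hq : 2 * (1 + be) <= al * (q - 3)).
Hypotheses (p1 : 1 < p) (eta0 : 0 <= eta) (eps0 : 0 < eps) (eps1 : eps <= 2^-1).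
Hypothesis small : (Cgm + 1) * (eta * (p - 1)^-1) * 4 <= 1.

(** The class that the iteration preserves. The bounds hold at every point, as the decay of the
    macroscopic fields is derived from them at every [(t, x)]. *)
Definition admissible (f : R -> R3 -> R3 -> R) : Prop :=
  [/\ measurable_fun [set: PS] (uc f),
      forall (t : R) x v, 0 <= t -> 0 <= f t x v,
      forall (t : R) x v, 0 <= t -> weight_w q v * f t x v <= eps &
      forall (t : R) x v, 0 <= t -> weight_W r t x v * f t x v <= eps].

Hypothesis rates : forall (t : R) (x : R3) (h : R3 -> R), 0 <= t -> dclass q eps h ->
  (forall v, weight_W r t x v * h v <= eps) ->
  [/\ collision_freq h al be <= lam p eta t,
      forall v, weight_w q v * (collision_freq h al be * maxwellian h v) <= lam p eta t * eps &
      forall v, weight_W r t x v * (collision_freq h al be * maxwellian h v) <= lam p eta t * eps].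

Lemma admissible_dclass f (t : R) x : admissible f -> 0 <= t -> dclass q eps (f t x).
Proof.
move=> [mf f0 fw fW] t0; split; [|by move=> v; exact: f0|by move=> v; exact: fw].
by apply: mR6_slice; exact: uc_slice mf.
Qed.

Lemma admissible_dclass1 f (t : R) x : admissible f -> 0 <= t -> dclass q 1 (f t x).
Proof.
move=> af t0; have [mf f0 fw] := admissible_dclass x af t0.
split=> // v; apply: le_trans (fw v) _; by move: eps1; lra.
Qed.

(** This is [nu M + (lam - nu) f], the source of the equation with damping [lam]. *)
Definition gain (f : R -> R3 -> R3 -> R) (s : R) (x v : R3) : R :=
  coll al be (f s x) v + lam p eta s * f s x v.

Lemma measurable_gain f : measurable_fun [set: PS] (uc f) -> measurable_fun [set: PS] (uc (gain f)).
Proof.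
move=> mf; apply: measurable_funD; first exact: measurable_coll_uc.
by apply: measurable_funM => //; apply: measurableT_comp => //; exact: measurable_lam.
Qed.

(** One [l eps] comes from [n M], and one from [(l - n) y]. *)
Lemma gain_weight_alg (W n M l y : R) : 0 <= W -> 0 <= n -> n <= l -> 0 <= y -> W * y <= eps ->
  W * (n * M) <= l * eps -> W * (n * (M - y) + l * y) <= 2 * (l * eps).
Proof.
move=> W0 n0 nl y0 Wy WM.
have -> : W * (n * (M - y) + l * y) = W * (n * M) + (l - n) * (W * y) by ring.
have -> : 2 * (l * eps) = l * eps + l * eps by ring.
apply: lerD => //; apply: (@le_trans _ _ (l * (W * y))).
  by rewrite ler_wpM2r ?mulr_ge0// lerBlDr lerDl.
by rewrite ler_wpM2l// (le_trans n0).
Qed.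

Lemma gainE f (s : R) x v : gain f s x v =
  collision_freq (f s x) al be * (maxwellian (f s x) v - f s x v) + lam p eta s * f s x v.
Proof. by []. Qed.

Section bounds.
Variable f : R -> R3 -> R3 -> R.
Hypothesis af : admissible f.

Lemma admissible_rates (s : R) (x : R3) : 0 <= s ->
  [/\ collision_freq (f s x) al be <= lam p eta s,
      forall v, weight_w q v * (collision_freq (f s x) al be * maxwellian (f s x) v) <= lam p eta s * eps &
      forall v, weight_W r s x v * (collision_freq (f s x) al be * maxwellian (f s x) v) <= lam p eta s * eps].
Proof.
move=> s0; apply: rates => //; first exact: admissible_dclass.
by move=> v; have [_ _ _ fW] := af; exact: fW.
Qed.

(** The damping dominates the collision frequency. *)
Lemma gain_ge0 (s : R) x v : 0 <= s -> 0 <= gain f s x v.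
Proof.
move=> s0; have [nl _ _] := admissible_rates x s0.
have [_ f0 _ _] := af.
have -> : gain f s x v = collision_freq (f s x) al be * maxwellian (f s x) v
   + (lam p eta s - collision_freq (f s x) al be) * f s x v by rewrite gainE; ring.
apply: addr_ge0; apply: mulr_ge0; rewrite ?collision_freq_ge0 ?subr_ge0//; last exact: f0.
by apply: maxwellian_ge0 => w; exact: f0.
Qed.

Lemma gain_w (s : R) x v : 0 <= s -> weight_w q v * gain f s x v <= 2 * (lam p eta s * eps).
Proof.
move=> s0; have [nl Mw _] := admissible_rates x s0.
have [_ f0 fw _] := af.
by apply: gain_weight_alg => //; [exact: powR_ge0|exact: collision_freq_ge0|exact: f0|exact: fw].
Qed.

Lemma gain_W (s : R) x v : 0 <= s -> weight_W r s x v * gain f s x v <= 2 * (lam p eta s * eps).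
Proof.
move=> s0; have [nl _ MW] := admissible_rates x s0.
have [_ f0 _ fW] := af.
by apply: gain_weight_alg => //; [exact: powR_ge0|exact: collision_freq_ge0|exact: f0|exact: fW].
Qed.

Lemma gain_le (s : R) x v : 0 <= s -> gain f s x v <= 2 * (eta * eps).
Proof.
move=> s0; apply: (@le_trans _ _ (weight_w q v * gain f s x v)).
  rewrite ler_peMl ?gain_ge0// weight_w_ge1//; by move: q5; lra.
apply: (le_trans (gain_w x v s0)).
by rewrite ler_wpM2l// ler_wpM2r ?lam_le// ltW.
Qed.

Lemma gain_L12_alg (C l n M y c : R) : 0 <= n -> n <= l -> 0 <= M -> 0 <= y ->
  n * (M - y) + l * y <= l * (M + y).
Proof.
move=> n0 nl M0 y0.
have -> : l * (M + y) = n * (M - y) + l * y + ((l - n) * M + n * y) by ring.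
by rewrite lerDl addr_ge0// mulr_ge0// subr_ge0.
Qed.

Lemma norm_L12_gain (s : R) : 0 <= s ->
  (norm_L12 (gain f s) <= ((Cgm + 1) * lam p eta s)%:E * norm_L12 (f s))%E.
Proof.
move=> s0; have [mf f0 fw _] := af.
have l0 := lam_ge0 p eta0 s.
have C0 : 0 <= (Cgm + 1 : R) by rewrite addr_ge0// Cgm_ge0.
apply: norm_L12_fiber.
- by apply: mulr_ge0.
- exact: (uc_slice s (measurable_gain mf)).
- exact: uc_slice.
move=> x; have cf := admissible_dclass1 x af s0.
have df := dclass_dens q5 ler01 cf.
have [mfx fx0 fi] := df.
have iM := ii_maxwellian q5 cf.
have w0 (v : R3) : 0 <= 1 + sqnorm v by rewrite addr_ge0// sqnorm_ge0.
have M0 v : 0 <= maxwellian (f s x) v by apply: maxwellian_ge0.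
have E : (\int[leb3]_v ((1 + sqnorm v) * `|f s x v|)%:E = (\int[leb3]_v ((1 + sqnorm v) * f s x v))%:E)%E.
  by rewrite EFin_I3//; apply: eq_integral => v _; rewrite ger0_norm.
rewrite E.
have i2 : ii (fun v => lam p eta s * ((1 + sqnorm v) * maxwellian (f s x) v + (1 + sqnorm v) * f s x v)).
  by apply: iiZ; exact: iiD.
apply: (@le_trans _ _ (\int[leb3]_v (lam p eta s * ((1 + sqnorm v) * maxwellian (f s x) v + (1 + sqnorm v) * f s x v)))%:E).
  rewrite EFin_I3//; apply: ge0_le_integral => //.
  - by move=> v _; rewrite lee_fin mulr_ge0.
  - apply/measurable_EFinP; apply: measurable_funM; first by apply: measurable_funD => //; exact: measurable_sqnorm.
    by apply: measurableT_comp => //; apply: mR6_slice; exact: (uc_slice s (measurable_gain mf)).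
  - by apply/measurable_EFinP; exact: ii_measurable i2.
  - move=> v _; rewrite lee_fin ger0_norm ?gain_ge0// -mulrDr mulrCA ler_wpM2l//.
    have [nl _ _] := admissible_rates x s0.
    by apply: gain_L12_alg => //; exact: collision_freq_ge0.
rewrite I3Z ?I3D//; last exact: iiD.
rewrite lee_fin [X in _ <= X]mulrAC -[X in _ <= X]mulrC ler_wpM2l//.
by rewrite [X in _ <= X]mulrDl mul1r lerD2r; have := maxwellian_energy q5 cf.
Qed.

End bounds.

Section map.
Variable f0 : R3 -> R3 -> R.
Hypotheses (mf0 : mR6 f0) (f00 : forall x v, 0 <= f0 x v).
Hypotheses (f0w : forall x v, weight_w q v * f0 x v <= eps ^+ 2)
  (f0W : forall x v, weight_W r 0 x v * f0 x v <= eps ^+ 2).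

(** The solution [F] of [(d/dt + v . grad_x + lam) F = gain f] with [F(0) = f0], by integration
    along characteristics. *)
Definition Phi (f : R -> R3 -> R3 -> R) (t : R) (x v : R3) : R :=
  duh p eta (f0 (x - t *: v) v) (fun s => gain f s (x - (t - s) *: v) v) t.

Lemma measurable_transport : measurable_fun [set: PS] (uc (fun t x v => f0 (x - t *: v) v)).
Proof.
apply: (measurableT_comp mf0 (g := fun p : PS => (p.2.1 - p.1 *: p.2.2, p.2.2))).
apply: measurable_fun_pair; last exact: measurableT_comp.
apply: measurable_R3B; first exact: measurableT_comp.
by apply: measurable_R3Z => //; exact: measurableT_comp.
Qed.

Lemma measurable_Phi f : measurable_fun [set: PS] (uc f) -> measurable_fun [set: PS] (uc (Phi f)).
Proof.
move=> mf; have mg := measurable_gain mf.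
have me : measurable_fun [set: R] (fun s => expR (Lam p eta s)).
  by apply: (measurableT_comp (@measurable_expR R)); exact: measurable_Lam.
rewrite /uc /Phi /duh; apply: measurable_funD.
  apply: measurable_funM; last exact: measurable_transport.
  apply: (measurableT_comp (@measurable_expR R)); apply: measurable_funN.
  by apply: (measurableT_comp (@measurable_Lam R p eta)).
under eq_fun do rewrite /Rintegral int_tind.
apply: (@measurable_Rint R _ _ _ _ leb (fun (z : PS) s => tind z.1 s *
  (expR (Lam p eta s - Lam p eta z.1) * gain f s (z.2.1 - (z.1 - s) *: z.2.2) z.2.2))).
apply: measurable_funM; first by apply: measurable_tind => //; exact: measurableT_comp.
apply: measurable_funM; last exact: (measurableT_comp mg (@measurable_along R)).
apply: (measurableT_comp (@measurable_expR R)); apply: measurable_funB.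
  exact: (measurableT_comp (@measurable_Lam R p eta)).
by apply: (measurableT_comp (@measurable_Lam R p eta)); exact: measurableT_comp.
Qed.

Section phi.
Variable f : R -> R3 -> R3 -> R.
Hypothesis af : admissible f.
Let mf : measurable_fun [set: PS] (uc f). Proof. by case: af. Qed.
Let mg := measurable_gain mf.
Let mga (t : R) x v := measurable_time_along t x v mg.

Lemma gain_along_ge0 (t : R) x v (s : R) : 0 <= s -> 0 <= gain f s (x - (t - s) *: v) v.
Proof. exact: gain_ge0. Qed.

Lemma gain_along_le (t : R) x v (s : R) : 0 <= s -> gain f s (x - (t - s) *: v) v <= 2 * (eta * eps).
Proof. exact: gain_le. Qed.

Lemma Phi_ge0 (t : R) x v : 0 <= Phi f t x v.
Proof.
apply: (duh_ge0 p1 eta0) => //.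
by move=> s; exact: gain_along_ge0.
Qed.

Lemma Phi_le (t : R) x v : 0 <= t ->
  Phi f t x v <= f0 (x - t *: v) v + \int[leb]_(s in `[0, t]) gain f s (x - (t - s) *: v) v.
Proof.
move=> t0; apply: (duh_le p1 eta0 (B := 2 * (eta * eps))) => //.
- by move=> s; exact: gain_along_ge0.
- by move=> s; exact: gain_along_le.
Qed.

Lemma integrable_gain (t : R) x v :
  leb.-integrable `[0%R, t] (EFin \o (fun s => gain f s (x - (t - s) *: v) v)).
Proof.
apply: (integrable_h (B := 2 * (eta * eps))) => //.
- by move=> s; exact: gain_along_ge0.
- by move=> s; exact: gain_along_le.
Qed.

(** Both weights are constant along characteristics. The data contribute [eps^2 <= eps / 2], and the
    gain at most [2 eps] times the integral of [lam], which the smallness condition makes at most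
    [1 / 4]. *)
Lemma weight_int_gain (W : R) (t : R) x v : 0 <= t ->
  (forall s : R, 0 <= s -> W * gain f s (x - (t - s) *: v) v <= 2 * (lam p eta s * eps)) ->
  W * f0 (x - t *: v) v <= eps ^+ 2 -> 0 <= W ->
  W * Phi f t x v <= eps.
Proof.
move=> t0 Wg W0f W0.
apply: (@le_trans _ _ (W * (f0 (x - t *: v) v + \int[leb]_(s in `[0, t]) gain f s (x - (t - s) *: v) v))).
  by rewrite ler_wpM2l// Phi_le.
rewrite mulrDr.
have -> : W * \int[leb]_(s in `[0, t]) gain f s (x - (t - s) *: v) v
    = \int[leb]_(s in `[0, t]) (W * gain f s (x - (t - s) *: v) v).
  by rewrite RintegralZl//; exact: integrable_gain.
have il : leb.-integrable `[0%R, t] (EFin \o (fun s => lam p eta s * (2 * eps))).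
  apply: (@bounded_integrable _ t (eta * (2 * eps))).
    by apply: measurable_funM => //; exact: measurable_lam.
  have e2 : 0 <= 2 * eps by rewrite mulr_ge0// ltW.
  move=> s s0 _; rewrite ger0_norm; last exact: mulr_ge0 (lam_ge0 p eta0 s) e2.
  by rewrite ler_wpM2r ?lam_le.
have H : \int[leb]_(s in `[0, t]) (W * gain f s (x - (t - s) *: v) v) <= Lam p eta t * (2 * eps).
  have -> : Lam p eta t * (2 * eps) = \int[leb]_(s in `[0, t]) (lam p eta s * (2 * eps)).
    rewrite RintegralZr//.
      by rewrite /Rintegral int_lam.
    apply: (@bounded_integrable _ t eta); first exact: measurable_lam.
    by move=> s s0 _; rewrite ger0_norm ?lam_ge0 ?lam_le.
  apply: le_Rintegral => //.
    apply: (@bounded_integrable _ t (W * (2 * (eta * eps)))).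
      by apply: measurable_funM => //; exact: mga.
    move=> s s0 _; rewrite ger0_norm; last by apply: mulr_ge0 => //; exact: gain_along_ge0.
    by rewrite ler_wpM2l// gain_along_le.
  move=> s; rewrite /= in_itv/= => /andP[s0 _].
  by apply: (le_trans (Wg s s0)); rewrite mulrCA.
apply: (le_trans (lerD W0f H)).
have L := Lam_le p1 eta0 t.
have c0 := @Cgm_ge0 R.
have e0 : 0 <= eta * (p - 1)^-1 by rewrite mulr_ge0// invr_ge0 subr_ge0 ltW.
move: small eps0 eps1 L c0 e0; move: (eta * (p - 1)^-1) (Lam p eta t) (Cgm : R) => E L C s e1 e2 LE C0 E0.
have H1 : E * 4 <= 1.
  by apply: le_trans s; rewrite -mulrA ler_peMl ?mulr_ge0// lerDr.
have H2 : L * (2 * eps) <= 2^-1 * eps.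
  rewrite mulrA ler_wpM2r ?(ltW e1)//; lra.
have H3 : eps ^+ 2 <= 2^-1 * eps by rewrite expr2 ler_wpM2r// ltW.
lra.
Qed.

Lemma admissible_Phi : admissible (Phi f).
Proof.
split.
- exact: measurable_Phi.
- by move=> t x v _; exact: Phi_ge0.
- move=> t x v t0; apply: weight_int_gain => //; last exact: powR_ge0.
  by move=> s s0; exact: gain_w.
- move=> t x v t0; apply: weight_int_gain => //; last exact: powR_ge0.
    by move=> s s0; rewrite -(weight_W_along r t s); exact: gain_W.
  rewrite -(weight_W_along r t 0) subr0; exact: f0W.
Qed.
End phi.

Lemma norm_L12_transport (t : R) : norm_L12 (fun x v => f0 (x - t *: v) v) = norm_L12 f0.
Proof.
rewrite /norm_L12 -[RHS](leb6_shear t)//; first exact: measurable_energy.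
by move=> z; exact: energy_ge0.
Qed.

Section two.
Variables f g : R -> R3 -> R3 -> R.
Hypotheses (af : admissible f) (ag : admissible g).
Let mf : measurable_fun [set: PS] (uc f). Proof. by case: af. Qed.
Let mg : measurable_fun [set: PS] (uc g). Proof. by case: ag. Qed.
Let mgf := measurable_gain mf.
Let mgg := measurable_gain mg.

Lemma measurable_gain_diff : measurable_fun [set: PS] (uc (fun s x v => gain f s x v - gain g s x v)).
Proof. exact: measurable_funB. Qed.

Lemma measurable_diff : measurable_fun [set: PS] (uc (fun s x v => f s x v - g s x v)).
Proof. exact: measurable_funB. Qed.

Lemma gain_diff_bound (s : R) x v : 0 <= s -> `|gain f s x v - gain g s x v| <= 2 * (eta * eps).
Proof.
move=> s0; have f1 := gain_ge0 af x v s0; have f2 := gain_le af x v s0.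
have g1 := gain_ge0 ag x v s0; have g2 := gain_le ag x v s0.
by rewrite ler_norml; apply/andP; split; move: f1 f2 g1 g2;
  move: (gain f s x v) (gain g s x v) (2 * (eta * eps)) => a b c *; lra.
Qed.

Lemma norm_L12_gain_diff (s : R) : 0 <= s ->
  (norm_L12 (fun x v => gain f s x v - gain g s x v)%R <=
   (Klip q + eta)%:E * norm_L12 (fun x v => f s x v - g s x v)%R)%E.
Proof.
move=> s0; have m1 := uc_slice s mf; have m2 := uc_slice s mg; have md := mR6B m1 m2.
have mc : mR6 (fun x v => coll al be (f s x) v - coll al be (g s x) v).
  apply: (mR6B (h := fun x v => coll al be (f s x) v) (k := fun x v => coll al be (g s x) v)).
    exact: (uc_slice s (measurable_coll_uc _ _ mf)).
  exact: (uc_slice s (measurable_coll_uc _ _ mg)).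
have K0 := @Klip_ge0 R q.
apply: (@le_trans _ _ (norm_L12 (fun x v => coll al be (f s x) v - coll al be (g s x) v)%R +
   norm_L12 (fun x v => eta * (f s x v - g s x v))%R)%E).
  apply: norm_L12D => //.
  - exact: (uc_slice s measurable_gain_diff).
  - by rewrite /mR6; apply: measurable_funM => //; exact: measurable_cst.
  move=> x v; have -> : gain f s x v - gain g s x v =
    (coll al be (f s x) v - coll al be (g s x) v) + lam p eta s * (f s x v - g s x v).
    by rewrite /gain; ring.
  apply: (le_trans (ler_normD _ _)); rewrite lerD2l normrM [X in _ <= X]normrM ler_wpM2r//.
  rewrite (ger0_norm eta0) ger0_norm; [exact: lam_le|exact: lam_ge0].
rewrite norm_L12Z// EFinD ge0_muleDl ?lee_fin// leeD2r//.
apply: norm_L12_coll => //.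
- by move=> x; exact: admissible_dclass1.
- by move=> x; exact: admissible_dclass1.
Qed.

(** The data cancel, and the damping factor is at most 1. *)
Lemma Phi_diff (t : R) x v : 0 <= t ->
  `|Phi f t x v - Phi g t x v| <=
  \int[leb]_(s in `[0, t]) `|gain f s (x - (t - s) *: v) v - gain g s (x - (t - s) *: v) v|.
Proof.
move=> t0.
have kf := integrable_kern p1 eta0 (measurable_time_along t x v mgf)
  (gain_along_ge0 af t x v) (gain_along_le af t x v) t.
have kg := integrable_kern p1 eta0 (measurable_time_along t x v mgg)
  (gain_along_ge0 ag t x v) (gain_along_le ag t x v) t.
rewrite /Phi /duh opprD addrACA subrr add0r -RintegralB//.
have md := measurable_time_along t x v measurable_gain_diff.
have eb (s : R) : 0 <= s -> s <= t ->
    `|expR (Lam p eta s - Lam p eta t) * gain f s (x - (t - s) *: v) v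
      - expR (Lam p eta s - Lam p eta t) * gain g s (x - (t - s) *: v) v|
    <= `|gain f s (x - (t - s) *: v) v - gain g s (x - (t - s) *: v) v|.
  move=> s0 st; rewrite -mulrBr normrM ger0_norm ?expR_ge0// ler_piMl//.
  exact: expLam_le.
have kd : leb.-integrable `[0%R, t] (EFin \o (fun s =>
   expR (Lam p eta s - Lam p eta t) * gain f s (x - (t - s) *: v) v
      - expR (Lam p eta s - Lam p eta t) * gain g s (x - (t - s) *: v) v)).
  apply: (@bounded_integrable _ t (2 * (eta * eps))).
    by apply: measurable_funB; apply: measurable_kern; exact: measurable_time_along.
  by move=> s s0 st; apply: (le_trans (eb s s0 st)); exact: gain_diff_bound.
apply: (le_trans (le_normr_Rintegral _ kd)) => //.
apply: le_Rintegral => //.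
- exact: integrable_norm kd.
- apply: (@bounded_integrable _ t (2 * (eta * eps))); first exact: measurableT_comp.
  by move=> s s0 _; rewrite normr_id; exact: gain_diff_bound.
by move=> s; rewrite /= in_itv/= => /andP[s0 st]; exact: eb.
Qed.

(** The data cancel, the damping factor is at most 1, and the gain is Lipschitz in [L^1_2].
    Transport along characteristics costs nothing. *)
Lemma Phi_contract (t : R) : 0 <= t ->
  (norm_L12 (fun x v => Phi f t x v - Phi g t x v)%R <=
   (Klip q + eta)%:E * \int[leb]_(s in `[0%R, t]) norm_L12 (fun x v => f s x v - g s x v)%R)%E.
Proof.
move=> t0; have K0 : 0 <= Klip q + eta by rewrite addr_ge0// Klip_ge0.
apply: (@le_trans _ _ (\int[leb]_(s in `[0%R, t]) norm_L12 (fun x v => gain f s x v - gain g s x v)%R)%E).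
  rewrite -(norm_L12_Rint t measurable_gain_diff (B := 2 * (eta * eps))); last exact: gain_diff_bound.
  apply: norm_L12_le.
  - by apply: mR6B; exact: (uc_slice t (measurable_Phi _)).
  - exact: (uc_slice t (measurable_Rint_along measurable_gain_diff)).
  move=> x v; apply: (le_trans (Phi_diff x v t0)); exact: ler_norm.
rewrite -(@ge0_integralZl _ _ _ leb _ (measurable_itv _)); last 3 first.
- by apply: measurable_funTS; exact: measurable_norm_L12 measurable_diff.
- by move=> s _; exact: norm_L12_ge0.
- by rewrite lee_fin.
apply: (@ge0_le_integral _ _ _ leb _ (measurable_itv _)).
- by move=> s _; exact: norm_L12_ge0.
- by apply: measurable_funTS; exact: measurable_norm_L12 measurable_gain_diff.
- apply: emeasurable_funM; first exact: measurable_cst.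
  by apply: measurable_funTS; exact: measurable_norm_L12 measurable_diff.
- by move=> s; rewrite /= in_itv/= => /andP[s0 _]; exact: norm_L12_gain_diff.
Qed.
End two.

(** The data contribute [N]; the gain contributes [(Cgm + 1) (2 N)] times the integral of [lam],
    which is at most [N] by the smallness condition. *)
Lemma norm_L12_Phi f (N : R) (t : R) : admissible f -> 0 <= t -> 0 <= N ->
  (norm_L12 f0 <= N%:E)%E -> (forall s : R, 0 <= s -> (norm_L12 (f s) <= (2 * N)%:E)%E) ->
  (norm_L12 (Phi f t) <= (2 * N)%:E)%E.
Proof.
move=> af t0 N0 n0 fN; have [mf _ _ _] := af; have mg := measurable_gain mf.
have C0 : 0 <= (Cgm + 1 : R) by rewrite addr_ge0// Cgm_ge0.
apply: (@le_trans _ _ (norm_L12 f0 + \int[leb]_(s in `[0%R, t]) norm_L12 (gain f s))%E).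
  rewrite -(norm_L12_transport t) -(norm_L12_Rint t mg (B := 2 * (eta * eps))); last first.
    by move=> s x v s0; rewrite ger0_norm ?gain_ge0 ?gain_le.
  apply: norm_L12D.
  - exact: (uc_slice t (measurable_Phi mf)).
  - exact: (uc_slice t measurable_transport).
  - exact: (uc_slice t (measurable_Rint_along mg)).
  move=> x v; rewrite (ger0_norm (Phi_ge0 af t x v)) (ger0_norm (f00 _ _)) ger0_norm; last exact: Rintegral_ge0.
  apply: (le_trans (Phi_le af x v t0)); rewrite lerD2l le_eqVlt; apply/orP; left; apply/eqP.
  apply: eq_Rintegral => s; rewrite inE /= in_itv/= => /andP[s0 _].
  by rewrite ger0_norm//; exact: gain_along_ge0.
have H : (\int[leb]_(s in `[0%R, t]) norm_L12 (gain f s) <= ((Cgm + 1) * (2 * N) * Lam p eta t)%:E)%E.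
  rewrite EFinM -(int_lam eta p1 t0) -ge0_integralZl//; last 3 first.
  - by apply: measurable_funTS; apply/measurable_EFinP; exact: measurable_lam.
  - by move=> s _; rewrite lee_fin lam_ge0.
  - by rewrite lee_fin !mulr_ge0.
  apply: (@ge0_le_integral _ _ _ leb _ (measurable_itv _)).
  - by move=> s _; exact: norm_L12_ge0.
  - by apply: measurable_funTS; exact: measurable_norm_L12 mg.
  - by apply: measurable_funTS; apply/measurable_EFinP; apply: measurable_funM => //; exact: measurable_lam.
  move=> s; rewrite /= in_itv/= => /andP[s0 _].
  apply: (le_trans (norm_L12_gain af s0)); have l0 := lam_ge0 p eta0 s.
  apply: (le_trans (lee_wpmul2l _ (fN s s0))); first by rewrite lee_fin mulr_ge0.
  rewrite -!EFinM lee_fin le_eqVlt; apply/orP; left; apply/eqP; ring.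
apply: (le_trans (leeD n0 H)); rewrite -EFinD lee_fin.
have L := Lam_le p1 eta0 t.
have e0 : 0 <= eta * (p - 1)^-1 by rewrite mulr_ge0// invr_ge0 subr_ge0 ltW.
move: small L C0 e0; move: (eta * (p - 1)^-1) (Lam p eta t) (Cgm + 1 : R) => E L C s LE C0 E0.
have -> : C * (2 * N) * L = (C * L * 2) * N by ring.
have H1 : C * L * 2 <= 1.
  apply: le_trans s; apply: (@le_trans _ _ (C * E * 2)); first by rewrite ler_wpM2r// ler_wpM2l.
  rewrite ler_wpM2l ?mulr_ge0//; lra.
have : C * L * 2 * N <= 1 * N by rewrite ler_wpM2r.
lra.
Qed.
Section picard.
Variable N : R.
Hypotheses (N0 : 0 <= N) (n0 : (norm_L12 f0 <= N%:E)%E).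

Fixpoint picard (n : nat) : R -> R3 -> R3 -> R :=
  if n is m.+1 then Phi (picard m) else fun _ _ _ => 0.

Lemma admissible_picard n : admissible (picard n).
Proof.
elim: n => [|n IH]; last exact: admissible_Phi.
split; first exact: measurable_cst.
- by [].
- by move=> t x v _; rewrite mulr0 ltW.
- by move=> t x v _; rewrite mulr0 ltW.
Qed.

Let mp n : measurable_fun [set: PS] (uc (picard n)). Proof. by case: (admissible_picard n). Qed.

Lemma norm_L12_picard n (t : R) : 0 <= t -> (norm_L12 (picard n t) <= (2 * N)%:E)%E.
Proof.
elim: n t => [|n IH] t t0 /=.
  rewrite /norm_L12; under eq_integral do rewrite normr0 mulr0.
  by rewrite integral0 lee_fin mulr_ge0.
exact: norm_L12_Phi (admissible_picard n) t0 N0 n0 IH.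
Qed.

(** The final 1 makes the exponential rate positive. *)
Definition Kexp : R := Klip q + eta + 1.

Lemma Kexp_gt0 : 0 < Kexp.
Proof. by rewrite ltr_wpDl// addr_ge0// Klip_ge0. Qed.

Lemma Phi_contractK f g (t c : R) : admissible f -> admissible g -> 0 <= t -> 0 <= c ->
  (forall s : R, 0 <= s -> (norm_L12 (fun x v => f s x v - g s x v)%R <= (c * expR (2 * Kexp * s))%:E)%E) ->
  (norm_L12 (fun x v => Phi f t x v - Phi g t x v)%R <= (c / 2 * expR (2 * Kexp * t))%:E)%E.
Proof.
move=> af ag t0 c0 H.
have md := measurable_diff af ag.
apply: le_trans (halving (N := fun s => norm_L12 (fun x v => f s x v - g s x v)%R) Kexp_gt0 c0 t0 _ _ _); first last.
- by apply: aeW => s; exact: H.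
- by move=> s; exact: norm_L12_ge0.
- exact: measurable_norm_L12 md.
apply: (le_trans (Phi_contract af ag t0)); apply: lee_wpmul2r.
  by apply: integral_ge0 => s _; exact: norm_L12_ge0.
by rewrite lee_fin /Kexp lerDl.
Qed.

Lemma norm_L12_picard_diff n (t : R) : 0 <= t ->
  (norm_L12 (fun x v => picard n.+1 t x v - picard n t x v)%R <= (2 * N / 2 ^+ n * expR (2 * Kexp * t))%:E)%E.
Proof.
elim: n t => [|n IH] t t0.
  apply: (@le_trans _ _ (2 * N)%:E).
    apply: le_trans (norm_L12_picard 1 t0); apply: norm_L12_le.
    - by apply: mR6B; exact: uc_slice (mp _).
    - exact: uc_slice (mp 1).
    - by move=> x v; rewrite subr0.
  rewrite lee_fin expr0 divr1 ler_peMr ?mulr_ge0//.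
  by have := @expR_ge1Dx R (2 * Kexp * t); have := Kexp_gt0 => k0 h; apply: le_trans h; rewrite lerDl mulr_ge0// mulr_ge0// ltW.
have -> : 2 * N / 2 ^+ n.+1 * expR (2 * Kexp * t) = (2 * N / 2 ^+ n) / 2 * expR (2 * Kexp * t).
  by rewrite exprS; field; exact: expf_neq0.
apply: (Phi_contractK (f := picard n.+1) (g := picard n)) => //.
- exact: (admissible_picard n.+1).
- exact: admissible_picard.
by rewrite divr_ge0 ?mulr_ge0 ?exprn_ge0.
Qed.

(** A limit superior, so that the limit is admissible at every point. *)
Definition plim (t : R) (x v : R3) : R := fine (limn_esup (fun n => (picard n t x v)%:E)).

Lemma weight_le (W y : R) : 0 < W -> (W * y <= eps) = (y <= eps / W).
Proof. by move=> W0; rewrite ler_pdivlMr// mulrC. Qed.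

Lemma weight_W_gt0 (t : R) x v : 0 < weight_W r t x v.
Proof. by rewrite /weight_W powR_gt0// ltr_wpDr ?sqnorm_ge0// ltr_wpDr ?sqnorm_ge0. Qed.

Lemma weight_w_gt0 v : 0 < weight_w q v.
Proof. by rewrite /weight_w powR_gt0// ltr_wpDr ?sqnorm_ge0. Qed.

Lemma admissible_plim : admissible plim.
Proof.
split.
- apply: (measurable_pointwise_lim (a := fun n (z : PS) => uc (picard n) z)); exact: mp.
- move=> t x v t0.
  have H n : 0 <= picard n t x v <= eps / weight_w q v.
    have [_ p0 pw _] := admissible_picard n.
    by rewrite p0//= -weight_le ?weight_w_gt0// pw.
  by have /andP[] := limn_esup_between H.
- move=> t x v t0; rewrite weight_le ?weight_w_gt0//.
  have H n : 0 <= picard n t x v <= eps / weight_w q v.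
    have [_ p0 pw _] := admissible_picard n.
    by rewrite p0//= -weight_le ?weight_w_gt0// pw.
  by have /andP[] := limn_esup_between H.
- move=> t x v t0; rewrite weight_le ?weight_W_gt0//.
  have H n : 0 <= picard n t x v <= eps / weight_W r t x v.
    have [_ p0 _ pW] := admissible_picard n.
    by rewrite p0//= -weight_le ?weight_W_gt0// pW.
  by have /andP[] := limn_esup_between H.
Qed.

Lemma plim_picard n (t : R) : 0 <= t ->
  (norm_L12 (fun x v => plim t x v - picard n t x v)%R <= (4 * N / 2 ^+ n * expR (2 * Kexp * t))%:E)%E.
Proof.
move=> t0.
have := @fast_lim R _ _ leb6 (fun z : R3 * R3 => 1 + sqnorm z.2) (fun n (z : R3 * R3) => picard n t z.1 z.2)
  (2 * N * expR (2 * Kexp * t)).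
have -> : 4 * N / 2 ^+ n * expR (2 * Kexp * t) = 2 * (2 * N * expR (2 * Kexp * t)) / 2 ^+ n by ring.
apply.
- by apply: measurable_funD => //; exact: measurable_sqnorm.
- by move=> z; rewrite lerDl sqnorm_ge0.
- by move=> m; exact: uc_slice (mp m).
- by rewrite !mulr_ge0// expR_ge0.
- move=> m; have := norm_L12_picard_diff m t0; rewrite mulrAC; exact.
Qed.

Lemma norm_L12_plim (t : R) : 0 <= t -> (norm_L12 (plim t) <= (2 * N)%:E)%E.
Proof.
have [ml _ _ _] := admissible_plim.
move=> t0; apply: (@halves_le _ _ (4 * N * expR (2 * Kexp * t))); first by rewrite !mulr_ge0// expR_ge0.
move=> n; rewrite EFinD; have -> : 4 * N * expR (2 * Kexp * t) / 2 ^+ n = 4 * N / 2 ^+ n * expR (2 * Kexp * t) by ring.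
apply: le_trans (leeD (plim_picard n t0) (norm_L12_picard n t0)).
apply: norm_L12D.
- exact: uc_slice ml.
- by apply: mR6B; [exact: uc_slice ml|exact: uc_slice (mp n)].
- exact: uc_slice (mp n).
by move=> x v; rewrite -{1}[plim t x v](subrK (picard n t x v)) ler_normD.
Qed.

(** The image of the limit rather than the limit itself: they agree almost everywhere, but only the
    image satisfies a Duhamel formula on every characteristic. *)
Definition sol := Phi plim.

Lemma admissible_sol : admissible sol.
Proof. exact: admissible_Phi admissible_plim. Qed.

Lemma norm_L12_sol (t : R) : 0 <= t -> (norm_L12 (sol t) <= (2 * N)%:E)%E.
Proof. by move=> t0; exact: norm_L12_Phi admissible_plim t0 N0 n0 norm_L12_plim. Qed.

(** Both are limits in [L^1_2] of the iterates. *)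
Lemma plim_sol (t : R) : 0 <= t -> norm_L12 (fun x v => plim t x v - sol t x v)%R = 0%E.
Proof.
move=> t0; have [ml _ _ _] := admissible_plim; have [ms _ _ _] := admissible_sol.
apply/eqP; rewrite eq_le norm_L12_ge0 andbT.
apply: (@halves_le _ _ (4 * N * expR (2 * Kexp * t))); first by rewrite !mulr_ge0// expR_ge0.
move=> n; rewrite addr0.
have -> : 4 * N * expR (2 * Kexp * t) / 2 ^+ n = 4 * N / 2 ^+ n.+1 * expR (2 * Kexp * t) + 4 * N / 2 ^+ n / 2 * expR (2 * Kexp * t).
  by rewrite exprS; field; exact: expf_neq0.
rewrite EFinD.
have H : (norm_L12 (fun x v => picard n.+1 t x v - sol t x v)%R <= (4 * N / 2 ^+ n / 2 * expR (2 * Kexp * t))%:E)%E.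
  apply: Phi_contractK => //; [exact: admissible_picard|exact: admissible_plim| |].
    by rewrite divr_ge0 ?mulr_ge0 ?exprn_ge0.
  move=> s s0; apply: le_trans (plim_picard n s0); apply: norm_L12_le.
  - by apply: mR6B; [exact: uc_slice (mp n)|exact: uc_slice ml].
  - by apply: mR6B; [exact: uc_slice ml|exact: uc_slice (mp n)].
  - by move=> x v; rewrite distrC.
apply: le_trans (leeD (plim_picard n.+1 t0) H); apply: norm_L12D.
- by apply: mR6B; [exact: uc_slice ml|exact: uc_slice ms].
- by apply: mR6B; [exact: uc_slice ml|exact: uc_slice (mp _)].
- by apply: mR6B; [exact: uc_slice (mp _)|exact: uc_slice ms].
by move=> x v; rewrite -(subrKA (picard n.+1 t x v)) ler_normD.
Qed.

Section mild.
Variables (t : R) (x v : R3).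
Hypothesis t0 : 0 <= t.

(** The points of one characteristic share the same data and the same source. *)
Lemma sol_along (s : R) : 0 <= s ->
  duh p eta (f0 (x - t *: v) v) (fun s => gain plim s (x - (t - s) *: v) v) s
  = sol s (x - (t - s) *: v) v.
Proof.
move=> s0; rewrite /sol /Phi.
have shift (a : R) : x - (t - s) *: v - (s - a) *: v = x - (t - a) *: v.
  by rewrite -addrA -opprD -scalerDl addrA subrK.
have -> : x - (t - s) *: v - s *: v = x - t *: v by rewrite -addrA -opprD -scalerDl subrK.
have -> : (fun a : R => gain plim a (x - (t - s) *: v - (s - a) *: v) v) =
    (fun a : R => gain plim a (x - (t - a) *: v) v) by apply/funext => a; rewrite shift.
by [].
Qed.

Lemma sol_le (s : R) y w : 0 <= s -> sol s y w <= eps.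
Proof.
move=> s0; have [_ p0 pw _] := admissible_sol.
apply: le_trans (pw s y w s0); rewrite ler_peMl ?p0// weight_w_ge1//; by move: q5; lra.
Qed.

Lemma coll_gain f (s : R) y w : coll al be (f s y) w = gain f s y w - lam p eta s * f s y w.
Proof. by rewrite /gain addrK. Qed.

Lemma integrable_coll_along :
  leb.-integrable `[0%R, t] (EFin \o (fun s => coll al be (sol s (x - (t - s) *: v)) v)).
Proof.
have as_ := admissible_sol; have [ms s0 _ _] := as_.
apply: (@bounded_integrable _ t (2 * (eta * eps) + eta * eps)).
  by have := measurable_time_along t x v (measurable_coll_uc be al0 ms).
move=> s ss _; rewrite coll_gain; apply: (le_trans (ler_normB _ _)); apply: lerD.
  by rewrite ger0_norm ?gain_ge0 ?gain_le.
rewrite ger0_norm; last by apply: mulr_ge0; [exact: lam_ge0|exact: s0].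
by apply: ler_pM; [exact: lam_ge0|exact: s0|exact: lam_le|exact: sol_le].
Qed.

(** Duhamel's formula for [sol] has [plim] in the gain; it is the mild formulation on every
    characteristic along which the gains of [plim] and [sol] agree. *)
Lemma sol_mild_along :
  \int[leb]_(s in `[0, t]) `|gain plim s (x - (t - s) *: v) v - gain sol s (x - (t - s) *: v) v| = 0 ->
  sol t x v = f0 (x - t *: v) v + \int[leb]_(s in `[0, t]) coll al be (sol s (x - (t - s) *: v)) v.
Proof.
move=> G0.
have apl := admissible_plim; have asl := admissible_sol.
have [mpl _ _ _] := apl; have [msl _ _ _] := asl.
have mgp := measurable_time_along t x v (measurable_gain mpl).
have mgs := measurable_time_along t x v (measurable_gain msl).
have E : sol t x v = f0 (x - t *: v) v +
   \int[leb]_(s in `[0, t]) (gain plim s (x - (t - s) *: v) v - lam p eta s * sol s (x - (t - s) *: v) v).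
  have xt : x - (t - t) *: v = x by rewrite subrr scale0r subr0.
  have := duh_mild_ext p1 eta0 (f00 (x - t *: v) v) mgp (gain_along_ge0 apl t x v) (gain_along_le apl t x v)
    (F := fun s => sol s (x - (t - s) *: v) v) t0 sol_along.
  by rewrite xt.
rewrite E; congr (_ + _); apply/eqP; rewrite -subr_eq0 -normr_le0.
have i2 := integrable_coll_along.
have i1 : leb.-integrable `[0%R, t] (EFin \o (fun s => gain plim s (x - (t - s) *: v) v - lam p eta s * sol s (x - (t - s) *: v) v)).
  apply: (@bounded_integrable _ t (2 * (eta * eps) + eta * eps)).
    apply: measurable_funB => //; apply: measurable_funM; first exact: measurable_lam.
    exact: measurable_time_along.
  have [_ s0 _ _] := asl.
  move=> s ss _; apply: (le_trans (ler_normB _ _)); apply: lerD.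
    by rewrite ger0_norm ?gain_ge0 ?gain_le.
  rewrite ger0_norm; last by apply: mulr_ge0; [exact: lam_ge0|exact: s0].
  by apply: ler_pM; [exact: lam_ge0|exact: s0|exact: lam_le|exact: sol_le].
rewrite -RintegralB//.
have -> : \int[leb]_(s in `[0, t]) (gain plim s (x - (t - s) *: v) v - lam p eta s * sol s (x - (t - s) *: v) v
    - coll al be (sol s (x - (t - s) *: v)) v) =
  \int[leb]_(s in `[0, t]) (gain plim s (x - (t - s) *: v) v - gain sol s (x - (t - s) *: v) v).
  by apply: eq_Rintegral => s _; rewrite coll_gain; ring.
rewrite -[X in _ <= X]G0; apply: le_normr_Rintegral; first exact: measurable_itv.
apply: (@bounded_integrable _ t (2 * (eta * eps))); first exact: measurable_funB.
by move=> s s0 _; exact: gain_diff_bound.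
Qed.
End mild.

(** Almost every characteristic is of this kind, because the gain is Lipschitz in [L^1_2]. *)
Lemma gain_plim_sol (t : R) :
  norm_L12 (fun x v => \int[leb]_(s in `[0, t]) `|gain plim s (x - (t - s) *: v) v - gain sol s (x - (t - s) *: v) v|)%R = 0%E.
Proof.
have apl := admissible_plim; have asl := admissible_sol.
rewrite (norm_L12_Rint t (measurable_gain_diff apl asl) (B := 2 * (eta * eps))); last exact: gain_diff_bound.
apply: integral0_eq => s; rewrite /= in_itv/= => /andP[s0 _].
apply/eqP; rewrite eq_le norm_L12_ge0 andbT.
by apply: (le_trans (norm_L12_gain_diff apl asl s0)); rewrite plim_sol// mule0.
Qed.

Lemma sol_mild : \forall z \ae leb_txv, 0 <= z.1 ->
  leb.-integrable `[0, z.1] (EFin \o (fun s => collision al be sol s (z.2.1 - (z.1 - s) *: z.2.2) z.2.2)) /\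
  sol z.1 z.2.1 z.2.2 = f0 (z.2.1 - z.1 *: z.2.2) z.2.2
    + \int[leb]_(s in `[0, z.1]) collision al be sol s (z.2.1 - (z.1 - s) *: z.2.2) z.2.2.
Proof.
have apl := admissible_plim; have asl := admissible_sol.
have mG := measurable_Rint_along (measurable_gain_diff apl asl).
pose E (z : PS) : \bar R := ((1 + sqnorm z.2.2) *
  `|\int[leb]_(s in `[0, z.1]) `|gain plim s (z.2.1 - (z.1 - s) *: z.2.2) z.2.2 - gain sol s (z.2.1 - (z.1 - s) *: z.2.2) z.2.2| |)%:E.
have mE : measurable_fun [set: PS] E.
  apply/measurable_EFinP; apply: measurable_funM; last exact: measurableT_comp.
  apply: measurable_funD => //; apply: measurable_sqnorm; exact: measurableT_comp.
have E0 z : (0 <= E z)%E by rewrite lee_fin mulr_ge0// addr_ge0// sqnorm_ge0.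
have IE : (\int[leb_txv]_z `|E z| = 0)%E.
  under eq_integral do rewrite gee0_abs//.
  rewrite [LHS]fubini_tonelli1//; apply: integral0_eq => t _; exact: gain_plim_sol.
have := (ae_eq_integral_abs leb_txv measurableT mE).1 IE.
move=> ae; apply: (@filterS _ _ (ae_filter_ringOfSetsType leb_txv) _ _ _ ae) => -[t [x v]] /= /(_ I) Ez t0.
split; first exact: integrable_coll_along.
apply: sol_mild_along => //.
have w0 : 1 + sqnorm v != 0 by rewrite gt_eqF// ltr_wpDr ?sqnorm_ge0.
by case: Ez => /eqP; rewrite mulf_eq0 (negPf w0) normr_eq0 => /eqP.
Qed.

(** The rate of change of [sol] along characteristics, valid on every one of them. *)
Definition rate (s : R) (x v : R3) : R := gain plim s x v - lam p eta s * sol s x v.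

Lemma measurable_rate : measurable_fun [set: PS] (uc rate).
Proof.
have [mpl _ _ _] := admissible_plim; have [msl _ _ _] := admissible_sol.
apply: (measurable_funB (measurable_gain mpl)).
apply: (measurable_funM (f := fun z : PS => lam p eta z.1)) => //.
by apply: (measurableT_comp (measurable_lam p eta)).
Qed.

Lemma rate_bound (s : R) x v : 0 <= s -> `|rate s x v| <= 2 * (eta * eps) + eta * eps.
Proof.
move=> ss; have [_ s0 _ _] := admissible_sol; have apl := admissible_plim.
apply: (le_trans (ler_normB _ _)); apply: lerD.
  by rewrite ger0_norm ?gain_ge0 ?gain_le.
rewrite ger0_norm; last by apply: mulr_ge0; [exact: lam_ge0|exact: s0].
by apply: ler_pM; [exact: lam_ge0|exact: s0|exact: lam_le|exact: sol_le].
Qed.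

Definition Crate : R := (Cgm + 1) * eta * (2 * N) + eta * (2 * N).

Lemma Crate_ge0 : 0 <= Crate.
Proof.
have C0 : 0 <= (Cgm + 1 : R) by rewrite addr_ge0// Cgm_ge0.
by rewrite /Crate addr_ge0// !mulr_ge0.
Qed.

Lemma norm_L12_rate (s : R) : 0 <= s -> (norm_L12 (rate s) <= Crate%:E)%E.
Proof.
move=> s0; have apl := admissible_plim; have [mpl _ _ _] := apl; have [msl _ _ _] := admissible_sol.
have mg := uc_slice s (measurable_gain mpl); have ms := uc_slice s msl.
have C0 : 0 <= (Cgm + 1 : R) by rewrite addr_ge0// Cgm_ge0.
have l0 := lam_ge0 p eta0 s; have le := lam_le p1 eta0 s0.
have mls : mR6 (fun x v => lam p eta s * sol s x v).
  by apply: (measurable_funM (f := fun=> lam p eta s)) => //; exact: measurable_cst.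
apply: (@le_trans _ _ (norm_L12 (gain plim s) + norm_L12 (fun x v => lam p eta s * sol s x v)%R)%E).
  by apply: norm_L12D => //; [exact: (uc_slice s measurable_rate)|move=> x v; exact: ler_normB].
rewrite norm_L12Z// /Crate EFinD; apply: leeD.
  apply: (le_trans (norm_L12_gain apl s0)).
  apply: (le_trans (lee_wpmul2l _ (norm_L12_plim s0))); first by rewrite lee_fin mulr_ge0.
  by rewrite -EFinM lee_fin ler_wpM2r ?mulr_ge0// ler_wpM2l.
apply: (le_trans (lee_wpmul2l _ (norm_L12_sol s0))); first by rewrite lee_fin.
by rewrite -EFinM lee_fin ler_wpM2r ?mulr_ge0.
Qed.

(** The cutoff at [a] is inside the integrand, so that integrals over [0, b] apply to the interval
    from [a] to [b]. *)
Definition rate_after (a s : R) (x v : R3) : R := (if a <= s then 1 else 0) * rate s x v.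

Lemma measurable_rate_after (a : R) : measurable_fun [set: PS] (uc (rate_after a)).
Proof.
apply: measurable_funM; last exact: measurable_rate.
by apply: measurable_fun_if => //; exact: measurable_fun_ler.
Qed.

Lemma rate_after_bound (a s : R) x v : 0 <= s -> `|rate_after a s x v| <= 2 * (eta * eps) + eta * eps.
Proof.
move=> s0; rewrite /rate_after; case: ifP => _; rewrite ?mul1r ?mul0r ?rate_bound// normr0.
have e0 : 0 <= eps by exact: ltW.
by rewrite addr_ge0// !mulr_ge0.
Qed.

Lemma sol_along_mild (b : R) x v (s : R) : 0 <= s ->
  sol s (x - (b - s) *: v) v = f0 (x - b *: v) v + \int[leb]_(a in `[0, s]) rate a (x - (b - a) *: v) v.
Proof.
move=> s0; have apl := admissible_plim; have [mpl _ _ _] := apl.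
have mgp := measurable_time_along b x v (measurable_gain mpl).
exact: (duh_mild_ext p1 eta0 (f00 (x - b *: v) v) mgp (gain_along_ge0 apl b x v) (gain_along_le apl b x v)
    (F := fun s => sol s (x - (b - s) *: v) v) s0 (sol_along b x v)).
Qed.

Lemma sol_step (a b : R) x v : 0 <= a -> a <= b ->
  `|sol b x v - sol a (x - (b - a) *: v) v| <=
  \int[leb]_(s in `[0, b]) `|rate_after a s (x - (b - s) *: v) v|.
Proof.
move=> a0 ab; have b0 := le_trans a0 ab.
have mr := measurable_time_along b x v measurable_rate.
have ir (c : R) : leb.-integrable `[0%R, c] (EFin \o (fun s => rate s (x - (b - s) *: v) v)).
  apply: (@bounded_integrable _ c (2 * (eta * eps) + eta * eps)) => //.
  by move=> s s0 _; exact: rate_bound.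
have := sol_along_mild b x v b0; rewrite subrr scale0r subr0 => ->.
rewrite (sol_along_mild b x v a0) opprD addrACA subrr add0r.
rewrite Rintegral_itvB ?bnd_simp//.
have iab : leb.-integrable `]a, b] (EFin \o (fun s => rate s (x - (b - s) *: v) v)).
  apply: (integrableS _ _ _ (ir b)) => //.
  by move=> s; rewrite /= !in_itv/= => /andP[sa ->]; rewrite (le_trans a0)// ltW.
apply: (le_trans (le_normr_Rintegral _ iab)); first exact: measurable_itv.
have mra := measurable_time_along b x v (measurable_rate_after a).
have ira : leb.-integrable `[0%R, b] (EFin \o (fun s => `|rate_after a s (x - (b - s) *: v) v|)).
  apply: (@bounded_integrable _ b (2 * (eta * eps) + eta * eps)); first exact: measurableT_comp.
  by move=> s s0 _; rewrite normr_id rate_after_bound.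
rewrite /Rintegral fine_le//.
- by apply: integrable_fin_num => //; exact: integrable_abse iab.
- exact: integrable_fin_num ira.
apply: (@le_trans _ _ (\int[leb]_(s in `]a, b]) (`|rate_after a s (x - (b - s) *: v) v|)%:E)%E).
  apply: ge0_le_integral => //.
  - by apply: measurable_funTS; apply/measurable_EFinP; exact: measurableT_comp.
  - by apply: measurable_funTS; apply/measurable_EFinP; exact: measurableT_comp.
  move=> s; rewrite /= in_itv/= => /andP[sa _].
  by rewrite /rate_after (ltW sa) mul1r.
apply: ge0_subset_integral => //.
  by apply: measurable_funTS; apply/measurable_EFinP; exact: measurableT_comp.
by move=> s; rewrite /= !in_itv/= => /andP[sa ->]; rewrite (le_trans a0)// ltW.
Qed.

(** The solution follows free transport up to an error that is Lipschitz in time, because the norm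
    of its rate is bounded. *)
Lemma norm_L12_step (a b : R) : 0 <= a -> a <= b ->
  (norm_L12 (fun x v => sol b x v - sol a (x - (b - a) *: v) v)%R <= (Crate * (b - a))%:E)%E.
Proof.
move=> a0 ab; have [msl _ _ _] := admissible_sol.
have msh : mR6 (fun x v => sol a (x - (b - a) *: v) v).
  by apply: (measurableT_comp (uc_slice a msl) (g := fun z : R3 * R3 => (z.1 - (b - a) *: z.2, z.2))); exact: measurable_shear.
apply: (@le_trans _ _ (\int[leb]_(s in `[0%R, b]) norm_L12 (rate_after a s))%E).
  rewrite -(norm_L12_Rint b (measurable_rate_after a) (B := 2 * (eta * eps) + eta * eps)); last first.
    by move=> s x v; exact: rate_after_bound.
  apply: norm_L12_le.
  - exact: (mR6B (uc_slice b msl) msh).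
  - exact: (uc_slice b (measurable_Rint_along (measurable_rate_after a))).
  by move=> x v; apply: (le_trans (sol_step x v a0 ab)); exact: ler_norm.
apply: (@le_trans _ _ (\int[leb]_(s in `[a, b]) (cst Crate%:E s : \bar R))%E); last first.
  rewrite integral_cst//= lebesgue_measure_itv/= lte_fin; case: ifPn => ba.
    by rewrite -EFinD -EFinM.
  by rewrite mule0 lee_fin mulr_ge0 ?Crate_ge0// subr_ge0.
rewrite [X in (X <= _)%E]integral_mkcond [X in (_ <= X)%E]integral_mkcond.
apply: (@ge0_le_integral _ _ _ leb _ measurableT).
- by move=> s _; rewrite patchE; case: ifP => // _; exact: norm_L12_ge0.
- by apply/(measurable_restrictT _ (measurable_itv _)); apply: measurable_funTS; exact: measurable_norm_L12 (measurable_rate_after a).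
- by apply/(measurable_restrictT _ (measurable_itv _)); exact: measurable_cst.
move=> s _; rewrite !patchE !mem_setE !in_itv /=.
have nZ : norm_L12 (rate_after a s) = ((if a <= s then 1 else 0)%:E * norm_L12 (rate s))%E.
  by rewrite /rate_after norm_L12Z//; [case: ifP|exact: (uc_slice s measurable_rate)].
case: ifPn => [/andP[s0 sb]|ns].
  rewrite nZ sb andbT; case: ifP => _; rewrite ?mul1e ?mul0e//; exact: norm_L12_rate.
case: ifP => // _; rewrite lee_fin; exact: Crate_ge0.
Qed.

Lemma sol_fin (t : R) : 0 <= t -> (norm_L12 (sol t) < +oo)%E.
Proof. by move=> t0; rewrite (le_lt_trans (norm_L12_sol t0))// ltry. Qed.

Lemma sol_continuous : continuous_L12 sol.
Proof.
have [msl _ _ _] := admissible_sol.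
exact: (continuous_L12_of_steps msl sol_fin norm_L12_step).
Qed.

Lemma mild_solution_exists : exists f, [/\ mild_solution al be f0 f, admissible f &
  forall t : R, 0 <= t -> (norm_L12 (f t) <= (2 * N)%:E)%E].
Proof.
exists sol; split; [split|exact: admissible_sol|exact: norm_L12_sol].
  exact: sol_continuous.
apply: (@filterS _ _ (ae_filter_ringOfSetsType leb_txv) _ _ _ sol_mild) => -[t [x v]] /= H t0.
exact: H.
Qed.
End picard.
End map.
End scheme.
End existence.

(** * The theorem *)

Section norms.
Context {R : realType}.
Local Notation R3 := (R3 R).

Lemma norm_w_leP (q M : R) (h : R3 -> R3 -> R) :
  (norm_w q h <= M%:E)%E <-> forall x v, `|weight_w q v * h x v| <= M.
Proof.
split=> [H x v|H].
  rewrite -lee_fin; apply: le_trans H; apply: ereal_sup_ubound.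
  by exists (x, v).
by apply: ge_ereal_sup => _ [[x v] _ <-]; rewrite lee_fin H.
Qed.

Lemma norm_W_leP (r t M : R) (h : R3 -> R3 -> R) :
  (norm_W r t h <= M%:E)%E <-> forall x v, `|weight_W r t x v * h x v| <= M.
Proof.
split=> [H x v|H].
  rewrite -lee_fin; apply: le_trans H; apply: ereal_sup_ubound.
  by exists (x, v).
by apply: ge_ereal_sup => _ [[x v] _ <-]; rewrite lee_fin H.
Qed.

Lemma sup_time_leP (N : R -> \bar R) (M : \bar R) :
  (sup_time N <= M)%E <-> forall t : R, 0 <= t -> (N t <= M)%E.
Proof.
split=> [H t t0|H].
  by apply: le_trans H; apply: ereal_sup_ubound; exists t.
by apply: ge_ereal_sup => _ [t t0 <-]; exact: H.
Qed.

(** The choice of the size of the data. *)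
Lemma small_power (c al : R) : 0 < al -> 0 <= c ->
  exists2 e0 : R, 0 < e0 & forall e : R, 0 < e -> e <= e0 -> e <= 2^-1 /\ c * e `^ al <= 1.
Proof.
move=> al0 c0; have c1 : 0 < (c + 1)^-1 by rewrite invr_gt0 ltr_wpDl.
exists (Num.min 2^-1 ((c + 1)^-1 `^ al^-1)); first by rewrite lt_min invr_gt0 ltr0n powR_gt0.
move=> e e0; rewrite le_min => /andP[e2 ec]; split => //.
have : e `^ al <= (c + 1)^-1.
  have -> : (c + 1)^-1 = ((c + 1)^-1 `^ al^-1) `^ al.
    by rewrite -powRrM mulVf ?powRr1 ?gt_eqF// ltW.
  by apply: ge0_ler_powR; rewrite ?nnegrE ?powR_ge0 ?(ltW al0) ?(ltW e0).
move=> H; apply: (@le_trans _ _ (c * (c + 1)^-1)); first by rewrite ler_wpM2l.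
by rewrite ler_pdivrMr ?ltr_wpDl// mul1r lerDl.
Qed.

End norms.

Theorem theorem1p2 (R : realType) (q r : R) :
  exists2 C : R, 0 < C & forall alpha beta : R,
    3^-1 < alpha -> alpha <= 1 ->
    0 <= beta -> beta <= 1 ->
    2 <= 3 * alpha + 2 * beta ->
    Num.max (3 + 2 * (1 + beta) / alpha)
            (3 + 6 * beta / (3 * alpha - 1)) < q ->
    (3 < r /\ r < 3 * alpha + 2 - 3 * (3 * alpha + 2 * beta - 1) / q)
      \/ 5 < r ->
  exists2 eps0 : R, 0 < eps0 &
    forall (eps : R) (f0 : R3 R -> R3 R -> R),
      0 < eps -> eps <= eps0 ->
      (forall x v, 0 <= f0 x v) ->
      in_L12 f0 ->
      (norm_w q f0 <= (eps ^+ 2)%:E)%E ->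
      (norm_W r 0 f0 <= (eps ^+ 2)%:E)%E ->
  let is_solution (f : R -> R3 R -> R3 R -> R) :=
    [/\ mild_solution alpha beta f0 f,
        forall t x v, 0 <= t -> 0 <= f t x v,
        (sup_time (fun t => norm_w q (f t)) <= eps%:E)%E
          /\ (sup_time (fun t => norm_W r t (f t)) <= eps%:E)%E,
        forall t x, 0 <= t ->
          collision_freq (f t x) alpha beta
          <= C * eps `^ alpha
             * (1 + t ^+ 2) `^ (- (3 * alpha / 2) + 3 * beta / (q - 3)) &
        (sup_time (fun t => norm_L12 (f t)) <= 2%:E * norm_L12 f0)%E] in
  exists2 f, is_solution f &
    forall g, is_solution g -> forall t, 0 <= t -> eq_L12 (g t) (f t).
Proof.
(* The added 1 makes the constant positive whatever [q] and [r] are. *)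
exists (Cnu q r ^+ 2 + 1); first by rewrite ltr_wpDl// sqr_ge0.
move=> al be al3 al1 be0 be1 hab; rewrite gt_max => /andP[hq1 hq2] hr.
have al0 := rate_al0 al3; have q5 := rate_q5 al3 al1 be0 hq1.
have r3 := rate_r3 hr; have hq := rate_hq al3 hq1.
have [p [C0 [p1 C00 rates]]] := decay_rates al3 al1 be0 hq1 hq2 hr.
have cg0 : 0 <= (Cgm + 1 : R) by rewrite addr_ge0// Cgm_ge0.
(* The size of the data makes the integral of the damping, [C0 eps^al / (p - 1)], small. *)
have [e0 e00 He] : exists2 e0 : R, 0 < e0 & forall e : R, 0 < e -> e <= e0 ->
    e <= 2^-1 /\ ((Cgm + 1) * (C0 / (p - 1)) * 4) * e `^ al <= 1.
  apply: small_power => //.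
  by rewrite mulr_ge0// mulr_ge0// divr_ge0// subr_ge0 ltW.
exists e0 => // eps f0 eps0 /(He eps eps0)[eps2 epsC] f00 [mf0 ff0] f0w f0W is_solution.
have fn : norm_L12 f0 \is a fin_num by rewrite ge0_fin_numE// norm_L12_ge0.
pose N := fine (norm_L12 f0).
have N0 : 0 <= N by rewrite fine_ge0// norm_L12_ge0.
have nN : norm_L12 f0 = N%:E by rewrite /N fineK.
have eta0 : 0 <= C0 * eps `^ al by rewrite mulr_ge0// powR_ge0.
have small : (Cgm + 1) * (C0 * eps `^ al / (p - 1)) * 4 <= 1.
  by move: epsC; congr (_ <= _); ring.
have rates' (t : R) (x : R3 R) (h : R3 R -> R) : 0 <= t -> dclass q eps h ->
    (forall v, weight_W r t x v * h v <= eps) ->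
  [/\ collision_freq h al be <= lam p (C0 * eps `^ al) t,
      forall v, weight_w q v * (collision_freq h al be * maxwellian h v) <= lam p (C0 * eps `^ al) t * eps &
      forall v, weight_W r t x v * (collision_freq h al be * maxwellian h v) <= lam p (C0 * eps `^ al) t * eps].
  by move=> t0 ch hW; exact: rates.
have f0w' x v : weight_w q v * f0 x v <= eps ^+ 2.
  by apply: le_trans (ler_norm _) _; exact: ((norm_w_leP q (eps ^+ 2) f0).1 f0w x v).
have f0W' x v : weight_W r 0 x v * f0 x v <= eps ^+ 2.
  by apply: le_trans (ler_norm _) _; exact: ((norm_W_leP r 0 (eps ^+ 2) f0).1 f0W x v).
have nle : (norm_L12 f0 <= N%:E)%E by rewrite nN.
have [f [sf af Nf]] := mild_solution_exists q5 al0 al1 be0 be1 hab hq p1 eta0 eps0 eps2 small rates' mf0 f00 f0w' f0W' N0 nle.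
have [mf fp fw fW] := af.
have fc t x : 0 <= t -> dclass q eps (f t x) by exact: admissible_dclass af.
have one h : dclass q eps h -> dclass q 1 h.
  by move=> [mh hp hw]; split=> // v; apply: (le_trans (hw v)); rewrite (le_trans eps2)// invf_le1// ler1n.
exists f.
  split=> //.
  - split; apply/sup_time_leP => t t0.
      apply/norm_w_leP => x v; rewrite ger0_norm ?fw//.
      by apply: mulr_ge0; [exact: powR_ge0|exact: fp].
    apply/norm_W_leP => x v; rewrite ger0_norm ?fW//.
    by apply: mulr_ge0; [exact: powR_ge0|exact: fp].
  - move=> t x t0.
    have E0 : 0 <= eps `^ al * (1 + t ^+ 2) `^ (- (3 * al / 2) + 3 * be / (q - 3)).
      by rewrite mulr_ge0// powR_ge0.
    apply: (@le_trans _ _ (Cnu q r ^+ 2 * eps `^ al * (1 + t ^+ 2) `^ (- (3 * al / 2) + 3 * be / (q - 3)))).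
      have [r0|r0] := eqVneq (rho (f t x)) 0.
        by rewrite /collision_freq r0 eqxx -mulrA mulr_ge0// sqr_ge0.
      have rp : 0 < rho (f t x).
        by rewrite lt_neqAle eq_sym r0 rho_ge0//; exact: dclass_dens q5 (ltW eps0) (fc t x t0).
      apply: (decay_nu q5 r3 eps0 (fc t x t0) _ rp) => //.
      + by move=> v; exact: fW.
      + exact: ltW.
      + exact: (rate_kbe al3 al1 be0 hq1).
    by rewrite -mulrA -[X in _ <= X]mulrA ler_wpM2r// lerDl.
  - by apply/sup_time_leP => t t0; rewrite nN -EFinM; exact: Nf.
move=> g [sg gp [gw gW] _ gN] t t0.
have N20 : 0 <= 2 * N by rewrite mulr_ge0.
have [[_ ing _] _] := sg.
apply: (mild_solution_unique q5 al0 al1 be0 be1 hab hq N20 sg sf) => //.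
- move=> s x s0; apply: one; split.
  + by apply: mR6_slice; have [] := ing s s0.
  + by move=> v; exact: gp.
  + move=> v; apply: le_trans (ler_norm _) _.
    exact: (norm_w_leP _ _ _).1 ((sup_time_leP _ _).1 gw s s0) x v.
- by move=> s x s0; apply: one; exact: fc.
- by move=> s s0; rewrite EFinM -nN; exact: (sup_time_leP _ _).1 gN s s0.
Qed.
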